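(* Let $n\ge2$ and let $\Omega \subset \mathbb{R}^n$ be a bounded Lipschitz domain. Then there exists a divergence-free field $\mathbf{F} \in L^1(\mathbb{R}^n;\mathbb{R}^n)$ with precise majorant $h$ such that $$\int_{\partial\Omega} h \,\mathrm{d}\mathcal{H}^{n-1} = \infty \quad\text{whereas}\quad \lim_{\varepsilon \downarrow 0} \frac1{2\varepsilon} \int_{B_{\varepsilon}(\partial\Omega)} |\mathbf{F}| \,\mathrm{d} x < \infty.$$
   Context: Notation: $\mathcal{H}^{n-1}$ is the $(n-1)$-dimensional Hausdorff measure; $B_r(x)$ is the ball of radius $r$ centred at $x$, $B_r=B_r(0)$; for $A\subset\mathbb{R}^n$, $B_\varepsilon(A) = A+B_\varepsilon$. Divergence-free means that the distributional divergence on $\mathbb{R}^n$ vanishes. Precise majorant. Fix once and for all a standard radial mollifier $\rho\in C_c^\infty(B_1)$ on $\mathbb{R}^n$ (non-negative, radial, $\int\rho=1$, $\rho(0)>0$) and put $\rho_\delta(x)=\delta^{-n}\rho(x/\delta)$. For a non-negative scalar function $F\in L^1(\mathbb{R}^n)$ choose a sequence $\delta_k\downarrow0$ such that $F_k:=F*\rho_{\delta_k}$ satisfies $\|F_{k+1}-F_k\|_{L^1(\mathbb{R}^n)}\le 2^{-k}$ for all $k\in\mathbb{N}$. Set $F^*(x)=\lim_{k\to\infty}F_k(x)$ if the limit exists and $F^*(x)=0$ otherwise, and define $$h(x):=|F_1(x)|+\sum_{k=1}^\infty|F_{k+1}(x)-F_k(x)|+|F^*(x)|,$$ with $h(x)=\infty$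 if the series diverges. Any such $h$ is called a precise majorant of $F$. For a vector field $\mathbf{F}=(F_1,\dots,F_n)\in L^1(\mathbb{R}^n;\mathbb{R}^n)$ (subscripts now denoting components) write $F_i=F_i^+-F_i^-$ with positive and negative parts, let $h_i^\pm$ be precise majorants of $F_i^\pm$ chosen along a common sequence $\delta_k\downarrow0$, and call $h:=\sum_{i=1}^n(h_i^++h_i^-)$ a precise majorant of $\mathbf{F}$. *)

(* Defs.v *)
From HB Require Import structures.
From mathcomp Require Import all_boot all_order all_algebra.
From mathcomp Require Import all_classical all_reals all_analysis.

Set Implicit Arguments.
Unset Strict Implicit.
Unset Printing Implicit Defensive.

Import Order.TTheory GRing.Theory Num.Theory.
Import numFieldNormedType.Exports.

Local Open Scope classical_set_scope.
Local Open Scope ring_scope.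

(* The library norm on 'rV[R]_n is the maximum norm: it induces the right     *)
(* topology, but balls, diameters and lengths below are Euclidean.            *)
Section euclidean.
Context {R : realType} {n : nat}.
Implicit Types (x y : 'rV[R]_n) (A : set 'rV[R]_n).

Definition enorm x : R := Num.sqrt (\sum_(i < n) x ord0 i ^+ 2).

Definition eball x (r : R) : set 'rV[R]_n := [set y | enorm (y - x) < r].

(* A + B_eps *)
Definition enbhd (eps : R) A : set 'rV[R]_n :=
  [set x | exists2 a, A a & eball a eps x].

(* -oo for the empty set *)
Definition ediam A : \bar R :=
  ereal_sup [set (enorm (x - y))%:E | x in A & y in A].

Definition frontier A : set 'rV[R]_n := closure A `\` interior A.

End euclidean.

Section borel.
Context (R : realType) (n : nat).
Let G : set (set 'rV[R]_n) := open.

HB.instance Definition _ := @isMeasurable.Build (sigma_display G) 'rV[R]_n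
  <<s G >> (@sigma_algebra0 _ setT G) (@sigma_algebraC _ G)
  (@sigma_algebra_bigcup _ setT G).

End borel.

Section borel_theory.
Context {R : realType}.

Lemma open_measurable_rV n (U : set 'rV[R]_n) : open U -> measurable U.
Proof. by move=> oU; exact: sub_sigma_algebra. Qed.

Lemma measurable_coord n (i : 'I_n) :
  measurable_fun setT (fun x : 'rV[R]_n => x ord0 i : measurableTypeR R).
Proof.
apply: (@measurability _ _ _ _ _ _ (@measurable_realfun.RGenOpens.G R)).
  exact: measurable_realfun.RGenOpens.measurableE.
move=> _ [_ [a [b ->]] <-]; rewrite setTI.
apply: open_measurable_rV.
have /continuousP := @coord_continuous R 1 n ord0 i.
apply; exact: interval_open.
Qed.

Let box n (q : 'rV[rat]_n * 'rV[rat]_n) : set 'rV[R]_n :=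
  [set v | forall i, ratr (q.1 ord0 i) < v ord0 i < ratr (q.2 ord0 i)].

Lemma open_bigcup_box n (U : set 'rV[R]_n) : open U ->
  U = \bigcup_(q in [set q | box q `<=` U]) box q.
Proof.
move=> oU; apply/seteqP; split => [v Uv|v [q /= + qv]]; last exact.
have /nbhs_ballP[e /= e0 eU] : nbhs v U by exact: open_nbhs_nbhs.
have H (i : 'I_n) : exists q : rat * rat,
    [/\ v ord0 i - e < ratr q.1 < v ord0 i
      & v ord0 i < ratr q.2 < v ord0 i + e].
  have [|p pI] := @rat_in_itvoo R (v ord0 i - e) (v ord0 i).
    by rewrite ltrBlDr ltrDl.
  have [|q qI] := @rat_in_itvoo R (v ord0 i) (v ord0 i + e).
    by rewrite ltrDl.
  by exists (p, q).
have [f fP] := choice H.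
exists (\row_i (f i).1, \row_i (f i).2) => [w wb|] /=; last first.
  by move=> i; rewrite !mxE; have [/andP[_ ->] /andP[-> _]] := fP i.
apply: eU; split => // i j; rewrite ord1.
have := wb j; rewrite /= !mxE => /andP[w1 w2].
have [/andP[a1 a2] /andP[b1 b2]] := fP j.
rewrite /ball /= distrC ltr_distl.
by rewrite (lt_trans a1 w1) (lt_trans w2 b2).
Qed.

Lemma measurable_fun_rV d (T : measurableType d) n (f : T -> 'rV[R]_n) :
  (forall i, measurable_fun setT (fun x => f x ord0 i : measurableTypeR R)) ->
  measurable_fun setT f.
Proof.
move=> mf; apply: (@measurability _ _ _ _ _ _ (@open 'rV[R]_n)) => //.
move=> _ [U oU <-]; rewrite setTI (open_bigcup_box oU) preimage_bigcup.
rewrite bigcup_mkcond; apply: countable_bigcupT_measurable => // q.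
case: ifPn => // _.
rewrite (_ : _ @^-1` _ = \bigcap_(i in [set: 'I_n])
    ((fun x => f x ord0 i) @^-1` `]ratr (q.1 ord0 i), ratr (q.2 ord0 i)[)).
  apply: fin_bigcap_measurable => // i _; rewrite -[X in measurable X]setTI.
  by apply: mf => //; exact: measurable_itv.
apply/seteqP; split => x /= xq i; first by move=> _; rewrite /= in_itv; exact: xq.
by have := xq i Logic.I; rewrite /= in_itv.
Qed.

(* (t, v) |-> (t, v_0, ..., v_{n-1}) *)
Definition cons_rV n (p : measurableTypeR R * 'rV[R]_n) : 'rV[R]_n.+1 :=
  \row_i oapp (p.2 ord0) p.1 (unlift ord0 i).

Let uncons_rV n (x : 'rV[R]_n.+1) : measurableTypeR R * 'rV[R]_n :=
  (x ord0 ord0, \row_i x ord0 (lift ord0 i)).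

Let cons_rVK n : cancel (@cons_rV n) (@uncons_rV n).
Proof.
move=> [t v]; rewrite /uncons_rV /cons_rV mxE unlift_none/=; congr (_, _).
by apply/rowP => i; rewrite !mxE liftK.
Qed.

Let cons_rV0 n (p : measurableTypeR R * 'rV[R]_n) : cons_rV p ord0 ord0 = p.1.
Proof. by rewrite mxE unlift_none. Qed.

Let cons_rVS n (p : measurableTypeR R * 'rV[R]_n) i :
  cons_rV p ord0 (lift ord0 i) = p.2 ord0 i.
Proof. by rewrite mxE liftK. Qed.

Lemma measurable_cons_rV n : measurable_fun setT (@cons_rV n).
Proof.
apply: measurable_fun_rV => i; have [j ->|->] := unliftP ord0 i.
  under eq_fun do rewrite cons_rVS.
  by apply: (measurableT_comp (measurable_coord j)); exact: measurable_snd.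
under eq_fun do rewrite cons_rV0.
exact: measurable_fst.
Qed.

Let measurable_uncons_rV n : measurable_fun setT (@uncons_rV n).
Proof.
apply: measurable_fun_pair; first exact: measurable_coord.
apply: measurable_fun_rV => i; under eq_fun do rewrite mxE.
exact: measurable_coord.
Qed.

Section lebesgue_step.
Local Open Scope ereal_scope.
Variables (n : nat) (mu : {sigma_finite_measure set 'rV[R]_n -> \bar R}).

Definition lebesgue_cons : set 'rV[R]_n.+1 -> \bar R :=
  pushforward (@lebesgue_measure R \x mu) (@cons_rV n).

Let mlambda : {measure set (measurableTypeR R * 'rV[R]_n)%type -> \bar R} :=
  (@lebesgue_measure R \x mu).

Let mpre A : measurable A -> measurable (@cons_rV n @^-1` A).
Proof.
by move=> mA; rewrite -[X in measurable X]setTI; exact: measurable_cons_rV.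
Qed.

Let lebesgue_cons0 : lebesgue_cons set0 = 0.
Proof. by rewrite /lebesgue_cons /pushforward preimage_set0 (measure0 mlambda). Qed.

Let lebesgue_cons_ge0 A : 0 <= lebesgue_cons A.
Proof. exact: (measure_ge0 mlambda). Qed.

Let lebesgue_cons_sigma_additive : semi_sigma_additive lebesgue_cons.
Proof.
move=> F mF tF mUF; rewrite /lebesgue_cons /pushforward preimage_bigcup.
apply: (@measure_semi_sigma_additive _ _ _ mlambda).
- by move=> k; exact: mpre.
- apply/trivIsetP => /= i j _ _ ij; rewrite -preimage_setI.
  by move/trivIsetP : tF => /(_ _ _ _ _ ij) ->//; rewrite preimage_set0.
- by rewrite -preimage_bigcup; exact: mpre.
Qed.

HB.instance Definition _ := isMeasure.Build _ _ _ lebesgue_cons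
  lebesgue_cons0 lebesgue_cons_ge0 lebesgue_cons_sigma_additive.

Let lebesgue_cons_sigma_finite : sigma_finite setT lebesgue_cons.
Proof.
have /sigma_finiteP[F [TF ndF Foo]] := sigma_finiteT (@lebesgue_measure R).
have /sigma_finiteP[G [TG ndG Goo]] := sigma_finiteT mu.
exists (fun k => @uncons_rV n @^-1` (F k `*` G k)).
  rewrite -preimage_bigcup -[LHS](preimage_setT (@uncons_rV n)).
  congr preimage; rewrite -setXTT TF TG.
  apply/seteqP; split=> [[x y] [/= [k _ Fx] [l _ Gy]]|[x y] [k _ [/= Fx Gy]]].
    exists (maxn k l) => //; split.
    - by move: x Fx; exact/subsetPset/ndF/leq_maxl.
    - by move: y Gy; exact/subsetPset/ndG/leq_maxr.
  by split; exists k.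
move=> k; have [mF Fkoo] := Foo k; have [mG Gkoo] := Goo k; split.
  by rewrite -[X in measurable X]setTI; apply: measurable_uncons_rV => //; exact: measurableX.
rewrite /lebesgue_cons /pushforward -comp_preimage.
rewrite (_ : _ \o _ = id) ?product_measure1E ?lte_mul_pinfty ?ge0_fin_numE//.
  by apply/funext => p /=; rewrite cons_rVK.
Qed.

HB.instance Definition _ := Measure_isSigmaFinite.Build _ _ _ lebesgue_cons
  lebesgue_cons_sigma_finite.

End lebesgue_step.

End borel_theory.

(* Lebesgue measure on R^n: the n-fold product of the Lebesgue measure on R.  *)
Fixpoint lebesgue_rV (R : realType) (n : nat) : {sigma_finite_measure set 'rV[R]_n -> \bar R} :=
  if n is m.+1 then lebesgue_cons (lebesgue_rV R m)
  else \d_(0 : 'rV[R]_0).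

Section hausdorff.
Local Open Scope ereal_scope.
Context (R : realType) (n m : nat).
Implicit Types (A : set 'rV[R]_n) (d : R).

(* omega_m (diam A / 2)^m, where omega_m is the volume of the unit ball of    *)
(* R^m; the empty set counts for 0, also when m = 0.                          *)
Definition hausdorff_gauge A : \bar R :=
  if `[< A = set0 >] then 0
  else lebesgue_rV R m (eball 0%R 1%R) * (2^-1%:E * ediam A) ^+ m.

(* The covering pieces are arbitrary, possibly empty, subsets of R^n.         *)
Definition hausdorff_content d A : \bar R :=
  ereal_inf [set \sum_(0 <= k <oo) hausdorff_gauge (C k) |
    C in [set C : (set 'rV[R]_n)^nat |
      A `<=` \bigcup_k C k /\ forall k, ediam (C k) <= d%:E]].

Definition hausdorff_outer A : \bar R :=
  ereal_sup [set hausdorff_content d A | d in [set d : R | (0 < d)%R]].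

Lemma ediam_ge0 A : A !=set0 -> 0 <= ediam A.
Proof.
move=> [x Ax]; apply: ereal_sup_ubound; exists x => //; exists x => //.
rewrite subrr /enorm big1 ?sqrtr0// => i _.
by rewrite mxE expr0n.
Qed.

Lemma hausdorff_gauge0 : hausdorff_gauge set0 = 0.
Proof. by rewrite /hausdorff_gauge asboolT. Qed.

Lemma hausdorff_gauge_ge0 A : 0 <= hausdorff_gauge A.
Proof.
rewrite /hausdorff_gauge; case: asboolP => // /eqP/set0P A0.
apply: mule_ge0 => //; apply: expe_ge0; apply: mule_ge0; rewrite ?lee_fin//.
exact: ediam_ge0.
Qed.

(* Allowing only pieces of diameter at most d amounts to giving the others    *)
(* infinite weight; the library construction mu_ext then applies, every set   *)
(* being declared measurable.                                                 *)
Let all_sets := g_sigma_algebraType (@setT (set 'rV[R]_n)).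

Let gauge d (A : set all_sets) : \bar R :=
  if ediam (A : set 'rV[R]_n) <= d%:E then hausdorff_gauge A else +oo.

Let gauge_ge0 d A : 0 <= gauge d A.
Proof. by rewrite /gauge; case: ifP => // _; exact: hausdorff_gauge_ge0. Qed.

Let gauge0 d : gauge d set0 = 0.
Proof.
rewrite /gauge hausdorff_gauge0 ifT//.
by apply: ge_ereal_sup => _ [x []].
Qed.

Let contentE d : hausdorff_content d = mu_ext (gauge d).
Proof.
apply/funext => A; apply/eqP; rewrite eq_le; apply/andP; split.
  apply: le_ereal_inf_tmp => _ [C [_ AC] <-].
  have [Cd|] := pselect (forall k, ediam (C k : set 'rV[R]_n) <= d%:E).
    apply: ereal_inf_lbound; exists C => //.
    by apply: eq_eseriesr => k _; rewrite /gauge Cd.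
  move=> /existsNP[k /negP kd]; rewrite (eseries_pinfty (k := k)) ?leey//.
    by move=> i _; rewrite -ltNye (lt_le_trans ltNy0) ?gauge_ge0.
  by rewrite /gauge (negbTE kd).
apply: le_ereal_inf_tmp => _ [C [AC Cd] <-].
apply: ereal_inf_lbound; exists C.
  by split=> // k; exact: sub_sigma_algebra.
by apply: eq_eseriesr => k _; rewrite /gauge Cd.
Qed.

Let outer0 : hausdorff_outer set0 = 0.
Proof.
apply/eqP; rewrite eq_le; apply/andP; split.
  by apply: ge_ereal_sup => _ [d d0 <-]; rewrite contentE mu_ext0.
apply: ereal_sup_ubound; exists 1%R => //=.
by rewrite contentE mu_ext0.
Qed.

Let outer_ge0 A : 0 <= hausdorff_outer A.
Proof.
apply: le_trans (ereal_sup_ubound _); last by exists 1%R => //=.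
by rewrite contentE; exact: mu_ext_ge0.
Qed.

Let outer_le : {homo hausdorff_outer : A B / A `<=` B >-> A <= B}.
Proof.
move=> A B AB; apply: ge_ereal_sup => _ [d d0 <-].
apply: le_trans (ereal_sup_ubound _); last by exists d.
by rewrite contentE; exact: le_mu_ext.
Qed.

Let outer_sigma_subadditive : sigma_subadditive hausdorff_outer.
Proof.
move=> A; apply: ge_ereal_sup => _ [d d0 <-]; rewrite contentE.
apply: le_trans (mu_ext_sigma_subadditive _ _) _ => //.
apply: lee_nneseries => [k _ _|k _]; first exact: mu_ext_ge0.
by apply: ereal_sup_ubound; exists d => //; rewrite contentE.
Qed.

HB.instance Definition _ := isOuterMeasure.Build R 'rV[R]_n hausdorff_outer
  outer0 outer_ge0 outer_le outer_sigma_subadditive.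

End hausdorff.

(* The m-dimensional Hausdorff measure of R^n, on the Caratheodory measurable *)
(* sets.                                                                      *)
Definition hausdorff_measure (R : realType) (n m : nat) :=
  let mu : {outer_measure set 'rV[R]_n -> \bar R} :=
    @hausdorff_outer R n m in
  mu : {measure set (caratheodory_type mu) -> \bar R}.

Section smooth.
Context {R : realType} {n : nat}.
Implicit Types f phi rho : 'rV[R]_n -> R.

Definition partial (i : 'I_n) f : 'rV[R]_n -> R := 'D_(delta_mx ord0 i) f.

Definition smooth f := forall s : seq 'I_n,
  let g := foldr partial f s in
  continuous g /\ forall i x, derivable g x (delta_mx ord0 i).

Definition closed_support f : set 'rV[R]_n := closure [set x | f x != 0].

(* C_c^oo(U), for U open *)
Definition test_function (U : set 'rV[R]_n) f :=
  [/\ smooth f, compact (closed_support f) & closed_support f `<=` U].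

Definition standard_mollifier rho :=
  [/\ test_function (eball 0 1) rho,
      forall x, 0 <= rho x,
      forall x y, enorm x = enorm y -> rho x = rho y,
      (\int[lebesgue_rV R n]_x (rho x)%:E = 1)%E
    & 0 < rho 0].

Definition rescale rho (delta : R) : 'rV[R]_n -> R :=
  fun x => delta ^- n * rho (delta^-1 *: x).

Definition convolution f g : 'rV[R]_n -> R :=
  fun x => \int[lebesgue_rV R n]_y (f y * g (x - y)).

End smooth.

Section vector_fields.
Context {R : realType} {n : nat}.
Implicit Types F : 'rV[R]_n -> 'rV[R]_n.

Definition component F (i : 'I_n) : 'rV[R]_n -> R := fun x => F x ord0 i.

Definition integrable_field F := forall i,
  (lebesgue_rV R n).-integrable setT (EFin \o component F i).

Definition divergence_free F := forall phi, test_function setT phi ->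
  (\int[lebesgue_rV R n]_x
    (\sum_(i < n) component F i x * partial i phi x)%:E = 0)%E.

End vector_fields.

(* Sequences of scales are indexed from 1: the value of delta at 0 is not     *)
(* used.                                                                      *)
Section precise_majorant.
Context {R : realType} {n : nat} (rho : 'rV[R]_n -> R) (delta : R^nat).
Implicit Types F : 'rV[R]_n -> R.

Definition mollify F (k : nat) : 'rV[R]_n -> R :=
  convolution F (rescale rho (delta k)).

Definition fast_approximation F := forall k, (1 <= k)%N ->
  (\int[lebesgue_rV R n]_x `|mollify F k.+1 x - mollify F k x|%:E
    <= (2 ^- k)%:E)%E.

Definition precise_representative F : 'rV[R]_n -> R := fun x =>
  if `[< cvgn (fun k => mollify F k x) >] then limn (fun k => mollify F k x)
  else 0.

Definition majorant F : 'rV[R]_n -> \bar R := fun x =>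
  (`|mollify F 1 x|%:E
   + \sum_(1 <= k <oo) `|mollify F k.+1 x - mollify F k x|%:E
   + `|precise_representative F x|%:E)%E.

End precise_majorant.

Definition decreases_to_zero {R : realType} (delta : R^nat) :=
  [/\ decreasing_seq delta, forall k, 0 < delta k & delta @ \oo --> (0 : R)].

Definition precise_majorant {R : realType} {n : nat} (rho : 'rV[R]_n -> R)
    (F : 'rV[R]_n -> 'rV[R]_n) (h : 'rV[R]_n -> \bar R) :=
  exists delta : R^nat,
    [/\ decreases_to_zero delta,
        forall i, fast_approximation rho delta (component F i)^\+,
        forall i, fast_approximation rho delta (component F i)^\-
      & forall x, (h x = \sum_(i < n)
          (majorant rho delta (component F i)^\+%R x
           + majorant rho delta (component F i)^\-%R x))%E].

Section lipschitz_domain.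
Context {R : realType} {n : nat}.
Implicit Types Omega : set 'rV[R]_n.

(* In the orthonormal coordinates z = y *m Q, the set is, near the point x,   *)
(* the region above the graph of g over the coordinates of z other than the   *)
(* j-th one.                                                                  *)
Definition lipschitz_epigraph_near Omega (x : 'rV[R]_n) :=
  exists (r : R) (Q : 'M[R]_n) (j : 'I_n) (g : 'rV[R]_n.-1 -> R) (L : R),
    [/\ 0 < r,
        Q *m Q^T = 1%:M,
        forall u v, `|g u - g v| <= L * enorm (u - v)
      & Omega `&` eball x r =
        [set y | g (col' j (y *m Q)) < (y *m Q) ord0 j] `&` eball x r].

Definition bounded_lipschitz_domain Omega :=
  [/\ Omega !=set0, open Omega, connected Omega, bounded_set Omega
    & forall x, frontier Omega x -> lipschitz_epigraph_near Omega x].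

End lipschitz_domain.

(* Main.v *)
From HB Require Import structures.
Require Import Defs.
From mathcomp Require Import all_boot all_order all_algebra.
From mathcomp Require Import all_classical all_reals all_analysis.
From mathcomp Require Import measurable_realfun.
From mathcomp Require Import zify lra ring.

(** A precise majorant h dominates on the boundary the sum of the jumps
    between consecutive mollifications of F, whereas the averages over thin
    neighbourhoods of the boundary only see the mass of F. A vortex is a
    compactly supported divergence-free field. Let h_j be a sequence of heights
    that decreases geometrically, and put near one boundary point q, for every
    j, a vortex of mass about h_j / (j + 1) that is supported within 2 h_j of q
    but stays at distance h_j / 2 from the whole boundary.

    - A neighbourhood of radius eps, between h_k / 2 and h_(k-1) / 2, only meets
      the vortices from k on. Their mass is at most a constant times
      h_k / (k + 1), so the averages tend to 0 (nbhd_limit).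
    - Mollified at a scale C h_k, the k-th vortex leaves a trace of size about
      h_k ^ (1 - n) / (k + 1) on the part of the boundary within h_k of q
      (mollified_ge), while at the previous scale everything that the boundary
      sees is smaller by a large factor because n is at least 2 (mollified_le,
      mollified_jump). That part of the boundary has measure at least
      c h_k ^ (n - 1) (lipschitz_frontier_density). So each jump contributes
      about 1 / (k + 1) to the integral of h, and the harmonic series diverges.

    The vortices are copies of the rotated gradient of the mollifier itself in
    the plane of two coordinates (curl_field); it is divergence-free because
    mixed derivatives commute (integral_curl). They are centred on the segment
    from q to a point p0 of the domain whose nearest boundary point is q: the
    point at distance t from q on this segment has distance t from the boundary
    (touching_segment). The mollifications along the scales C h_k converge fast
    in L1: a translation by C h_k changes a vortex much larger than h_k little,
    since it is Lipschitz, and the much smaller ones have little mass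
    (tower_shift_L1).

    On the geometric side, the boundary is locally a Lipschitz graph, whose
    projection to a hyperplane contains a ball; and the Lebesgue measure of a
    projection is at most a constant times the Hausdorff measure of the set
    (hausdorff_outer_ge_projection).
    The integral over the boundary is bounded below by simple functions on
    closed sets, which are measurable by the criterion of Caratheodory
    (caratheodory_closed).

    Norms and balls are those of the maximum norm, unless they are called enorm
    and eball. The maximum norm is at most the Euclidean one, so Euclidean
    neighbourhoods and Euclidean unit balls lie in those of the maximum norm. *)

Set Implicit Arguments.
Unset Strict Implicit.
Unset Printing Implicit Defensive.

Import Order.TTheory GRing.Theory Num.Theory.
Import numFieldNormedType.Exports.

Local Open Scope classical_set_scope.
Local Open Scope ring_scope.

(** * Continuous functions and monotonicity of the integral *)

Section continuous_functions.
Context {R : realType} {T : topologicalType}.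
Implicit Types f g : T -> R.

Lemma fun_continuousD f g : continuous f -> continuous g -> continuous (fun x => f x + g x).
Proof. by move=> cf cg x; apply: cvgD; [exact: cf|exact: cg]. Qed.

Lemma fun_continuousB f g : continuous f -> continuous g -> continuous (fun x => f x - g x).
Proof. by move=> cf cg x; apply: cvgB; [exact: cf|exact: cg]. Qed.

Lemma fun_continuousM f g : continuous f -> continuous g -> continuous (fun x => f x * g x).
Proof. by move=> cf cg x; apply: cvgM; [exact: cf|exact: cg]. Qed.

Lemma fun_continuous_cst (a : R) : continuous (fun _ : T => a).
Proof. by move=> x; exact: cvg_cst. Qed.

Lemma fun_continuous_sum (I : Type) (r : seq I) (f : I -> T -> R) :
  (forall i, continuous (f i)) -> continuous (fun x => \sum_(i <- r) f i x).
Proof.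
move=> cf; elim: r => [|i r IH].
  by under eq_fun do rewrite big_nil; exact: fun_continuous_cst.
under eq_fun do rewrite big_cons.
exact: fun_continuousD.
Qed.

Lemma fun_continuous_norm f : continuous f -> continuous (fun x => `|f x|).
Proof. by move=> cf x; apply: cvg_norm; exact: cf. Qed.

End continuous_functions.

Lemma continuous_affine_rV (R : realType) n (a : 'rV[R]_n) (t : R) :
  continuous (fun y : 'rV[R]_n => a + t *: y).
Proof.
move=> x; apply: (@cvgD R 'rV[R]_n _ (nbhs x)); first exact: cvg_cst.
exact: (@cvgZl_tmp R 'rV[R]_n _ (nbhs x) _ t id x (@cvg_id _ _)).
Qed.

Lemma continuous_comp_rV (R : realType) n m (a : 'rV[R]_n -> 'rV[R]_m)
    (f : 'rV[R]_m -> R) : continuous a -> continuous f -> continuous (f \o a).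
Proof. by move=> ca cf x; apply: continuous_comp; [exact: ca|exact: cf]. Qed.

Section integral_mono.
Local Open Scope ereal_scope.
Context d (T : measurableType d) (R : realType).
Variable mu : {measure set T -> \bar R}.

(** The integral of a non-negative function is a supremum over the simple
    functions below it, so it is monotone on all functions, measurable or not.
    The majorant on the boundary is handled in this way. *)
Lemma integral_mono (D : set T) (f g : T -> \bar R) :
  (forall x, D x -> 0 <= f x) -> (forall x, D x -> f x <= g x) ->
  \int[mu]_(x in D) f x <= \int[mu]_(x in D) g x.
Proof.
move=> f0 fg.
have g0 x : D x -> 0 <= g x by move=> Dx; exact: le_trans (f0 _ Dx) (fg _ Dx).
rewrite !ge0_integralE//; apply: le_ereal_sup => _ [h hf <-].
exists h => //= x; apply: le_trans (hf x) _.
by apply: lee_restrict.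
Qed.

End integral_mono.

(** * Lebesgue measure on R^n *)

Section lebesgue_1d.
Context {R : realType}.
Local Notation lam := (@lebesgue_measure R).
Variables (a t : R).
Hypothesis t0 : t != 0.

Let phi (s : measurableTypeR R) : measurableTypeR R := a + t * s.

Let mphi : measurable_fun setT phi.
Proof.
apply: (@continuous_measurable_fun R phi) => x.
apply: cvgD; first exact: cvg_cst.
by apply: cvgM; [exact: cvg_cst|exact: cvg_id].
Qed.

HB.instance Definition _ := isMeasurableFun.Build _ _ _ _ phi mphi.

Let abst : {nonneg R} := NngNum (normr_ge0 t).

Let affine_itv (u v : R) : (u <= v)%R ->
  lam (phi @^-1` `]u, v]) = ((`|t|^-1) * (v - u))%:E.
Proof.
move=> uv; have [tgt|tlt] := ltP 0 t.
  rewrite (_ : _ @^-1` _ = `](u - a) / t, (v - a) / t]%classic).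
    rewrite lebesgue_measure_itv/= lte_fin gtr0_norm//.
    case: ifPn => [|]; rewrite ltr_pM2r ?invr_gt0// ltrD2r.
      by rewrite -EFinD => _; congr EFin; field.
    by rewrite -leNgt => vu; have -> : u = v by [apply/eqP; rewrite eq_le uv vu];
      rewrite subrr mulr0.
  by apply/seteqP; split => x /=; rewrite /phi !in_itv/= ltr_pdivrMr// ler_pdivlMr//
    ltrBlDr lerBrDr addrC (mulrC x).
have {tlt} tn : t < 0 by rewrite lt_neqAle t0.
rewrite (_ : _ @^-1` _ = `[(v - a) / t, (u - a) / t[%classic).
  rewrite lebesgue_measure_itv/= lte_fin ltr0_norm//.
  case: ifPn => [|]; rewrite ltr_nM2r ?invr_lt0// ltrD2r.
    by rewrite -EFinD => _; congr EFin; field.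
  by rewrite -leNgt => vu; have -> : u = v by [apply/eqP; rewrite eq_le uv vu];
    rewrite subrr mulr0.
by apply/seteqP; split => x /=; rewrite /phi !in_itv/= ltr_ndivlMr// ler_ndivrMr//
  ltrBlDr lerBrDr andbC addrC (mulrC x).
Qed.

(** The image of Lebesgue measure, scaled by |t|, has the same values as Lebesgue
    measure on half-open intervals. *)
Lemma lebesgue_integral_affine (f : R -> \bar R) :
  measurable_fun setT (f : measurableTypeR R -> \bar R) ->
  (forall x, 0 <= f x)%E ->
  (\int[lam]_x f (a + t * x)%R = (`|t|^-1)%:E * \int[lam]_x f x)%E.
Proof.
move=> mf f0.
have E A : measurable A -> lam A = mscale abst (pushforward lam phi) A.
  apply: lebesgue_measure_unique => _ [[u v]/= _ <-].
  rewrite /mscale/= /pushforward.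
  have [vu|uv] := ltP v u.
    by rewrite set_itv_ge ?bnd_simp -?leNgt ?ltW// preimage_set0 !measure0 mule0.
  have -> := @lebesgue_measure_itv R `]u, v].
  rewrite affine_itv//= lte_fin -EFinM mulrA divff ?normr_eq0// mul1r.
  by case: ltgtP uv => // ->; rewrite subrr.
rewrite [in RHS](eq_measure_integral (mscale abst (pushforward lam phi))); last first.
  by move=> A mA _; exact: E.
rewrite ge0_integral_mscale// ge0_integral_pushforward//.
by rewrite preimage_setT muleA -EFinM mulVf ?normr_eq0// mul1e.
Qed.

End lebesgue_1d.

Section lebesgue_rV_theory.
Context {R : realType}.
Local Notation lam := (@lebesgue_measure R).

Lemma ge0_integral_rVS n (f : 'rV[R]_n.+1 -> \bar R) :
  measurable_fun setT f -> (forall x, 0 <= f x)%E ->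
  (\int[lebesgue_rV R n.+1]_x f x =
   \int[lam]_s \int[lebesgue_rV R n]_v f (cons_rV (s, v)))%E.
Proof.
move=> mf f0.
have mc := @measurable_cons_rV R n.
pose m := (lam \x lebesgue_rV R n)%E.
rewrite -(fubini_tonelli1 (fun z => f (cons_rV z)))//; last exact: measurableT_comp.
transitivity (\int[pushforward m (@cons_rV R n)]_x f x)%E.
  by apply: eq_measure_integral.
by rewrite ge0_integral_pushforward// preimage_setT.
Qed.

Lemma continuous_measurable_rV n (f : 'rV[R]_n -> R) :
  continuous f -> measurable_fun setT (f : 'rV[R]_n -> measurableTypeR R).
Proof.
move=> cf; apply: (@measurability _ _ _ _ _ _ (@RGenOpens.G R)).
  exact: RGenOpens.measurableE.
move=> _ [_ [a [b ->]] <-]; rewrite setTI.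
apply: open_measurable_rV.
have /continuousP := cf; apply; exact: interval_open.
Qed.

Lemma measurable_affine_rV n (a : 'rV[R]_n) (t : R) :
  measurable_fun setT (fun x : 'rV[R]_n => a + t *: x).
Proof.
apply: measurable_fun_rV => i; apply: continuous_measurable_rV.
rewrite (_ : (fun y => _) = (fun y : 'rV[R]_n => a ord0 i + t * y ord0 i)).
  apply: fun_continuousD; first exact: fun_continuous_cst.
  by apply: fun_continuousM; [exact: fun_continuous_cst|exact: coord_continuous].
by apply/funext => y; rewrite !mxE.
Qed.

(** The one-dimensional change of variables, one coordinate at a time. *)
Lemma ge0_integral_affine n (a : 'rV[R]_n) (t : R) (f : 'rV[R]_n -> \bar R) :
  t != 0 -> measurable_fun setT f -> (forall x, 0 <= f x)%E ->
  (\int[lebesgue_rV R n]_x f (a + t *: x)%R =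
   (`|t| ^- n)%:E * \int[lebesgue_rV R n]_x f x)%E.
Proof.
move=> t0; elim: n a f => [|n IH] a f mf f0.
  rewrite expr0 invr1 mul1e; apply: eq_integral => x _; congr f.
  by rewrite (thinmx0 (_ + _)) (thinmx0 x).
have mfa : measurable_fun setT (fun x : 'rV[R]_n.+1 => f (a + t *: x)%R).
  by apply: measurableT_comp => //; exact: measurable_affine_rV.
have mc := @measurable_cons_rV R n.
rewrite ge0_integral_rVS// ge0_integral_rVS//.
pose a' : 'rV[R]_n := \row_i a ord0 (lift ord0 i).
have E s v : a + t *: cons_rV (s, v) = cons_rV (a ord0 ord0 + t * s, a' + t *: v).
  apply/rowP => i; rewrite !mxE; have [j ->|->] := unliftP ord0 i => /=.
    by rewrite !mxE.
  by [].
have mf2 : measurable_fun setT (fun z : measurableTypeR R * 'rV[R]_n => f (cons_rV z)).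
  exact: measurableT_comp.
pose g s := (\int[lebesgue_rV R n]_v f (cons_rV (s, v)))%E.
have mg : measurable_fun setT (g : measurableTypeR R -> \bar R).
  exact: (measurable_fun_fubini_tonelli_F (fun z => f (cons_rV z))).
have g0 s : (0 <= g s)%E by apply: integral_ge0.
have -> : (\int[lam]_s \int[lebesgue_rV R n]_v f (a + t *: cons_rV (s, v))%R =
  \int[lam]_s ((`|t| ^- n)%:E * g (a ord0 ord0 + t * s)%R))%E.
  apply: eq_integral => s _; under eq_integral do rewrite E.
  rewrite (IH a' (fun v => f (cons_rV (a ord0 ord0 + t * s, v))))//.
  apply: (measurableT_comp mf2); exact: measurable_pair1.
have tn0 : (0 <= `|t| ^- n)%R by rewrite invr_ge0 exprn_ge0.
have mgp : measurable_fun setT (fun s : measurableTypeR R => g (a ord0 ord0 + t * s)).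
  apply: (measurableT_comp mg); apply: continuous_measurable_fun => x.
  apply: cvgD; first exact: cvg_cst.
  by apply: cvgM; [exact: cvg_cst|exact: cvg_id].
have -> := @ge0_integralZl_EFin _ _ _ lam setT measurableT _ (fun s _ => g0 _) mgp _ tn0.
rewrite (lebesgue_integral_affine _ t0 mg g0) muleA -EFinM.
by rewrite -invfM -exprSr.
Qed.

(** A ball of the maximum norm is a cube, hence a product. *)
Lemma lebesgue_ball n (x : 'rV[R]_n) r : 0 < r ->
  lebesgue_rV R n (ball x r) = ((2 * r) ^+ n)%:E.
Proof.
move=> r0; elim: n x => [|n IH] x.
  by rewrite expr0 /= diracE mem_set// /ball /=; split => // i [].
pose x' : 'rV[R]_n := \row_i x ord0 (lift ord0 i).
rewrite /= /lebesgue_cons /pushforward.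
rewrite (_ : _ @^-1` _ = (ball (x ord0 ord0) r : set (measurableTypeR R)) `*` ball x' r).
  rewrite product_measure1E//; last 2 first.
  - exact: measurable_ball.
  - by apply: open_measurable_rV; apply: ball_open.
  transitivity ((r *+ 2)%:E * ((2 * r) ^+ n)%:E)%E.
    by congr (_ * _)%E; [exact: lebesgue_measure_ball (ltW r0)|exact: IH].
  by rewrite -EFinM exprS mulr_natl.
apply/seteqP; split => [[s v]|[s v]] /=.
  move=> [_ B]; split; first by have := B ord0 ord0; rewrite /ball/= !mxE unlift_none.
  by split => // i j; rewrite (ord1 i); move: (B ord0 (lift ord0 j)); rewrite /x' !mxE liftK.
move=> [B1 [_ B2]]; split => // i j; rewrite (ord1 i) mxE.
have [k ->|->] := unliftP ord0 j; rewrite /=//.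
by move: (B2 ord0 k); rewrite /x' mxE.
Qed.

End lebesgue_rV_theory.

(** * Closed sets and metric outer measures *)

Section caratheodory_closed.
Context {R : realType} {V : normedModType R}.
Variable mu : {outer_measure set V -> \bar R}.

Hypothesis mu_metric : forall (e : R) (A B : set V), 0 < e ->
  (forall a b, A a -> B b -> e <= `|a - b|) -> (mu A + mu B <= mu (A `|` B))%E.

Variables (C X : set V).
Hypothesis closedC : closed C.
Hypothesis muX : (mu X < +oo)%E.

Let far k : set V := [set x | X x /\ forall c, C c -> k.+1%:R^-1 <= `|x - c|].

Let far_sub k : far k `<=` X. Proof. by move=> x []. Qed.

Let far_nd j k : (j <= k)%N -> far j `<=` far k.
Proof.
move=> jk x [Xx h]; split => // c Cc; apply: le_trans (h _ Cc).
by rewrite lef_pV2 ?posrE// ler_nat.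
Qed.

Let far_cover x : X x -> ~ C x -> exists k, far k x.
Proof.
move=> Xx nCx.
have /nbhs_ballP[e /= e0 eC] : nbhs x (~` C).
  by apply: open_nbhs_nbhs; split => //; exact: closed_openC.
have [k ke] : exists k, k.+1%:R^-1 < e.
  near \oo => k; exists k; near: k; exact: near_infty_natSinv_lt (PosNum e0).
exists k; split => // c Cc; rewrite leNgt; apply/negP => xc.
apply: (eC c) => //; rewrite -ball_normE /ball_/=.
exact: lt_trans xc ke.
Unshelve. all: by end_near. Qed.

Let fin S : S `<=` X -> mu S \is a fin_num.
Proof.
move=> SX; rewrite ge0_fin_numE; last exact: outer_measure_ge0.
by apply: le_lt_trans muX; exact: le_outer_measure.
Qed.

Let m S : R := fine (mu S).

Let mE S : S `<=` X -> mu S = (m S)%:E.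
Proof. by move=> SX; rewrite fineK// fin. Qed.

Let m_le S T : S `<=` T -> T `<=` X -> m S <= m T.
Proof.
move=> ST TX; rewrite -lee_fin -!mE//; last exact: subset_trans TX.
exact: le_outer_measure.
Qed.

(** Shells that, together with far 0, exhaust X without C. Shells that are not
    consecutive are at positive distance from each other. *)
Let ring k := far k.+1 `\` far k.

Let ring_sub k : ring k `<=` X.
Proof. by move=> x [/far_sub]. Qed.

Let gap (j k : nat) : (k < j)%N -> 0 < k.+1%:R^-1 - j.+1%:R^-1 :> R.
Proof. by move=> kj; rewrite subr_gt0 ltf_pV2 ?posrE// ltr_nat. Qed.

(** The shell k + 1 lies at positive distance from the set far k, and both are
    contained in far (k + 2): the measures of the shells telescope. *)
Let ring_far k : m (ring k.+1) <= m (far k.+2) - m (far k).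
Proof.
rewrite lerBrDr -lee_fin EFinD -!mE//.
apply: le_trans (mu_metric (gap (ltnSn k)) _) _.
  move=> a b [fa nfa] [Xb fb].
  have [c Cc ac] : exists2 c, C c & `|a - c| < k.+2%:R^-1.
    apply: contrapT => h; apply: nfa; split; first exact: far_sub fa.
    move=> c Cc; rewrite leNgt; apply/negP => ac; apply: h; by exists c.
  rewrite lerBlDr; apply: le_trans (fb c Cc) _.
  apply: le_trans (ler_distD a b c) _.
  by rewrite (distrC b a) lerD2l ltW.
have fk2 : far k `<=` far k.+2 by apply: far_nd; lia.
by apply: le_outer_measure => x [[]//|]; exact: fk2.
Qed.

Let rings k N : \sum_(i < N) m (ring (k + i).+1) <=
  m (far (k + N)) + m (far (k + N).+1) - m (far k) - m (far k.+1).
Proof.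
elim: N => [|N IH]; first by rewrite big_ord0 addn0; lra.
rewrite big_ord_recr/= !addnS; have := ring_far (k + N); lra.
Qed.

Let near_cover k : (mu (X `\` C) <=
  mu (far k.+1) + \sum_(k <= i <oo) mu (ring i.+1))%E.
Proof.
apply: (@le_trans _ _ (mu (far k.+1) + mu (\bigcup_(i in ~` `I_k) ring i.+1))%E).
  apply: le_trans (outer_measureU2 _ _ _); apply: le_outer_measure => x [Xx nCx].
  have [j] := far_cover Xx nCx.
  elim: j => [|j IH] fj; first by left; exact: far_nd fj.
  have [/IH//|nfj] := pselect (far j x).
  have [jk|kj] := leqP j.+1 k.+1; first by left; exact: far_nd fj.
  right; exists j.-1; first by rewrite /=; lia.
  by rewrite /ring prednK//; lia.
by apply: leeD => //; exact: outer_measure_sigma_subadditive_tail.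
Qed.

(** Caratheodory's argument: the measures of the shells are summable, so the
    measure of far k tends to that of X without C; and far k is at positive
    distance from C, so its measure adds up with that of the trace of C. *)
Lemma metric_outer_measure_split : (mu (X `&` C) + mu (X `&` ~` C) <= mu X)%E.
Proof.
have bnd k : m (far k) <= m X by apply: m_le.
pose l := sup (range (fun k => m (far k))).
have hs : has_sup (range (fun k => m (far k))).
  by split; [exists (m (far 0)); exists 0%N | exists (m X) => _ [k _ <-]].
have fl k : m (far k) <= l by apply: sup_upper_bound => //; exists k.
have tail k : (mu (X `\` C) <= (l + (l + l - m (far k) - m (far k.+1)))%:E)%E.
  apply: le_trans (near_cover k) _; rewrite EFinD leeD//.
    by rewrite mE// lee_fin.
  apply: lime_le.
    by apply: is_cvg_nneseries => i _ _; exact: outer_measure_ge0.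
  near=> N; rewrite -{1}(add0n k) big_addn big_mkord.
  under eq_bigr => i _ do rewrite addnC (mE (@ring_sub _)).
  rewrite sumEFin lee_fin; apply: le_trans (rings _ _) _.
  by have := fl (k + (N - k))%N; have := fl (k + (N - k)).+1; lra.
have XC : X `\` C `<=` X by move=> x [].
have mXC : m (X `\` C) <= l.
  apply/ler_addgt0Pr => e e0.
  have [_ [k _ <-] lk] := sup_adherent (divr_gt0 e0 (ltr0Sn R 1)) hs.
  have := tail k; rewrite mE// lee_fin.
  have : m (far k) <= m (far k.+1) by apply: m_le => //; exact: far_nd.
  rewrite -/l in lk; lra.
have XC1 : X `&` C `<=` X by move=> x [].
rewrite -setDE !mE// -EFinD lee_fin.
apply/ler_addgt0Pr => e e0.
have [_ [k _ <-] lk] := sup_adherent e0 hs.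
suff : m (X `&` C) + m (far k) <= m X by rewrite -/l in lk; lra.
rewrite -lee_fin EFinD -!mE//.
apply: le_trans (mu_metric (e := k.+1%:R^-1) _ _) _; first by [].
  by move=> a b [Xa Ca] [Xb fb]; rewrite distrC; exact: fb.
by apply: le_outer_measure => x [[]//|]; exact: far_sub.
Unshelve. all: by end_near. Qed.

End caratheodory_closed.

Lemma caratheodory_closed {R : realType} {V : normedModType R}
    (mu : {outer_measure set V -> \bar R}) (C : set V) :
  (forall (e : R) (A B : set V), 0 < e ->
    (forall a b, A a -> B b -> e <= `|a - b|) ->
    (mu A + mu B <= mu (A `|` B))%E) ->
  closed C -> mu.-caratheodory C.
Proof.
move=> mm cC; apply: le_caratheodory_measurable => X.
have [->|Xoo] := eqVneq (mu X) +oo%E; first exact: leey.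
by apply: (metric_outer_measure_split mm) => //; rewrite ltey.
Qed.

(** * The Hausdorff outer measure is metric *)

Section rV_norm.
Context {R : realType} {n : nat}.
Implicit Types x y : 'rV[R]_n.

Lemma rV_norm_le x (r : R) : 0 <= r -> (forall i, `|x ord0 i| <= r) -> `|x| <= r.
Proof.
move=> r0 h; rewrite [leLHS]mx_normrE; apply/bigmax_leP; split => // -[i j] _.
by rewrite (ord1 i); exact: h.
Qed.

Lemma coord_le_norm x i : `|x ord0 i| <= `|x|.
Proof. by rewrite [leRHS]mx_normrE; exact: (le_bigmax _ _ (ord0, i)). Qed.

Lemma enorm_ge0 x : 0 <= enorm x.
Proof. exact: sqrtr_ge0. Qed.

Lemma coord_le_enorm x i : `|x ord0 i| <= enorm x.
Proof.
rewrite -sqrtr_sqr /enorm ler_sqrt ?sumr_ge0// => [|j _]; last exact: sqr_ge0.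
by rewrite (bigD1 i)//= lerDl sumr_ge0// => j _; exact: sqr_ge0.
Qed.

Lemma norm_le_enorm x : `|x| <= enorm x.
Proof. by apply: rV_norm_le; [exact: enorm_ge0|exact: coord_le_enorm]. Qed.

Lemma enorm_le_sum x : enorm x <= \sum_(i < n) `|x ord0 i|.
Proof.
have [S0 h] : 0 <= \sum_(i < n) `|x ord0 i| /\
    \sum_(i < n) x ord0 i ^+ 2 <= (\sum_(i < n) `|x ord0 i|) ^+ 2.
  apply: (big_ind2 (fun u v : R => 0 <= v /\ u <= v ^+ 2)).
  - by rewrite expr0n.
  - by move=> u1 v1 u2 v2 [? ?] [? ?]; split; nra.
  - by move=> i _; rewrite normr_ge0 real_normK// num_real.
by rewrite -[leRHS]ger0_norm// -sqrtr_sqr /enorm ler_sqrt ?sqr_ge0.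
Qed.

Lemma enorm_le_norm x : enorm x <= n%:R * `|x|.
Proof.
apply: le_trans (enorm_le_sum x) _.
rewrite mulr_natl -[X in _ *+ X]card_ord -sumr_const.
by apply: ler_sum => i _; exact: coord_le_norm.
Qed.

End rV_norm.

Section sup_add.
Local Open Scope ereal_scope.
Context {R : realType}.

Lemma ereal_sup_add_le (A B : set (\bar R)) (M : \bar R) :
  A !=set0 -> B !=set0 -> (forall x, A x -> 0 <= x) -> (forall x, B x -> 0 <= x) ->
  (forall x y, A x -> B y -> x + y <= M) -> ereal_sup A + ereal_sup B <= M.
Proof.
move=> [a Aa] [b Bb] A0 B0 AB.
have [->|Moo] := eqVneq M +oo; first exact: leey.
have AM x : A x -> x <= M.
  by move=> Ax; apply: le_trans (AB _ _ Ax Bb); rewrite leeDl// B0.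
have BM x : B x -> x <= M.
  by move=> Bx; apply: le_trans (AB _ _ Aa Bx); rewrite leeDr// A0.
have Mlt : M < +oo by rewrite ltey.
have fB x : B x -> x \is a fin_num.
  by move=> Bx; rewrite ge0_fin_numE ?B0//; exact: le_lt_trans (BM _ Bx) Mlt.
have fA : ereal_sup A \is a fin_num.
  rewrite ge0_fin_numE.
    by apply: le_lt_trans Mlt; apply: ge_ereal_sup => x /AM.
  by apply: le_trans (A0 _ Aa) _; exact: ereal_sup_ubound.
rewrite addeC -leeBrDr//; apply: ge_ereal_sup => y By.
rewrite leeBrDr// addeC -leeBrDr ?fB//; apply: ge_ereal_sup => x Ax.
by rewrite leeBrDr ?fB//; exact: AB.
Qed.

End sup_add.

Section hausdorff_metric.
Local Open Scope ereal_scope.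
Context {R : realType} {n m : nat}.

Lemma hausdorff_content_ge0 (d : R) (A : set 'rV[R]_n) :
  0 <= hausdorff_content m d A.
Proof.
apply: le_ereal_inf_tmp => _ [C _ <-]; apply: nneseries_ge0 => k _ _.
exact: hausdorff_gauge_ge0.
Qed.

Lemma ediam_set0 : ediam (set0 : set 'rV[R]_n) = -oo.
Proof.
rewrite /ediam (_ : [set _ | _ in _ & _ in _] = set0) ?ereal_sup0//.
by apply/seteqP; split => // x [? []].
Qed.

Lemma ediam_ubound (A : set 'rV[R]_n) x y : A x -> A y -> (enorm (x - y))%:E <= ediam A.
Proof. by move=> Ax Ay; apply: ereal_sup_ubound; exists x => //; exists y. Qed.

(** A set of diameter smaller than e cannot meet both A and B, so a fine cover of
    the union splits into a cover of A and a cover of B. *)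
Lemma hausdorff_outer_metric (e : R) (A B : set 'rV[R]_n) : (0 < e)%R ->
  (forall a b, A a -> B b -> (e <= `|a - b|)%R) ->
  hausdorff_outer m A + hausdorff_outer m B <= hausdorff_outer m (A `|` B).
Proof.
move=> e0 gapAB; apply: ereal_sup_add_le.
- by exists (hausdorff_content m 1 A); exists 1%R => /=.
- by exists (hausdorff_content m 1 B); exists 1%R => /=.
- by move=> _ [d _ <-]; exact: hausdorff_content_ge0.
- by move=> _ [d _ <-]; exact: hausdorff_content_ge0.
move=> _ _ [d1 /= d10 <-] [d2 /= d20 <-].
pose d := Num.min (Num.min d1 d2) (e / 2)%R.
have d0 : (0 < d)%R by rewrite !lt_min d10 d20 divr_gt0.
apply: (@le_trans _ _ (hausdorff_content m d (A `|` B))); last first.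
  by apply: ereal_sup_ubound; exists d.
apply: le_ereal_inf_tmp => _ [C [AC Cd] <-].
(* The pieces that meet A, then the others. *)
pose CA k := if `[< C k `&` A !=set0 >] then C k else set0.
pose CB k := if `[< C k `&` A !=set0 >] then set0 else C k.
have -> : \sum_(0 <= k <oo) hausdorff_gauge m (C k) =
    \sum_(0 <= k <oo) hausdorff_gauge m (CA k) + \sum_(0 <= k <oo) hausdorff_gauge m (CB k).
  rewrite -nneseriesD; last 2 first.
  - by move=> *; exact: hausdorff_gauge_ge0.
  - by move=> *; exact: hausdorff_gauge_ge0.
  apply: eq_eseriesr => k _; rewrite /CA /CB.
  by case: ifP => _; rewrite hausdorff_gauge0 ?adde0 ?add0e.
have dle d' : (d <= d')%R -> forall k, ediam (C k) <= d'%:E.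
  by move=> dd' k; apply: le_trans (Cd k) _; rewrite lee_fin.
apply: leeD; apply: ereal_inf_lbound.
- exists CA => //; split.
    move=> a Aa; have [k _ Ck] := AC a (or_introl Aa); exists k => //.
    by rewrite /CA asboolT//; exists a.
  move=> k; rewrite /CA; case: ifP => _; last by rewrite ediam_set0 leNye.
  by apply: dle; rewrite /d !ge_min lexx.
- exists CB => //; split.
    move=> b Bb; have [k _ Ck] := AC b (or_intror Bb); exists k => //.
    rewrite /CB asboolF// => -[a [Cka Aa]].
    have := le_trans (ediam_ubound Cka Ck) (Cd k); rewrite lee_fin leNgt => /negP; apply.
    apply: lt_le_trans (le_trans (gapAB _ _ Aa Bb) (norm_le_enorm _)).
    by rewrite /d gt_min ltr_pdivrMr// ltr_pMr// ltr1n orbT.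
  move=> k; rewrite /CB; case: ifP => _; first by rewrite ediam_set0 leNye.
  by apply: dle; rewrite /d !ge_min lexx orbT.
Qed.

End hausdorff_metric.

Lemma hausdorff_measurable_closed {R : realType} n m (C : set 'rV[R]_n) :
  closed C -> (@hausdorff_outer R n m).-caratheodory C.
Proof.
by move=> cC; apply: caratheodory_closed => // e A B; exact: hausdorff_outer_metric.
Qed.

(** * Hausdorff measure of Lipschitz boundaries *)

Lemma continuous_enorm {R : realType} k : continuous (@enorm R k).
Proof.
move=> x; apply: (@continuous_comp _ _ _ (fun x : 'rV[R]_k => \sum_(i < k) x ord0 i ^+ 2) Num.sqrt).
  apply: fun_continuous_sum => i.
  rewrite (_ : (fun y : 'rV[R]_k => _) = (fun y => y ord0 i * y ord0 i)); last by [].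
  by apply: fun_continuousM; exact: coord_continuous.
exact: sqrt_continuous.
Qed.

Section hausdorff_lower.
Context {R : realType} {n m : nat}.

Let cube (x : 'rV[R]_m) (r : R) : set 'rV[R]_m :=
  [set y | forall i, `|x ord0 i - y ord0 i| <= r].

Let cube_measurable x r : measurable (cube x r).
Proof.
rewrite (_ : cube x r = \bigcap_(i in [set: 'I_m])
    ((fun y : 'rV[R]_m => `|x ord0 i - y ord0 i| : measurableTypeR R) @^-1` `]-oo, r])).
  apply: fin_bigcap_measurable => // i _; rewrite -[X in measurable X]setTI.
  apply: (@continuous_measurable_rV R m (fun y => `|x ord0 i - y ord0 i|)) => //.
    by apply: fun_continuous_norm; apply: fun_continuousB; [exact: fun_continuous_cst|exact: coord_continuous].
apply/seteqP; split => y /= h i; first by move=> _; rewrite /= in_itv/=; exact: h.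
by have := h i Logic.I; rewrite /= in_itv.
Qed.

Let cube_le x r : 0 <= r -> (lebesgue_rV R m (cube x r) <= ((2 * r) ^+ m)%:E)%E.
Proof.
move=> r0.
have h (e : R) : 0 < e -> (lebesgue_rV R m (cube x r) <= ((2 * (r + e)) ^+ m)%:E)%E.
  move=> e0; rewrite -(lebesgue_ball x); last by rewrite ltr_wpDl.
  apply: le_measure; rewrite ?inE.
  - exact: cube_measurable.
  - by apply: open_measurable_rV; exact: ball_open.
  move=> y hy; split => [|i j]; first by rewrite ltr_wpDl.
  by rewrite (ord1 i); apply: le_lt_trans (hy j) _; rewrite ltrDl.
pose f (e : R) := (2 * (r + e)) ^+ m.
have cf : f @ (0 : R)^'+ --> f 0.
  apply: cvg_at_right_filter.
  apply: (@continuous_comp R R R (fun e => 2 * (r + e)) (fun u => u ^+ m)).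
    apply: cvgM; first exact: cvg_cst.
    by apply: cvgD; [exact: cvg_cst|exact: cvg_id].
  exact: exprn_continuous.
have ce : (EFin \o f) e @[e --> (0 : R)^'+] --> (f 0)%:E.
  by apply: cvg_EFin; [exact: nearW|exact: cf].
rewrite -[X in (2 * X)]addr0 -/(f 0).
rewrite -(cvg_lim _ ce)//; apply: lime_ge; first by apply/cvg_ex; exists (f 0)%:E.
by near=> e; apply: h.
Unshelve. all: by end_near. Qed.

Let omega : R := fine (lebesgue_rV R m (eball 0 1)).

Let eball_measurable : measurable (eball 0 1 : set 'rV[R]_m).
Proof.
apply: open_measurable_rV.
rewrite (_ : eball _ _ = @enorm R m @^-1` `]-oo, 1[).
  by have /continuousP := @continuous_enorm R m; apply; exact: interval_open.
by apply/seteqP; split => y /=; rewrite /eball /= subr0 in_itv.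
Qed.

Let omega_fin : lebesgue_rV R m (eball 0 1) = omega%:E.
Proof.
rewrite fineK// ge0_fin_numE//.
apply: (@le_lt_trans _ _ (lebesgue_rV R m (ball 0 1))); last by rewrite lebesgue_ball// ltry.
apply: le_measure; rewrite ?inE//; first by apply: open_measurable_rV; exact: ball_open.
move=> y; rewrite /eball /= subr0 => y1; split => // i j.
by rewrite (ord1 i) /ball/= mxE sub0r normrN; apply: le_lt_trans y1; exact: coord_le_enorm.
Qed.

Let omega_gt0 : 0 < omega.
Proof.
rewrite -lte_fin -omega_fin.
have e0 : 0 < m.+1%:R^-1 :> R by rewrite invr_gt0.
apply: (@lt_le_trans _ _ (lebesgue_rV R m (ball 0 m.+1%:R^-1))).
  by rewrite lebesgue_ball// lte_fin exprn_gt0// mulr_gt0.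
apply: le_measure; rewrite ?inE//; first by apply: open_measurable_rV; exact: ball_open.
move=> y [_ By]; rewrite /eball /= subr0.
apply: le_lt_trans (enorm_le_norm _) _.
have yle : `|y| <= m.+1%:R^-1.
  apply: rV_norm_le; first exact: ltW.
  by move=> i; have := By ord0 i; rewrite /ball/= mxE sub0r normrN => /ltW.
apply: le_lt_trans (ler_wpM2l (ler0n _ _) yle) _.
by rewrite ltr_pdivrMr// mul1r ltr_nat.
Qed.

(** Replace every piece of a cover of A by the cube around the image of one of
    its points whose half-side is the diameter of the piece. These cubes cover
    the ball, and their volumes are at most a constant times the gauges of the
    pieces; the constant only depends on the dimension m. *)
Lemma hausdorff_outer_ge_projection : exists2 c : R, 0 < c &
  forall (A : set 'rV[R]_n) (p : 'rV[R]_n -> 'rV[R]_m) (u : 'rV[R]_m) (r : R),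
    0 < r -> (forall x y i, `|p x ord0 i - p y ord0 i| <= enorm (x - y)) ->
    ball u r `<=` p @` A -> ((c * r ^+ m)%:E <= hausdorff_outer m A)%E.
Proof.
exists (omega / 2 ^+ m) => [|A p u r r0 plip pA]; first by rewrite divr_gt0// exprn_gt0.
apply: (@le_trans _ _ (hausdorff_content m 1 A)); last first.
  by apply: ereal_sup_ubound; exists 1 => /=.
apply: le_ereal_inf_tmp => _ [C [AC Cd] <-].
pose x0 k := xget 0 (C k).
pose D k := fine (ediam (C k)).
pose Q k := if `[< C k = set0 >] then set0 else cube (p (x0 k)) (D k).
have DE k : C k !=set0 -> (ediam (C k) = (D k)%:E)%E /\ 0 <= D k.
  move=> Ck; have e0 := ediam_ge0 Ck; have e1 := Cd k.
  have ef : ediam (C k) \is a fin_num.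
    by rewrite ge0_fin_numE//; apply: le_lt_trans e1 _; exact: ltry.
  by rewrite /D fineK//; split => //; apply: fine_ge0.
have mQ k : measurable (Q k) by rewrite /Q; case: ifP => // _; exact: cube_measurable.
have uQ : ball u r `<=` \bigcup_k Q k.
  move=> v /pA[x Ax <-]; have [k _ Ck] := AC x Ax; exists k => //.
  have Ck0 : C k !=set0 by exists x.
  rewrite /Q asboolF; last by apply/eqP/set0P.
  move=> i; apply: le_trans (plip _ _ _) _.
  have Cx0 : C k (x0 k) by rewrite /x0; case: xgetP => // /(_ x).
  by rewrite -lee_fin -(DE k Ck0).1; exact: ediam_ubound.
pose w := omega / 4 ^+ m.
have w0 : 0 <= w by rewrite divr_ge0 ?ltW// exprn_gt0.
have gQ k : (w%:E * lebesgue_rV R m (Q k) <= hausdorff_gauge m (C k))%E.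
  rewrite /Q /hausdorff_gauge; case: asboolP => [_|Ck].
    by rewrite measure0 mule0.
  have [De D0] := DE k (proj1 (set0P _) (introN eqP Ck)).
  rewrite omega_fin De; apply: le_trans (lee_wpmul2l _ (cube_le _ D0)) _.
    by rewrite lee_fin.
  rewrite -EFinM -EFin_expe -!EFinM lee_fin /w.
  have -> : (4 : R) ^+ m = 2 ^+ m * 2 ^+ m by rewrite -exprMn; congr (_ ^+ m); ring.
  rewrite !exprMn exprVn invfM.
  have p2 : (2 : R) ^+ m != 0 by rewrite expf_neq0.
  by rewrite le_eqVlt; apply/orP; left; apply/eqP; field.
have -> : (omega / 2 ^+ m * r ^+ m)%:E = (w%:E * lebesgue_rV R m (ball u r))%E.
  rewrite lebesgue_ball// -EFinM /w.
  have -> : (4 : R) ^+ m = 2 ^+ m * 2 ^+ m by rewrite -exprMn; congr (_ ^+ m); ring.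
  have p2 : (2 : R) ^+ m != 0 by rewrite expf_neq0.
  by rewrite exprMn; congr EFin; field.
apply: (@le_trans _ _ (w%:E * \sum_(0 <= k <oo) lebesgue_rV R m (Q k))%E).
  apply: lee_wpmul2l; first by rewrite lee_fin.
  apply: measure_sigma_subadditive => //.
  by apply: open_measurable_rV; exact: ball_open.
rewrite -nneseriesZl//.
by apply: lee_nneseries => k _ //; rewrite mule_ge0// lee_fin.
Qed.

End hausdorff_lower.

Section lipschitz_frontier.
Context {R : realType} {n : nat}.
Variable Omega : set 'rV[R]_n.+1.
Hypothesis oOmega : open Omega.

Lemma frontier_closed : closed (frontier Omega).
Proof.
rewrite /frontier setDE; apply: closedI; first exact: closed_closure.
by apply: open_closedC; exact: open_interior.
Qed.

Lemma frontierN x : frontier Omega x -> ~ Omega x.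
Proof. by move=> [_ nO] Ox; apply: nO; exact: open_nbhs_nbhs. Qed.

(** The point of the graph of a function of the coordinates other than the
    j-th one, when t is the value of the function at u. *)
Let row_insert (j : 'I_n.+1) (u : 'rV[R]_n) (t : R) : 'rV[R]_n.+1 :=
  \row_i oapp (u ord0) t (unlift j i).

Let insert_col' j u t : col' j (row_insert j u t) = u.
Proof. by apply/rowP => i; rewrite !mxE liftK. Qed.

Let insert_j j u t : row_insert j u t ord0 j = t.
Proof. by rewrite mxE unlift_none. Qed.

Let enorm_orth (Q : 'M[R]_n.+1) (y : 'rV[R]_n.+1) : Q *m Q^T = 1%:M -> enorm (y *m Q) = enorm y.
Proof.
move=> QQ.
have E (z : 'rV[R]_n.+1) : \sum_(i < n.+1) z ord0 i ^+ 2 = (z *m z^T) ord0 ord0.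
  by rewrite mxE; apply: eq_bigr => i _; rewrite mxE expr2.
by rewrite /enorm !E trmx_mul mulmxA -(mulmxA y) QQ mulmx1.
Qed.

Let col'_enorm (Q : 'M[R]_n.+1) (j : 'I_n.+1) (x y : 'rV[R]_n.+1) i : Q *m Q^T = 1%:M ->
  `|col' j (x *m Q) ord0 i - col' j (y *m Q) ord0 i| <= enorm (x - y).
Proof.
move=> QQ; rewrite -(enorm_orth (x - y) QQ) mulmxBl.
by apply: le_trans (coord_le_enorm _ (lift j i)); rewrite !mxE.
Qed.

(** In the chart the boundary is a graph. The points of the graph above the ball
    of radius r / C about the projection of q are within r of q, where C bounds
    the slope, so the projection of the boundary near q contains that ball. *)
Lemma lipschitz_frontier_density (q : 'rV[R]_n.+1) :
  frontier Omega q -> lipschitz_epigraph_near Omega q ->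
  exists c r1 : R, [/\ 0 < c, 0 < r1 & forall r, 0 < r -> r < r1 ->
    ((c * r ^+ n)%:E <= hausdorff_outer n (frontier Omega `&` [set y | (`|y - q| <= r)%R]))%E].
Proof.
move=> Fq [r0 [Q [j [g [L [r00 QQ gL chart]]]]]].
have L0 : 0 <= `|L| by [].
have gL' u v : `|g u - g v| <= `|L| * enorm (u - v).
  apply: le_trans (gL u v) _; apply: ler_wpM2r; first exact: enorm_ge0.
  exact: ler_norm.
have QQ' : Q^T *m Q = 1%:M by exact: mulmx1C.
pose C := n%:R + `|L| * n%:R + 1 : R.
have C1 : 1 <= C by rewrite /C lerDr addr_ge0// mulr_ge0.
have C0 : 0 < C by apply: lt_le_trans C1.
have chartP y : enorm (y - q) < r0 -> Omega y <-> g (col' j (y *m Q)) < (y *m Q) ord0 j.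
  move=> yr; split => [Oy|gy].
    have : (Omega `&` eball q r0) y by [].
    by rewrite chart => -[].
  have : ([set y | g (col' j (y *m Q)) < (y *m Q) ord0 j] `&` eball q r0) y by [].
  by rewrite -chart => -[].
have enormq : enorm (q - q) < r0.
  rewrite subrr; apply: le_lt_trans r00; apply: le_trans (enorm_le_norm _) _.
  by rewrite normr0 mulr0.
have qle : (q *m Q) ord0 j <= g (col' j (q *m Q)).
  by rewrite leNgt; apply/negP => /(chartP q enormq).2; exact: frontierN.
have coordQ x y i : `|(x *m Q) ord0 i - (y *m Q) ord0 i| <= enorm (x - y).
  rewrite -(enorm_orth (x - y) QQ) mulmxBl.
  by apply: le_trans (coord_le_enorm _ i); rewrite !mxE.
have lip_col x y : enorm (col' j (x *m Q) - col' j (y *m Q)) <= n%:R * enorm (x - y).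
  apply: le_trans (enorm_le_norm _) _; apply: ler_wpM2l => //.
  apply: rV_norm_le; first exact: enorm_ge0.
  by move=> i; rewrite mxE [X in _ + X]mxE; exact: col'_enorm.
(* The point q is on the graph: the part of Omega near q lies above the
   graph and accumulates at q. *)
have qE : (q *m Q) ord0 j = g (col' j (q *m Q)).
  apply/eqP; rewrite eq_le qle/=; apply/ler_addgt0Pr => e e0.
  pose e' := Num.min (r0 / n.+1%:R / 2) (e / (n.+1%:R * C)).
  have e'0 : 0 < e' by rewrite lt_min !divr_gt0// mulr_gt0.
  have [y [Oy By]] : Omega `&` ball q e' !=set0 by apply: Fq.1; exact: nbhsx_ballx.
  have yq : `|y - q| < e' by move: By; rewrite -ball_normE /ball_/= distrC.
  have yq2 : enorm (y - q) <= n.+1%:R * e'.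
    by apply: le_trans (enorm_le_norm _) _; apply: ler_wpM2l => //; exact: ltW.
  have yr : enorm (y - q) < r0.
    apply: le_lt_trans yq2 _; rewrite mulrC -ltr_pdivlMr//.
    by rewrite /e' gt_min ltr_pdivrMr// ltr_pMr ?divr_gt0// ltr1n.
  have yC : C * enorm (y - q) <= e.
    apply: le_trans (ler_wpM2l (ltW C0) yq2) _.
    have -> : C * (n.+1%:R * e') = e' * (n.+1%:R * C) by ring.
    by rewrite -ler_pdivlMr ?mulr_gt0// /e' ge_min lexx orbT.
  have /(chartP y yr).1 gy := Oy.
  have h1 := gL' (col' j (q *m Q)) (col' j (y *m Q)).
  have h2 := coordQ y q j.
  have h3 := lip_col q y.
  have e3 : enorm (q - y) = enorm (y - q).
    rewrite -opprB /enorm; congr Num.sqrt; apply: eq_bigr => i _.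
    by rewrite mxE sqrrN.
  rewrite e3 in h3.
  have h4 : `|L| * enorm (col' j (q *m Q) - col' j (y *m Q)) <= `|L| * (n%:R * enorm (y - q)).
    exact: ler_wpM2l.
  have h5 : `|L| * n%:R * enorm (y - q) + enorm (y - q) <= C * enorm (y - q).
    by rewrite /C !mulrDl mul1r -addrA lerDr mulr_ge0// enorm_ge0.
  move: h1 h2; rewrite !ler_norml => /andP[_ h1] /andP[_ h2].
  rewrite mulrA in h4; lra.
have [c c0 Hc] := @hausdorff_outer_ge_projection R n.+1 n.
exists (c / C ^+ n), (r0 / C); split; rewrite ?divr_gt0// ?exprn_gt0// => r rgt rlt.
have rC0 : 0 < r / C by rewrite divr_gt0.
have -> : c / C ^+ n * r ^+ n = c * (r / C) ^+ n by rewrite expr_div_n; ring.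
apply: (Hc _ (fun y => col' j (y *m Q)) (col' j (q *m Q))) => //.
  by move=> x y i; exact: col'_enorm.
move=> u [_ Bu].
pose z := row_insert j u (g u).
pose y := z *m Q^T.
have yz : y *m Q = z by rewrite /y -mulmxA QQ' mulmx1.
exists y; last by rewrite yz insert_col'.
have ubnd i : `|u ord0 i - col' j (q *m Q) ord0 i| <= r / C.
  by rewrite distrC; apply: ltW; have := Bu ord0 i.
have unorm : enorm (u - col' j (q *m Q)) <= n%:R * (r / C).
  apply: le_trans (enorm_le_norm _) _; apply: ler_wpM2l => //.
  by apply: rV_norm_le; [exact: ltW|move=> i; rewrite mxE [X in _ + X]mxE; exact: ubnd].
have yqr : enorm (y - q) <= r.
  rewrite -(enorm_orth (y - q) QQ) mulmxBl yz.
  apply: le_trans (enorm_le_sum _) _.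
  have zj : (z - q *m Q) ord0 j = g u - g (col' j (q *m Q)).
    by rewrite mxE [X in _ + X]mxE /z insert_j qE.
  rewrite (bigD1_ord j)//= zj.
  apply: (@le_trans _ _ (`|L| * (n%:R * (r / C)) + n%:R * (r / C))).
    apply: lerD; first by apply: le_trans (gL' _ _) _; exact: ler_wpM2l.
    rewrite mulr_natl -[X in _ *+ X]card_ord -sumr_const.
    apply: ler_sum => i _; rewrite mxE [X in _ + X]mxE /z mxE liftK/=.
    by have := ubnd i; rewrite mxE.
  have -> : `|L| * (n%:R * (r / C)) + n%:R * (r / C) = (n%:R + `|L| * n%:R) * (r / C) by ring.
  have hC : n%:R + `|L| * n%:R <= C by rewrite /C lerDl.
  by rewrite mulrA ler_pdivrMr// (mulrC r); apply: ler_wpM2r => //; exact: ltW.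
split; last by apply: le_trans (norm_le_enorm _) yqr.
have yr0 : enorm (y - q) < r0.
  apply: le_lt_trans yqr _; apply: lt_le_trans rlt _.
  by rewrite ler_pdivrMr// ler_peMr// ltW.
split; last first.
  move=> /interior_subset/(chartP y yr0).1.
  by rewrite yz insert_col' insert_j ltxx.
(* A point of the graph is a limit of points just above it, which are in
   Omega. *)
move=> B /nbhs_ballP[e1 /= e10 eB].
have /nbhs_ballP[e2 /= e20 eB2] : nbhs y [set w | enorm (w - q) < r0].
  apply: (@open_nbhs_nbhs _ y [set w | enorm (w - q) < r0]); split => //.
  rewrite (_ : [set w | _] = (fun w => enorm (w - q)) @^-1` `]-oo, r0[).
    have /continuousP : continuous (fun w : 'rV[R]_n.+1 => enorm (w - q)).
      apply: (@continuous_comp_rV R n.+1 n.+1 (fun w => w - q) (@enorm R n.+1)).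
        by move=> w; apply: (@cvgB R 'rV[R]_n.+1 _ (nbhs w)); [exact: cvg_id|exact: cvg_cst].
      exact: continuous_enorm.
    by apply; exact: interval_open.
  by apply/seteqP; split => w /=; rewrite in_itv.
pose e := Num.min e1 e2.
have e0 : 0 < e by rewrite lt_min e10.
pose w := y + (e / 2) *: (delta_mx ord0 j *m Q^T).
have wz : w *m Q = z + (e / 2) *: delta_mx ord0 j.
  by rewrite mulmxDl yz -scalemxAl -mulmxA QQ' mulmx1.
have wy : `|y - w| < e.
  rewrite distrC; apply: le_lt_trans (norm_le_enorm _) _.
  rewrite -(enorm_orth _ QQ) mulmxBl yz wz addrAC subrr add0r.
  apply: le_lt_trans (enorm_le_sum _) _.
  rewrite (bigD1_ord j)//= big1 ?addr0 => [|i _].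
    by rewrite !mxE !eqxx mulr1 ger0_norm ?divr_ge0 ?ltW// ltr_pdivrMr// ltr_pMr// ltr1n.
  by rewrite !mxE eqxx/= eq_sym (negbTE (neq_lift _ _)) mulr0 normr0.
exists w; split.
  apply: (chartP w _).2.
    by apply: (eB2 w); rewrite -ball_normE /ball_/=; apply: lt_le_trans wy _; rewrite ge_min lexx orbT.
  rewrite wz.
  have -> : col' j (z + (e / 2) *: delta_mx ord0 j) = u.
    apply/rowP => i; rewrite !mxE liftK/=.
    by rewrite eq_sym (negbTE (neq_lift _ _)) mulr0 addr0.
  by rewrite mxE /z insert_j ltrDl !mxE !eqxx mulr1 divr_gt0.
by apply: (eB w); rewrite -ball_normE /ball_/=; apply: lt_le_trans wy _; rewrite ge_min lexx.
Qed.
End lipschitz_frontier.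

(** * Partial derivatives and their integrals *)

Section line_derivative.
Context {R : realType} {V : normedModType R}.
Implicit Types (f : V -> R) (x v : V).

(** Directional derivatives are derivatives of functions of one variable, to
    which the mean value theorem applies. *)
Lemma is_derive_lineP f x v (t d : R) :
  is_derive t 1 (fun s : R => f (x + s *: v)) d <-> is_derive (x + t *: v) v f d.
Proof.
have E : (fun h : R => h^-1 *: (((fun s : R => f (x + s *: v)) \o shift t) (h *: 1) - f (x + t *: v)))
  = (fun h => h^-1 *: ((f \o shift (x + t *: v)) (h *: v) - f (x + t *: v))).
  apply/funext => h /=; congr (_ *: (f _ - _)).
  by rewrite /shift/= [_%:A]mulr1 scalerDl addrCA.
by split => -[] h1 h2; apply: DeriveDef; move: h1 h2; rewrite /derivable /derive E.
Qed.

Lemma is_derive_line f x v (t : R) : derivable f (x + t *: v) v ->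
  is_derive t 1 (fun s : R => f (x + s *: v)) ('D_v f (x + t *: v)).
Proof. by move=> df; apply/is_derive_lineP; exact/derivableP. Qed.

Lemma line_mvt f x v (t : R) : 0 <= t -> (forall s, derivable f (x + s *: v) v) ->
  exists2 c, 0 <= c <= t & f (x + t *: v) - f x = 'D_v f (x + c *: v) * t.
Proof.
move=> t0 df.
have := @MVT_segment R (fun s : R => f (x + s *: v)) (fun s => 'D_v f (x + s *: v)) 0 t t0.
case.
- by move=> s _; exact: is_derive_line.
- apply: derivable_within_continuous => s _.
  by have [] := is_derive_line (df s).
- by move=> c; rewrite in_itv/= scale0r addr0 subr0 => ct ->; exists c.
Qed.

Lemma line_lipschitz f x v (M t : R) : (forall s, derivable f (x + s *: v) v) ->
  (forall y, `|'D_v f y| <= M) -> `|f (x + t *: v) - f x| <= M * `|t|.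
Proof.
move=> df dM.
have [t0|t0] := leP 0 t.
  have [c _ ->] := line_mvt t0 df.
  by rewrite normrM ler_wpM2r.
have t0' : 0 <= - t by rewrite oppr_ge0 ltW.
have df' s : derivable f ((x + t *: v) + s *: v) v by rewrite -addrA -scalerDl.
have [c _] := line_mvt t0' df'.
rewrite -addrA -scalerDl subrr scale0r addr0 distrC => ->.
by rewrite normrM normrN ler_wpM2r.
Qed.

Lemma derive_line_cvg f x v : derivable f x v ->
  (fun m : nat => m.+1%:R * (f (x + m.+1%:R^-1 *: v) - f x)) @ \oo --> 'D_v f x.
Proof.
move=> df.
have hc : (fun h => h^-1 *: ((f \o shift x) (h *: v) - f x)) @ 0^' --> 'D_v f x by exact: df.
have hm : (fun m : nat => m.+1%:R^-1 : R) @ \oo --> (0 : R)^'.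
  have /cvgrPdist_lt h0 := @cvg_harmonic R.
  move=> A [e /= e0 eA].
  have := h0 e e0; apply: filterS => m hm; apply: eA => //=.
have := cvg_comp _ _ hm hc; apply: cvg_trans.
rewrite (_ : _ \o _ = (fun m : nat => m.+1%:R * (f (x + m.+1%:R^-1 *: v) - f x))) //.
by apply/funext => m /=; rewrite invrK /shift /= (addrC x).
Qed.

End line_derivative.

Section partials.
Context {R : realType} {n : nat}.
Local Notation V := 'rV[R]_n.
Implicit Types (f u : V -> R) (x y : V).

(** The corners of a path from y to x that follows the coordinate axes. *)
Definition hybrid x y k : V := \row_i if (i < k)%N then x ord0 i else y ord0 i.

Lemma hybridS x y (i : 'I_n) :
  hybrid x y i.+1 = hybrid x y i + (x ord0 i - y ord0 i) *: delta_mx ord0 i.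
Proof.
apply/rowP => j; rewrite !mxE !eqxx /= ltnS leq_eqVlt.
have [->|ji] := eqVneq j i; first by rewrite ltnn eqxx mulr1 addrC subrK.
have -> : (j == i :> nat) = false by apply/negbTE; rewrite val_eqE.
by rewrite mulr0 addr0.
Qed.

Lemma lipschitz_of_partial f (M : R) :
  (forall i x, derivable f x (delta_mx ord0 i)) ->
  (forall i x, `|partial i f x| <= M) ->
  forall x y, `|f x - f y| <= n%:R * M * `|x - y|.
Proof.
move=> df dM x y.
have E0 : hybrid x y 0 = y by apply/rowP => i; rewrite mxE.
have En : hybrid x y n = x by apply/rowP => i; rewrite mxE ltn_ord.
have -> : f x - f y = \sum_(i < n) (f (hybrid x y i.+1) - f (hybrid x y i)).
  by rewrite -(big_mkord xpredT (fun k => f (hybrid x y k.+1) - f (hybrid x y k)))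
    telescope_sumr// En E0.
apply: le_trans (ler_norm_sum _ _ _) _.
rewrite -mulrA mulr_natl -[X in _ *+ X]card_ord -sumr_const.
apply: ler_sum => i _; rewrite hybridS.
apply: le_trans (line_lipschitz _ (fun s => df i _) (dM i)) _.
have M0 : 0 <= M by apply: le_trans (dM i x).
apply: ler_wpM2l => //.
by have := coord_le_norm (x - y) i; rewrite !mxE.
Qed.

Lemma partial_eq0 u (S : set V) x i : closed S ->
  (forall y, ~ S y -> u y = 0) -> ~ S x -> partial i u x = 0.
Proof.
move=> cS u0 Sx; rewrite /partial.
have <- : 'D_(delta_mx ord0 i) (cst 0 : V -> R) x = 0 by exact: derive_cst.
apply: near_eq_derive.
have : nbhs x (~` S) by apply: open_nbhs_nbhs; split => //; exact: closed_openC.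
by apply: filterS => y /u0.
Qed.

(** Compact support, with an explicit radius for the maximum norm. *)
Definition vanishes_off (r : R) u := forall x, r <= `|x| -> u x = 0.

Lemma vanishes_off_partial (r : R) u i : vanishes_off r u ->
  forall x, r < `|x| -> partial i u x = 0.
Proof.
move=> u0 x xr; apply: (@partial_eq0 u [set y | `|y| <= r]).
- rewrite (_ : [set y | _] = (fun y : V => `|y|) @^-1` [set t | t <= r])//.
  by apply: closed_comp => [y _|]; [exact: norm_continuous|exact: closed_le].
- by move=> y /negP; rewrite -ltNge => /ltW; exact: u0.
- by apply/negP; rewrite -ltNge.
Qed.

Lemma vanishing_bounded (r : R) u : continuous u -> vanishes_off r u ->
  exists2 M, 0 < M & forall x, `|u x| <= M.
Proof.
move=> cu u0.
have cK : compact [set x : V | `|x| <= r].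
  apply: bounded_closed_compact.
    exists r; split; first exact: num_real.
    by move=> M rM x /= xr; apply: le_trans xr (ltW rM).
  rewrite (_ : [set y | _] = (fun y : V => `|y|) @^-1` [set t | t <= r])//.
  by apply: closed_comp => [y _|]; [exact: norm_continuous|exact: closed_le].
have /compact_bounded[M [_ HM]] : compact (u @` [set x : V | `|x| <= r]).
  by apply: continuous_compact => //; exact: continuous_subspaceT.
exists (`|M| + 1); first by rewrite ltr_wpDl.
move=> x; have [xr|xr] := leP `|x| r.
  apply: (HM (`|M| + 1)); last by exists x.
  by rewrite (le_lt_trans (ler_norm M))// ltrDl.
have -> : u x = 0 by apply: u0; exact: ltW.
by rewrite normr0 ltW// ltr_wpDl.
Qed.

Lemma integral_le_ball (g : V -> \bar R) (M r : R) (p : V) : 0 < r -> 0 <= M ->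
  (forall x, 0 <= g x)%E -> (forall x, ball p r x -> (g x <= M%:E)%E) ->
  (forall x, ~ ball p r x -> g x = 0%E) ->
  (\int[lebesgue_rV R n]_x g x <= (M * (2 * r) ^+ n)%:E)%E.
Proof.
move=> r0 M0 g0 gM gz.
have mb : measurable (ball p r) by apply: open_measurable_rV; exact: ball_open.
apply: (@le_trans _ _ (\int[lebesgue_rV R n]_x (M * \1_(ball p r) x)%:E)%E).
  apply: integral_mono => // x _; rewrite indicE.
  have [xb|xb] := pselect (ball p r x); first by rewrite mem_set// mulr1 gM.
  by rewrite memNset// mulr0 gz.
rewrite (integralZl_indic measurableT (fun=> ball p r))//; last first.
  by move=> M0'; move: M0; rewrite leNgt M0'.
rewrite integral_indic// setIT EFinM; apply: lee_wpmul2l; first by rewrite lee_fin.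
by rewrite -(lebesgue_ball p r0).
Qed.

Lemma vanishing_integrable (r : R) u : continuous u -> vanishes_off r u ->
  (lebesgue_rV R n).-integrable setT (EFin \o u).
Proof.
move=> cu u0.
have [M M0 uM] := vanishing_bounded cu u0.
apply/integrableP; split.
  by apply/measurable_EFinP; exact: continuous_measurable_rV.
have r'0 : 0 < `|r| + 1 by rewrite ltr_wpDl.
apply: (@le_lt_trans _ _ (M * (2 * (`|r| + 1)) ^+ n)%:E); last exact: ltry.
apply: (@integral_le_ball _ _ _ 0) => //; first exact: ltW.
  by move=> x _; rewrite lee_fin.
move=> x; rewrite -ball_normE /ball_/= sub0r normrN => /negP; rewrite -leNgt => xr.
rewrite /= u0 ?normr0//; apply: le_trans (le_trans (ler_norm r) _) xr.
by rewrite lerDl.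
Qed.

Lemma integral_translate u (a : V) : continuous u ->
  (\int[lebesgue_rV R n]_x (u (x + a))%:E = \int[lebesgue_rV R n]_x (u x)%:E)%E.
Proof.
move=> cu.
have mu : measurable_fun setT (EFin \o u).
  by apply/measurable_EFinP; exact: continuous_measurable_rV.
have E (f : V -> \bar R) : measurable_fun setT f -> (forall x, 0 <= f x)%E ->
    (\int[lebesgue_rV R n]_x f (x + a)%R = \int[lebesgue_rV R n]_x f x)%E.
  move=> mf f0; have := @ge0_integral_affine R n a 1 f (oner_neq0 _) mf f0.
  rewrite normr1 expr1n invr1 mul1e => <-.
  by apply: eq_integral => x _; rewrite scale1r addrC.
rewrite integralE [RHS]integralE; congr (_ - _)%E.
  transitivity (\int[lebesgue_rV R n]_x ((EFin \o u)^\+ (x + a)%R))%E; first by apply: eq_integral => x _; rewrite !funeposE.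
  by rewrite (E (EFin \o u)^\+%E)//; exact: measurable_funepos.
transitivity (\int[lebesgue_rV R n]_x ((EFin \o u)^\- (x + a)%R))%E; first by apply: eq_integral => x _; rewrite !funenegE.
by rewrite (E (EFin \o u)^\-%E)//; exact: measurable_funeneg.
Qed.

(** The difference quotients of u have integral 0 by translation invariance, and
    they converge to the derivative while staying bounded on a fixed ball. *)
Lemma integral_partial_eq0 (r : R) u i : continuous u -> vanishes_off r u ->
  (forall x, derivable u x (delta_mx ord0 i)) -> continuous (partial i u) ->
  (\int[lebesgue_rV R n]_x (partial i u x)%:E = 0)%E.
Proof.
move=> cu u0 du cdu.
pose e : V := delta_mx ord0 i.
have du0 : vanishes_off (r + 1) (partial i u).
  move=> x xr; apply: (vanishes_off_partial i u0).
  by apply: lt_le_trans xr; rewrite ltrDl.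
have [M M0 uM] := vanishing_bounded cdu du0.
have iu := vanishing_integrable cu u0.
pose f (m : nat) (x : V) := m.+1%:R * (u (x + m.+1%:R^-1 *: e) - u x).
have cf m : continuous (f m).
  apply: fun_continuousM; first exact: fun_continuous_cst.
  apply: fun_continuousB => //.
  apply: (@continuous_comp_rV R n n (fun x => x + m.+1%:R^-1 *: e)) => //.
  by move=> x; apply: (@cvgD R V _ (nbhs x)); [exact: cvg_id|exact: cvg_cst].
have e1 : `|e| <= 1.
  by apply: rV_norm_le => // j; rewrite mxE; case: andP => _; rewrite ?normr1 ?normr0.
have shift_norm (m : nat) (x : V) : `|x| <= `|x + m.+1%:R^-1 *: e| + 1.
  have := ler_normB (x + m.+1%:R^-1 *: e) (m.+1%:R^-1 *: e).
  rewrite addrK => h; apply: le_trans h _; rewrite lerD2l.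
  by rewrite normrZ ger0_norm// mulr_ile1// invf_le1// ler1n.
have f0 m : (\int[lebesgue_rV R n]_x (f m x)%:E = 0)%E.
  have it : (lebesgue_rV R n).-integrable setT (EFin \o (fun x => u (x + m.+1%:R^-1 *: e))).
    apply: (@vanishing_integrable (r + 1)).
      apply: (@continuous_comp_rV R n n (fun x => x + m.+1%:R^-1 *: e)) => //.
      by move=> x; apply: (@cvgD R V _ (nbhs x)); [exact: cvg_id|exact: cvg_cst].
    move=> x xr; apply: u0.
    by have := shift_norm m x; lra.
  under eq_integral do rewrite EFinM EFinB.
  rewrite integralZl//; last exact: integrableB.
  by rewrite integralB_EFin// integral_translate// subee ?mule0// integrable_fin_num.
pose B : set V := ball 0 (`|r| + 2).
have B0 : 0 < `|r| + 2 by rewrite ltr_wpDl.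
have BP x : ~ B x -> r + 2 <= `|x|.
  rewrite /B -ball_normE /ball_/= sub0r normrN => /negP; rewrite -leNgt.
  by apply: le_trans; rewrite lerD2r ler_norm.
have dom m x : `|f m x| <= M * \1_B x.
  rewrite indicE; have [xb|xb] := pselect (B x).
    rewrite mem_set// mulr1 /f normrM ger0_norm// -ler_pdivlMl// mulrC.
    have := line_lipschitz (x := x) (v := e) (m.+1%:R^-1) (fun s => du _) uM.
    by rewrite [in X in _ <= X -> _]ger0_norm// invr_ge0.
  have xr := BP x xb.
  rewrite memNset// mulr0 /f.
  rewrite (u0 x); last by lra.
  rewrite u0 ?subrr ?mulr0 ?normr0//.
  have := shift_norm m x; lra.
have mB : measurable B by apply: open_measurable_rV; exact: ball_open.
have iB : (lebesgue_rV R n).-integrable setT (EFin \o (fun x => M * \1_B x)).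
  apply/integrableP; split.
    by apply/measurable_EFinP; apply: measurable_funM => //; exact: measurable_indic.
  apply: (@le_lt_trans _ _ (M * (2 * (`|r| + 2)) ^+ n)%:E); last exact: ltry.
  apply: (@integral_le_ball _ _ _ 0) => //; first exact: ltW.
    by move=> x Bx; rewrite /= lee_fin indicE mem_set// mulr1 ger0_norm// ltW.
  by move=> x Bx; rewrite /= indicE memNset// mulr0 normr0.
have mf m : measurable_fun setT (EFin \o f m).
  by apply/measurable_EFinP; exact: continuous_measurable_rV.
have mdu : measurable_fun setT (EFin \o partial i u).
  by apply/measurable_EFinP; exact: continuous_measurable_rV.
have cvf : {ae lebesgue_rV R n, forall x, setT x ->
    (EFin \o f m) x @[m --> \oo] --> (EFin \o partial i u) x}.
  apply: aeW => x _; apply: cvg_EFin; first exact: nearW.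
  exact: derive_line_cvg.
have bnd : {ae lebesgue_rV R n, forall x m, setT x ->
    (`|(EFin \o f m) x| <= (EFin \o (fun x => (M * \1_B x)%R)) x)%E}.
  by apply: aeW => x m _; rewrite /= lee_fin.
have [_ _] := dominated_convergence measurableT mf mdu cvf iB bnd.
move=> /cvg_lim <-//.
by rewrite (_ : (fun m => _) = cst 0%E) ?lim_cst//; apply/funext => m; exact: f0.
Qed.

End partials.

(** * Mixed derivatives and rotated gradients *)

Section affine_derivative.
Context {R : realType} {V : normedModType R}.
Implicit Types (f : V -> R) (x v a : V).

Lemma is_derive_affine f a x v (t : R) : derivable f (a + t *: x) v ->
  is_derive x v (fun y => f (a + t *: y)) (t * 'D_v f (a + t *: x)).
Proof.
move=> df.
rewrite -[x in is_derive x _ _ _]addr0 -(scale0r v); apply/is_derive_lineP.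
have h : is_derive (t * 0) 1 (fun s => f (a + t *: x + s *: v)) ('D_v f (a + t *: x)).
  by apply/is_derive_lineP; rewrite mulr0 scale0r addr0; exact/derivableP.
have h2 : is_derive (0 : R) 1 (fun s : R => t * s) t.
  have := @is_deriveZ R R R id t 0 1 1 (is_derive_id _ _).
  by rewrite /= => H; apply: is_derive_eq; rewrite [LHS]mulr1.
have := is_derive1_comp h h2; rewrite mulrC.
by congr (is_derive _ _ _ _); apply/funext => s /=; rewrite scalerDr scalerA addrA.
Qed.

End affine_derivative.

Section schwarz.
Context {R : realType} {n : nat}.
Local Notation V := 'rV[R]_n.
Local Notation e i := (delta_mx ord0 i : V).
Implicit Types (f u phi : V -> R) (x y : V).

Lemma is_derive_shift_rV f x v c : derivable f (x + c) v ->
  is_derive x v (fun y => f (y + c)) ('D_v f (x + c)).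
Proof.
move=> df; have := @is_derive_affine R V f c x v 1.
rewrite scale1r addrC mul1r => /(_ df).
by congr (is_derive _ _ _ _); apply/funext => y; rewrite scale1r addrC.
Qed.

(** The mean value theorem in direction i, then in direction j. *)
Lemma second_difference f i j x (h : R) : 0 <= h ->
  (forall k y, derivable f y (e k)) ->
  (forall y, derivable (partial i f) y (e j)) ->
  exists c d, [/\ 0 <= c <= h, 0 <= d <= h &
    f (x + h *: e i + h *: e j) - f (x + h *: e i) - (f (x + h *: e j) - f x)
    = partial j (partial i f) (x + c *: e i + d *: e j) * h * h].
Proof.
move=> h0 df ddf.
pose g y := f (y + h *: e j) - f y.
have dg y : is_derive y (e i) g (partial i f (y + h *: e j) - partial i f y).
  apply: is_deriveB; first by apply: is_derive_shift_rV.
  exact/derivableP.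
have dg' s : derivable g (x + s *: e i) (e i) by have [] := dg (x + s *: e i).
have [c ch E] := line_mvt h0 dg'.
have [d dh E2] := line_mvt (x := x + c *: e i) h0 (fun s => ddf _).
exists c, d; split => //.
rewrite -[LHS]/(g (x + h *: e i) - g x) E.
by have [_ ->] := dg (x + c *: e i); rewrite E2.
Qed.

(** Both mixed derivatives are values of the same second difference quotient at
    points close to x. *)
Lemma schwarz f i j x :
  (forall k y, derivable f y (e k)) ->
  (forall k l y, derivable (partial k f) y (e l)) ->
  (forall k l, continuous (partial l (partial k f))) ->
  partial i (partial j f) x = partial j (partial i f) x.
Proof.
move=> df ddf cf.
have e1 k : `|e k| <= 1.
  by apply: rV_norm_le => // l; rewrite mxE; case: andP => _; rewrite ?normr1 ?normr0.
apply/eqP; rewrite -subr_eq0 -normr_le0; apply/ler_addgt0Pr => eps eps0; rewrite add0r.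
have near_cont k l : exists2 dl, 0 < dl & forall y, `|y - x| < dl ->
    `|partial l (partial k f) y - partial l (partial k f) x| < eps / 2.
  have /cvgrPdist_lt/(_ _ (divr_gt0 eps0 (ltr0Sn R 1)))/nbhs_ballP[dl /= dl0 H] := cf k l x.
  exists dl => // y yx; rewrite distrC; apply: H.
  by rewrite -ball_normE /ball_/= distrC.
have [d1 d10 H1] := near_cont i j.
have [d2 d20 H2] := near_cont j i.
pose h := Num.min d1 d2 / 3.
have h0 : 0 < h by rewrite divr_gt0// lt_min d10.
have close c d k l : 0 <= c <= h -> 0 <= d <= h ->
    `|x + c *: e k + d *: e l - x| < Num.min d1 d2.
  move=> /andP[c0 ch] /andP[d0 dh].
  have -> : x + c *: e k + d *: e l - x = c *: e k + d *: e l.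
    by rewrite -(addrA x) [LHS]addrC addKr.
  apply: le_lt_trans (ler_normD _ _) _; rewrite !normrZ !ger0_norm//.
  have h3 : Num.min d1 d2 = 3 * h by rewrite /h; field.
  rewrite h3.
  have ce : c * `|e k| <= h * 1 by apply: ler_pM.
  have de : d * `|e l| <= h * 1 by apply: ler_pM.
  rewrite mulr1 in ce de; lra.
have [c [d [ch dh E1]]] := @second_difference f i j x h (ltW h0) df (ddf i j).
have [c' [d' [ch' dh' E2]]] := @second_difference f j i x h (ltW h0) df (ddf j i).
have E : partial j (partial i f) (x + c *: e i + d *: e j) =
    partial i (partial j f) (x + c' *: e j + d' *: e i).
  apply: (mulIf (lt0r_neq0 h0)); apply: (mulIf (lt0r_neq0 h0)).
  apply: etrans (esym E1) (etrans _ E2).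
  have -> : x + h *: e j + h *: e i = x + h *: e i + h *: e j by exact: addrAC.
  move: (f (x + h *: e i + h *: e j)) (f (x + h *: e i)) (f (x + h *: e j)) (f x) => A1 A2 A3 A4.
  by ring.
have := H1 _ (lt_le_trans (close _ _ i j ch dh) _).
rewrite ge_min lexx => /(_ isT); rewrite E => G1.
have := H2 _ (lt_le_trans (close _ _ j i ch' dh') _).
rewrite ge_min lexx orbT => /(_ isT) => G2.
apply: le_trans (ler_distD _ _ _) _; rewrite [leRHS]splitr.
by apply: lerD; [rewrite distrC; exact: ltW G2|exact: ltW G1].
Qed.

Lemma smooth_cont f : smooth f -> continuous f.
Proof. by move=> /(_ [::])[]. Qed.
Lemma smooth_derivable f i x : smooth f -> derivable f x (e i).
Proof. by move=> /(_ [::])[]. Qed.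
Lemma smooth_partial f i : smooth f -> smooth (partial i f).
Proof. by move=> sf s; have := sf (rcons s i); rewrite foldr_rcons. Qed.

(** As mixed derivatives commute, the integrand is the difference of the partial
    derivatives d_i (phi d_j u) and d_j (phi d_i u) of compactly supported
    functions. With u fixed, this says that the field with components d_j u and
    - d_i u in the directions i and j is divergence-free. *)
Lemma integral_curl u phi (r : R) i j : smooth u -> vanishes_off r u -> smooth phi ->
  (\int[lebesgue_rV R n]_x
    (partial j u x * partial i phi x - partial i u x * partial j phi x)%:E = 0)%E.
Proof.
move=> su u0 sphi.
have du k x : derivable u x (e k) by exact: smooth_derivable.
have ddu k l x : derivable (partial k u) x (e l).
  by apply: smooth_derivable; exact: smooth_partial.
have cdu k l : continuous (partial l (partial k u)).
  by apply: smooth_cont; do 2 apply: smooth_partial.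
pose w k x := partial k u x * phi x.
have cw k : continuous (w k).
  by apply: fun_continuousM; [apply: smooth_cont; exact: smooth_partial|exact: smooth_cont].
have dw k l x : is_derive x (e l) (w k)
    (partial k u x * partial l phi x + phi x * partial l (partial k u) x).
  by apply: is_deriveM; apply/derivableP => //; exact: smooth_derivable.
have dwE k l : partial l (w k) =
    (fun x => partial k u x * partial l phi x + phi x * partial l (partial k u) x).
  by apply/funext => x; have [_] := dw k l x.
have cdw k l : continuous (partial l (w k)).
  rewrite dwE; apply: fun_continuousD; apply: fun_continuousM.
  - by apply: smooth_cont; exact: smooth_partial su.
  - by apply: smooth_cont; exact: smooth_partial sphi.
  - exact: smooth_cont sphi.
  - exact: cdu.
have w0 k : vanishes_off (r + 1) (w k).
  move=> x xr; rewrite /w (vanishes_off_partial k u0) ?mul0r//.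
  by apply: lt_le_trans xr; rewrite ltrDl.
have w00 k l : vanishes_off (r + 1 + 1) (partial l (w k)).
  move=> x xr; apply: (vanishes_off_partial l (w0 k)).
  by apply: lt_le_trans xr; rewrite ltrDl.
have I k l : (\int[lebesgue_rV R n]_x (partial l (w k) x)%:E = 0)%E.
  by apply: (integral_partial_eq0 (cw k) (w0 k)) => // x; have [] := dw k l x.
transitivity (\int[lebesgue_rV R n]_x ((partial i (w j) x)%:E - (partial j (w i) x)%:E))%E.
  apply: eq_integral => x _; rewrite -EFinB; congr EFin.
  rewrite !dwE (schwarz i j x du ddu cdu).
  move: (partial j (partial i u) x) (phi x) (partial j u x) (partial i phi x)
    (partial i u x) (partial j phi x) => A1 A2 A3 A4 A5 A6.
  by ring.
rewrite integralB_EFin//; [|exact: vanishing_integrable (w00 _ _)|exact: vanishing_integrable (w00 _ _)].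
rewrite -[RHS](sube0 0); congr (_ - _)%E; [exact: (I j i)|exact: (I i j)].
Qed.

Lemma partial_affine f a (t : R) i : (forall x, derivable f x (e i)) ->
  partial i (fun x => f (a + t *: x)) = (fun x => t * partial i f (a + t *: x)).
Proof.
by move=> df; apply/funext => x; have [_] := is_derive_affine (df (a + t *: x)).
Qed.

Lemma smooth_affine f a (t : R) : smooth f -> smooth (fun x => f (a + t *: x)).
Proof.
move=> sf s.
have E : foldr partial (fun x => f (a + t *: x)) s =
    (fun x => t ^+ size s * foldr partial f s (a + t *: x)).
  elim: s => [|i s IH]; first by apply/funext => x; rewrite expr0 mul1r.
  have [_ ds] := sf s.
  rewrite /= IH; apply/funext => x.
  have h := is_derive_affine (ds i (a + t *: x)).
  have [_] := @is_deriveZ _ _ _ _ (t ^+ size s) _ _ _ h.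
  by rewrite /partial => ->; rewrite exprSr [LHS]mulrA.
have [cs ds] := sf s.
rewrite E; split.
  apply: fun_continuousM; first exact: fun_continuous_cst.
  by apply: (@continuous_comp_rV R n n (fun x => a + t *: x)) => //; exact: continuous_affine_rV.
move=> i x.
have h := is_derive_affine (ds i (a + t *: x)).
by have [] := @is_deriveZ _ _ _ _ (t ^+ size s) _ _ _ h.
Qed.

End schwarz.

(** * Mollification *)

Lemma measurable_rV_lin {R : realType} n (a b : R) :
  measurable_fun setT (fun xz : 'rV[R]_n * 'rV[R]_n => a *: xz.1 + b *: xz.2).
Proof.
apply: measurable_fun_rV => i.
rewrite (_ : (fun x => _) = (fun x : 'rV[R]_n * 'rV[R]_n => a * x.1 ord0 i + b * x.2 ord0 i)).
  apply: measurable_funD; apply: measurable_funM => //.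
    by apply: (measurableT_comp (measurable_coord i)); exact: measurable_fst.
  by apply: (measurableT_comp (measurable_coord i)); exact: measurable_snd.
by apply/funext => x; rewrite !mxE.
Qed.

Section mollifier.
Context {R : realType} {n : nat}.
Local Notation V := 'rV[R]_n.
Local Notation lam := (lebesgue_rV R n).
Variables (rho : V -> R) (Mr : R).
Hypothesis crho : continuous rho.
Hypothesis rho0 : forall x, 0 <= rho x.
Hypothesis rhoM : forall x, rho x <= Mr.
Hypothesis rho_off : vanishes_off 1 rho.
Hypothesis rho1 : (\int[lam]_x (rho x)%:E = 1)%E.

Section one.
Variable f : V -> R.
Hypothesis mf : measurable_fun setT (f : V -> measurableTypeR R).
Hypothesis f0 : forall x, 0 <= f x.
Hypothesis fi : lam.-integrable setT (EFin \o f).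

Let mrho : measurable_fun setT (rho : V -> measurableTypeR R).
Proof. exact: continuous_measurable_rV. Qed.

Let rescale_affine (d : R) (x y : V) :
  rescale rho d (x - y) = d ^- n * rho (d^-1 *: x + (- d^-1) *: y).
Proof. by rewrite /rescale scalerBr scaleNr. Qed.

Let mrescale (d : R) (x : V) : measurable_fun setT (fun y : V => rescale rho d (x - y) : measurableTypeR R).
Proof.
under eq_fun do rewrite rescale_affine.
apply: measurable_funM => //.
by apply: (measurableT_comp mrho); exact: measurable_affine_rV.
Qed.

Lemma conv_bounded_fin (d : R) (x : V) : 0 < d ->
  (\int[lam]_y (f y * rescale rho d (x - y))%:E < +oo)%E.
Proof.
move=> d0; have dn : 0 <= d ^- n by rewrite invr_ge0 exprn_ge0// ltW.
have Mr0 : 0 <= Mr by apply: le_trans (rho0 0) _.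
apply: (@le_lt_trans _ _ (\int[lam]_y ((d ^- n * Mr)%:E * (f y)%:E))%E).
  apply: integral_mono => y _.
    by rewrite lee_fin mulr_ge0// /rescale mulr_ge0.
  by rewrite -EFinM lee_fin mulrC ler_wpM2r// /rescale ler_wpM2l.
rewrite ge0_integralZl//; last first.
- by rewrite lee_fin mulr_ge0.
- by move=> y _; rewrite lee_fin.
- exact/measurable_EFinP.
rewrite lte_mul_pinfty ?lee_fin ?mulr_ge0//.
have /integrableP[_] := fi; apply: le_lt_trans; apply: integral_mono => y _.
  by rewrite lee_fin.
by rewrite /= lee_fin ler_norm.
Qed.

Lemma conv_def (d : R) (x : V) : 0 < d ->
  ((convolution f (rescale rho d) x)%:E = \int[lam]_y (f y * rescale rho d (x - y))%:E)%E.
Proof.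
move=> d0; rewrite /convolution /Rintegral fineK// ge0_fin_numE.
  exact: conv_bounded_fin.
apply: integral_ge0 => y _; rewrite lee_fin mulr_ge0// /rescale mulr_ge0//.
by rewrite invr_ge0 exprn_ge0// ltW.
Qed.

(** The change of variables y = x - d z moves the scale from the kernel to f, so
    that mollifications at different scales become averages over the same
    weight. *)
Lemma conv_shift (d : R) (x : V) : 0 < d ->
  ((convolution f (rescale rho d) x)%:E = \int[lam]_z (f (x - d *: z) * rho z)%:E)%E.
Proof.
move=> d0; rewrite conv_def//.
have dn : 0 <= d ^- n by rewrite invr_ge0 exprn_ge0// ltW.
have mg : measurable_fun setT (fun y : V => (f y * rescale rho d (x - y))%:E : \bar R).
  by apply/measurable_EFinP; apply: measurable_funM; [exact: mf|exact: mrescale].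
have g0 y : (0 <= (f y * rescale rho d (x - y))%:E)%E.
  by rewrite lee_fin mulr_ge0// /rescale mulr_ge0.
have dn0 : d ^+ n != 0 by rewrite expf_neq0// gt_eqF.
have dN : - d != 0 by rewrite oppr_eq0 gt_eqF.
have := @ge0_integral_affine R n x (- d) _ dN mg g0.
rewrite normrN gtr0_norm// => E.
have -> : (\int[lam]_y (f y * rescale rho d (x - y))%:E =
    (d ^+ n)%:E * ((d ^- n)%:E * \int[lam]_y (f y * rescale rho d (x - y))%:E))%E.
  by rewrite muleA -EFinM divff// mul1e.
rewrite -E -ge0_integralZl//; last first.
- by rewrite lee_fin exprn_ge0// ltW.
- apply: (measurableT_comp mg); exact: measurable_affine_rV.
apply: eq_integral => z _; rewrite -EFinM; congr EFin.
rewrite /rescale opprD addNKr scaleNr opprK scalerA mulVf ?gt_eqF// scale1r.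
by rewrite mulrCA [d ^+ n * _]mulrA mulfV// mul1r.
Qed.

Lemma conv_shift_integrable (d : R) (x : V) : 0 < d ->
  lam.-integrable setT (fun z : V => (f (x - d *: z) * rho z)%:E).
Proof.
move=> d0.
have mfs : measurable_fun setT (fun z : V => f (x - d *: z) * rho z : measurableTypeR R).
  apply: measurable_funM => //.
  under eq_fun do rewrite -scaleNr.
  by apply: (measurableT_comp mf); exact: measurable_affine_rV.
apply/integrableP; split; first exact/measurable_EFinP.
under eq_integral => z _ do rewrite /= ger0_norm ?mulr_ge0//.
by rewrite -conv_shift// ltry.
Qed.

Lemma conv_diff_le (d d' : R) (x : V) : 0 < d -> 0 < d' ->
  (`|convolution f (rescale rho d') x - convolution f (rescale rho d) x|%:E <=
   \int[lam]_z (`|f (x - d' *: z) - f (x - d *: z)| * rho z)%:E)%E.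
Proof.
move=> d0 d'0.
have i1 := conv_shift_integrable x d0; have i2 := conv_shift_integrable x d'0.
rewrite -abse_EFin EFinB !conv_shift// -integralB_EFin//.
apply: le_trans (le_abse_integral _ _ _) _ => //.
  by case/integrableP : (integrableB measurableT i2 i1).
apply: integral_mono => z _ //; rewrite /= lee_fin.
by rewrite -mulrBl normrM (ger0_norm (rho0 z)).
Qed.

(** By Tonelli, mollifications at two scales are as close in L1 as, on average
    over z, the translates of f by d z and d' z are. *)
Lemma conv_diff_L1 (d d' E : R) : 0 < d -> 0 < d' ->
  (forall z, `|z| < 1 -> (\int[lam]_x `|f (x - d' *: z) - f (x - d *: z)|%:E <= E%:E)%E) ->
  (\int[lam]_x `|convolution f (rescale rho d') x - convolution f (rescale rho d) x|%:E
   <= E%:E)%E.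
Proof.
move=> d0 d'0 hE.
apply: (@le_trans _ _ (\int[lam]_x \int[lam]_z (`|f (x - d' *: z) - f (x - d *: z)| * rho z)%:E)%E).
  by apply: integral_mono => x _; [rewrite lee_fin|exact: conv_diff_le].
have mfd (c : R) : measurable_fun setT (fun xz : V * V => f (xz.1 - c *: xz.2) : measurableTypeR R).
  rewrite (_ : (fun xz => _) = (fun xz : V * V => f (1 *: xz.1 + (- c) *: xz.2))).
    by apply: (measurableT_comp mf); exact: measurable_rV_lin.
  by apply/funext => xz; rewrite scale1r scaleNr.
pose H (xz : V * V) := (`|f (xz.1 - d' *: xz.2) - f (xz.1 - d *: xz.2)| * rho xz.2)%:E.
have mH : measurable_fun setT H.
  apply/measurable_EFinP; apply: measurable_funM.
    by apply: measurableT_comp => //; apply: measurable_funB; exact: mfd.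
  by apply: (measurableT_comp mrho); exact: measurable_snd.
have H0 xz : (0 <= H xz)%E by rewrite lee_fin mulr_ge0.
rewrite (fubini_tonelli H)//.
have -> : E%:E = (E%:E * \int[lam]_z (rho z)%:E)%E by rewrite rho1 mule1.
have E0 : 0 <= E.
  rewrite -lee_fin; apply: le_trans (hE 0 _); last by rewrite normr0.
  by apply: integral_ge0 => x _; rewrite lee_fin.
rewrite -ge0_integralZl//; last first.
- by move=> z _; rewrite lee_fin.
- exact/measurable_EFinP.
apply: integral_mono => z _; first exact: integral_ge0.
rewrite /H /=.
have [z1|z1] := ltP `|z| 1; last first.
  by under eq_integral do rewrite (rho_off z1) mulr0; rewrite integral0 (rho_off z1) mule0.
have mfs (c : R) : measurable_fun setT (fun x : V => f (x - c *: z) : measurableTypeR R).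
  rewrite (_ : (fun x => _) = (fun x : V => f (- (c *: z) + 1 *: x))).
    by apply: (measurableT_comp mf); exact: measurable_affine_rV.
  by apply/funext => x; rewrite scale1r addrC.
under eq_integral do rewrite EFinM muleC.
rewrite ge0_integralZl//; last first.
- by rewrite lee_fin.
- apply/measurable_EFinP; apply: measurableT_comp => //.
  by apply: measurable_funB; exact: mfs.
by rewrite muleC lee_wpmul2r ?lee_fin// hE.
Qed.

End one.
End mollifier.

(** * A tower of vortices *)

Lemma nneseries_le_geometric {R : realType} (u : nat -> \bar R) (a : R) :
  0 <= a -> (forall j, 0 <= u j)%E -> (forall j, (u j <= (a * 2^-1 ^+ j)%:E)%E) ->
  (\sum_(0 <= j <oo) u j <= (2 * a)%:E)%E.
Proof.
move=> a0 u0 ua.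
have E m : \sum_(0 <= j < m) (a * 2^-1 ^+ j) = 2 * a - 2 * a * 2^-1 ^+ m.
  elim: m => [|m IH]; first by rewrite big_nil expr0; lra.
  by rewrite big_nat_recr//= IH exprS; field.
apply: lime_le; first by apply: is_cvg_nneseries => i _ _; exact: u0.
near=> m.
apply: (@le_trans _ _ (\sum_(0 <= j < m) (a * 2^-1 ^+ j))%:E).
  by rewrite -sumEFin; apply: lee_sum => j _; exact: ua.
rewrite lee_fin.
rewrite E.
by rewrite gerBl mulr_ge0// ?mulr_ge0// exprn_ge0.
Unshelve. all: by end_near. Qed.

Lemma integral_le_2balls {R : realType} n (g : 'rV[R]_n -> \bar R) (M r : R) (p1 p2 : 'rV[R]_n) :
  0 < r -> 0 <= M -> (forall x, 0 <= g x)%E ->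
  (forall x, ball p1 r x \/ ball p2 r x -> (g x <= M%:E)%E) ->
  (forall x, ~ ball p1 r x -> ~ ball p2 r x -> g x = 0%E) ->
  (\int[lebesgue_rV R n]_x g x <= (2 * (M * (2 * r) ^+ n))%:E)%E.
Proof.
move=> r0 M0 g0 gM gz.
have mb p : measurable (ball p r : set 'rV[R]_n) by apply: open_measurable_rV; exact: ball_open.
have mI p : measurable_fun setT (fun x : 'rV[R]_n => (M * \1_(ball p r) x)%:E).
  by apply/measurable_EFinP; apply: measurable_funM => //; exact: measurable_indic.
have I0 p (x : 'rV[R]_n) : (0 <= (M * \1_(ball p r) x)%:E)%E by rewrite lee_fin mulr_ge0.
apply: (@le_trans _ _ (\int[lebesgue_rV R n]_x
    ((M * \1_(ball p1 r) x)%:E + (M * \1_(ball p2 r) x)%:E))%E).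
  apply: integral_mono => // x _; rewrite -EFinD -mulrDr !indicE.
  have [x1|x1] := pselect (ball p1 r x).
    rewrite mem_set//; apply: le_trans (gM x (or_introl x1)) _.
    by rewrite lee_fin ler_peMr// lerDl.
  have [x2|x2] := pselect (ball p2 r x).
    rewrite (mem_set x2); apply: le_trans (gM x (or_intror x2)) _.
    by rewrite lee_fin ler_peMr// lerDr.
  by rewrite gz// lee_fin mulr_ge0// addr_ge0.
rewrite ge0_integralD//.
have h p : (\int[lebesgue_rV R n]_x (M * \1_(ball p r) x)%:E <= (M * (2 * r) ^+ n)%:E)%E.
  apply: (@integral_le_ball _ _ _ _ _ p) => // x xb; first by rewrite indicE mem_set// mulr1.
  by rewrite indicE memNset// mulr0.
by rewrite mulr_natl mulr2n EFinD; exact: leeD.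
Qed.

Section tower_of_vortices.
Context {R : realType} {N : nat}.
Local Notation V := 'rV[R]_N.
Local Notation lam := (lebesgue_rV R N).
Variables (q : V) (p : nat -> V) (D th : R).
Hypothesis D0 : 0 < D.
Hypothesis th0 : 0 < th.
Hypothesis th2 : th <= 2^-1.

(** The height above the boundary of the centre of the j-th vortex. The square
    makes min (height k) (height j) at most D th^k th^j, which is summable in j
    and leaves the factor th^k (see height_min). *)
Definition height j : R := D * (th ^+ j) ^+ 2.
Definition vortex_radius j : R := height j / 2.
(** With this amplitude, a bounded profile has mass of order
    height j / (j + 1) (see amplitude_volume): divided by the heights, the
    masses tend to 0, but their sum is infinite. *)
Definition amplitude j : R := height j / (j.+1%:R * height j ^+ N).

Hypothesis pq : forall j, `|p j - q| = height j.

Lemma height_gt0 j : 0 < height j. Proof. by rewrite /height mulr_gt0// exprn_gt0// exprn_gt0. Qed.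
Lemma vortex_radius_gt0 j : 0 < vortex_radius j. Proof. by rewrite divr_gt0// height_gt0. Qed.
Lemma amplitude_gt0 j : 0 < amplitude j.
Proof. by rewrite divr_gt0 ?height_gt0// mulr_gt0// exprn_gt0// height_gt0. Qed.

Lemma amplitude_volume j : amplitude j * (2 * vortex_radius j) ^+ N = height j / j.+1%:R.
Proof.
have -> : 2 * vortex_radius j = height j by rewrite /vortex_radius; field.
have dn : height j ^+ N != 0 by rewrite expf_neq0// gt_eqF// height_gt0.
by rewrite /amplitude invfM mulrA -mulrA mulVf// mulr1.
Qed.

Lemma height_addn j k : height (j + k) = height k * (th ^+ j) ^+ 2.
Proof. by rewrite /height exprD; ring. Qed.

Lemma th_exp_le1 j : 0 <= th ^+ j <= 1.
Proof.
have t1 : th <= 1 by apply: le_trans th2 _; rewrite invf_le1// ler1n.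
by apply/andP; split; [apply: exprn_ge0|apply: exprn_ile1 => //]; exact: ltW.
Qed.

Lemma th_exp_half j : th ^+ j <= 2^-1 ^+ j.
Proof. by rewrite lerXn2r// nnegrE ?ltW. Qed.

Lemma height_addn_le j k : height (j + k) <= height k * 2^-1 ^+ j.
Proof.
rewrite height_addn ler_pM2l ?height_gt0//.
apply: le_trans (th_exp_half j); have /andP[a b] := th_exp_le1 j.
by rewrite expr2 ler_piMl.
Qed.

Lemma height_lt j k : (j < k)%N -> 4 * height k <= height j.
Proof.
move=> jk; rewrite -(subnK jk) -addSnnS height_addn (exprS th).
have /andP[a b] := th_exp_le1 (k - j.+1); have := height_gt0 j.
set t := th ^+ _ in a b *; move: (height j) => x x0.
have t1 : t ^+ 2 <= 1 by rewrite expr_le1.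
have h : th ^+ 2 <= 4^-1.
  have -> : 4^-1 = (2^-1) ^+ 2 :> R by field.
  by apply: lerXn2r => //; rewrite nnegrE ltW.
have t2 : 0 <= t ^+ 2 by rewrite sqr_ge0.
rewrite exprMn.
have : th ^+ 2 * t ^+ 2 <= 4^-1 * 1 by apply: ler_pM; rewrite ?sqr_ge0.
nra.
Qed.

Lemma height_min j k : Num.min (height k) (height j) <= D * th ^+ k * 2^-1 ^+ j.
Proof.
have hj := th_exp_half j; have /andP[a b] := th_exp_le1 j; have /andP[c e] := th_exp_le1 k.
apply: (@le_trans _ _ (D * th ^+ k * th ^+ j)); last by rewrite ler_wpM2l// mulr_ge0// ltW.
rewrite ge_min /height !expr2 -!mulrA !(ler_pM2l D0).
have [h|h] := leP (th ^+ k) (th ^+ j); apply/orP; [left|right].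
  by rewrite ler_wpM2l.
by rewrite ler_wpM2r// ltW.
Qed.

Variables (G : 'I_N -> V -> R) (M L : R).
Hypothesis M0 : 0 < M.
Hypothesis L0 : 0 < L.
Hypothesis cG : forall i, continuous (G i).
Hypothesis GM : forall i x, `|G i x| <= M.
Hypothesis GL : forall i x y, `|G i x - G i y| <= L * `|x - y|.
Hypothesis G_off : forall i, vanishes_off 1 (G i).

(** The profile G transported to the ball of radius vortex_radius j about p j;
    see vortex_argE for the argument of G. *)
Definition vortex j i x := amplitude j * G i (- ((vortex_radius j)^-1 *: p j) + (vortex_radius j)^-1 *: x).

Lemma vortex_argE j x : - ((vortex_radius j)^-1 *: p j) + (vortex_radius j)^-1 *: x = (vortex_radius j)^-1 *: (x - p j).
Proof. by rewrite scalerBr addrC. Qed.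

Lemma vortex_off j i x : vortex_radius j <= `|x - p j| -> vortex j i x = 0.
Proof.
move=> h; rewrite /vortex vortex_argE G_off ?mulr0// normrZ gtr0_norm ?invr_gt0 ?vortex_radius_gt0//.
by rewrite mulrC ler_pdivlMr ?vortex_radius_gt0// mul1r.
Qed.

Lemma vortex_bound j i x : `|vortex j i x| <= amplitude j * M.
Proof. by rewrite normrM gtr0_norm ?amplitude_gt0// ler_pM2l// amplitude_gt0. Qed.

Lemma vortex_lip j i x y : `|vortex j i x - vortex j i y| <= amplitude j * (L * ((vortex_radius j)^-1 * `|x - y|)).
Proof.
rewrite /vortex !vortex_argE -mulrBr normrM gtr0_norm ?amplitude_gt0// ler_pM2l ?amplitude_gt0//.
apply: le_trans (GL _ _ _) _.
by rewrite -scalerBr opprB addrA subrK normrZ gtr0_norm ?invr_gt0 ?vortex_radius_gt0.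
Qed.

Lemma vortex_cont j i : continuous (vortex j i).
Proof.
apply: fun_continuousM; first exact: fun_continuous_cst.
by apply: (@continuous_comp_rV R N N _ (G i)) => //; exact: continuous_affine_rV.
Qed.

(** The j-th vortex lives in the shell of points whose distance to q is between
    height j / 2 and 3 height j / 2; the heights drop by a factor 4. *)
Lemma vortex_disjoint j k x : `|x - p j| < vortex_radius j -> `|x - p k| < vortex_radius k -> j = k.
Proof.
have far i : `|x - p i| < vortex_radius i -> height i / 2 < `|x - q| < 3 / 2 * height i.
  rewrite /vortex_radius => h; have := pq i.
  have h1 := ler_distD (p i) x q; have h2 := ler_distD x (p i) q.
  rewrite (distrC (p i) x) in h2.
  by move=> E; apply/andP; split; lra.
move=> /far/andP[a b] /far/andP[c e].
have dj := height_gt0 j; have dk := height_gt0 k.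
by case: (ltngtP j k) => // /height_lt h; exfalso; lra.
Qed.

Lemma at_most_one_vortex x : exists j0, forall j, j != j0 -> forall i, vortex j i x = 0.
Proof.
have [[j0 h]|h] := pselect (exists j, `|x - p j| < vortex_radius j).
  exists j0 => j /eqP jj0 i; apply: vortex_off; rewrite leNgt; apply/negP => hj.
  by apply: jj0; exact: vortex_disjoint hj h.
exists 0%N => j _ i; apply: vortex_off; rewrite leNgt; apply/negP => hj.
by apply: h; exists j.
Qed.

Definition tower_psum m i x := \sum_(j < m) vortex j i x.
(** At every point at most one term is different from 0, so the partial sums are
    eventually constant (see tower_psum_ex) and the limit exists. *)
Definition tower i x := limn (fun m => tower_psum m i x).

Lemma tower_psum_one j0 i x : (forall j, j != j0 -> vortex j i x = 0) ->
  forall m, tower_psum m i x = if (j0 < m)%N then vortex j0 i x else 0.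
Proof.
move=> h m; rewrite /tower_psum; case: ifPn => [j0m|mj0].
  rewrite (bigD1 (Ordinal j0m))//= big1 ?addr0// => j jj0; apply: h.
  by apply: contra jj0 => /eqP jj0; apply/eqP/val_inj.
apply: big1 => j _; apply: h; apply: contra mj0 => /eqP <-; exact: ltn_ord.
Qed.

Lemma tower_one j0 i x : (forall j, j != j0 -> vortex j i x = 0) -> tower i x = vortex j0 i x.
Proof.
move=> h; rewrite /tower; apply/cvg_lim => //; apply: cvg_near_cst.
by exists j0.+1 => // m /= mj0; rewrite (tower_psum_one h) mj0.
Qed.

Lemma tower_psum_cvg i x : tower_psum m i x @[m --> \oo] --> tower i x.
Proof.
have [j0 h] := at_most_one_vortex x; rewrite (@tower_one j0)//; last by move=> j /h.
apply: cvg_near_cst.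
by exists j0.+1 => // m /= mj0; rewrite (@tower_psum_one j0) ?mj0// => j /h.
Qed.

Lemma tower_psum_le m i x : `|tower_psum m i x| <= `|tower i x|.
Proof.
have [j0 h] := at_most_one_vortex x; rewrite (@tower_one j0)//; last by move=> j /h.
rewrite (@tower_psum_one j0); last by move=> j /h.
by case: ifP => // _; rewrite normr0.
Qed.

Lemma tower_psum_ex i x : exists m0, forall m, (m0 <= m)%N -> tower_psum m i x = tower i x.
Proof.
have [j0 h] := at_most_one_vortex x; exists j0.+1 => m mj0; rewrite (@tower_one j0)//; last by move=> j /h.
by rewrite (@tower_psum_one j0) ?mj0// => j /h.
Qed.

Lemma tower_vortex j i x : `|x - p j| < vortex_radius j -> tower i x = vortex j i x.
Proof.
move=> xj; apply: tower_one => k kj; apply: vortex_off; rewrite leNgt; apply/negP => xk.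
by move: kj; rewrite (vortex_disjoint xk xj) eqxx.
Qed.

Lemma tower_psum_cont m i : continuous (tower_psum m i).
Proof. by apply: fun_continuous_sum => j; exact: vortex_cont. Qed.

Lemma tower_measurable i : measurable_fun setT (tower i : V -> measurableTypeR R).
Proof.
apply: (@measurable_fun_cvg _ _ _ _ (fun m => tower_psum m i)) => [m|x _].
  by apply: continuous_measurable_rV; exact: tower_psum_cont.
exact: tower_psum_cvg.
Qed.

Lemma tower_le_series k i x : (forall j, (j < k)%N -> vortex_radius j <= `|x - p j|) ->
  (`|tower i x|%:E <= \sum_(0 <= j <oo) `|vortex (j + k) i x|%:E)%E.
Proof.
move=> h; have [m0 hm] := tower_psum_ex i x.
rewrite -(hm (m0 + k)%N (leq_addr _ _)).
apply: le_trans (nneseries_lim_ge m0 _); last by move=> j _ _; rewrite lee_fin.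
rewrite sumEFin lee_fin /tower_psum addnC big_split_ord/= big1 ?add0r; last first.
  by move=> j _; apply: vortex_off; exact: h.
apply: le_trans (ler_norm_sum _ _ _) _; rewrite big_mkord.
by apply: ler_sum => j _; rewrite addnC.
Qed.

Lemma tower_diff_series i x y :
  (`|tower i x - tower i y|%:E <= \sum_(0 <= j <oo) `|vortex j i x - vortex j i y|%:E)%E.
Proof.
(* A common partial sum computes both values. *)
have [m1 h1] := tower_psum_ex i x; have [m2 h2] := tower_psum_ex i y.
rewrite -(h1 (maxn m1 m2) (leq_maxl _ _)) -(h2 (maxn m1 m2) (leq_maxr _ _)).
apply: le_trans (nneseries_lim_ge (maxn m1 m2) _); last by move=> j _ _; rewrite lee_fin.
rewrite sumEFin lee_fin /tower_psum -sumrB big_mkord.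
exact: ler_norm_sum.
Qed.

(** The mass that is visible where the first k vortices vanish. *)
Lemma tower_tail (S : set V) k i :
  (forall x j, S x -> (j < k)%N -> vortex_radius j <= `|x - p j|) ->
  (\int[lam]_(x in S) `|tower i x|%:E <= (2 * (M * height k / k.+1%:R))%:E)%E.
Proof.
move=> hS; rewrite integral_mkcond.
apply: (@le_trans _ _ (\int[lam]_x \sum_(0 <= j <oo) `|vortex (j + k) i x|%:E)%E).
  apply: integral_mono => x _; first by apply: erestrict_ge0 => y _; rewrite lee_fin.
  rewrite patchE; case: ifPn => [/set_mem xS|_].
    by apply: tower_le_series => j; exact: hS.
  by apply: nneseries_ge0 => j _ _; rewrite lee_fin.
rewrite integral_nneseries//; last first.
- move=> j; apply/measurable_EFinP; apply: continuous_measurable_rV.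
  by apply: fun_continuous_norm; exact: vortex_cont.
apply: nneseries_le_geometric.
- by apply: divr_ge0 => //; apply: mulr_ge0; apply: ltW => //; exact: height_gt0.
- by move=> j; apply: integral_ge0 => x _; rewrite lee_fin.
move=> j.
apply: (@le_trans _ _ ((amplitude (j + k) * M) * (2 * vortex_radius (j + k)) ^+ N)%:E).
  apply: (@integral_le_ball _ _ _ _ _ (p (j + k))) => //.
  - exact: vortex_radius_gt0.
  - by rewrite mulr_ge0// ltW// amplitude_gt0.
  - by move=> x _; rewrite lee_fin vortex_bound.
  - move=> x; rewrite -ball_normE /ball_/= distrC => /negP; rewrite -leNgt => h.
    by rewrite vortex_off// normr0.
rewrite lee_fin mulrAC amplitude_volume.
apply: (@le_trans _ _ (height k * 2^-1 ^+ j / k.+1%:R * M)).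
  rewrite ler_pM2r//; apply: ler_pM => //; first exact/ltW/height_gt0.
    exact: height_addn_le.
  by rewrite lef_pV2 ?posrE// ler_nat ltnS leq_addl.
by rewrite le_eqVlt; apply/orP; left; apply/eqP; ring.
Qed.

Lemma tower_integrable i : lam.-integrable setT (EFin \o tower i).
Proof.
apply/integrableP; split; first by apply/measurable_EFinP; exact: tower_measurable.
have h : forall x j, [set: V] x -> (j < 0)%N -> vortex_radius j <= `|x - p j| by [].
by apply: le_lt_trans (tower_tail i h) _; exact: ltry.
Qed.

(** A translation by C height k changes the j-th vortex in L1 by at most its
    Lipschitz constant times the shift and the volume, a multiple of height k,
    and by at most twice its mass, a multiple of height j. *)
Lemma tower_shift_L1 i (u w : V) k (C B : R) : `|u - w| <= C * height k ->
  L * C <= B -> M <= B ->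
  (\int[lam]_x `|tower i (x - u) - tower i (x - w)|%:E <= (8 * B * D * th ^+ k)%:E)%E.
Proof.
move=> uw LB MB.
have B0 : 0 < B by exact: lt_le_trans MB.
apply: (@le_trans _ _ (\int[lam]_x \sum_(0 <= j <oo) `|vortex j i (x - u) - vortex j i (x - w)|%:E)%E).
  by apply: integral_mono => x _; [rewrite lee_fin|exact: tower_diff_series].
have cp j (v : V) : continuous (fun x : V => vortex j i (x - v)).
  apply: (@continuous_comp_rV R N N (fun x : V => x - v)); last exact: vortex_cont.
  by move=> x; apply: (@cvgB R V _ (nbhs x)); [exact: cvg_id|exact: cvg_cst].
rewrite integral_nneseries//; last first.
- move=> j; apply/measurable_EFinP; apply: continuous_measurable_rV.
  by apply: fun_continuous_norm; apply: fun_continuousB.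
have -> : 8 * B * D * th ^+ k = 2 * (4 * B * (D * th ^+ k)) by ring.
apply: nneseries_le_geometric.
- apply: mulr_ge0; first by rewrite mulr_ge0// ltW.
  by apply: mulr_ge0; [|apply: exprn_ge0]; exact: ltW.
- by move=> j; apply: integral_ge0 => x _; rewrite lee_fin.
move=> j.
(* Divided by the amplitude: the Lipschitz bound and twice the maximum. *)
pose m := Num.min (L * ((vortex_radius j)^-1 * (C * height k))) (2 * M).
have C0 : 0 <= C.
  by rewrite -(pmulr_rge0 _ (height_gt0 k)) mulrC; apply: le_trans uw.
have m0 : 0 <= m.
  rewrite le_min; apply/andP; split; last by rewrite mulr_ge0// ltW.
  apply: mulr_ge0; first exact: ltW.
  by apply: mulr_ge0; [rewrite invr_ge0; exact/ltW/vortex_radius_gt0|apply: mulr_ge0 => //; exact/ltW/height_gt0].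
apply: (@le_trans _ _ (2 * ((amplitude j * m) * (2 * vortex_radius j) ^+ N))%:E).
  apply: (@integral_le_2balls _ _ _ _ _ (p j + u) (p j + w)) => //.
  - exact: vortex_radius_gt0.
  - by rewrite mulr_ge0// ltW// amplitude_gt0.
  - move=> x _; rewrite lee_fin; apply: (@le_trans _ _ (Num.min (amplitude j * (L * ((vortex_radius j)^-1 * (C * height k)))) (amplitude j * (2 * M)))).
      rewrite le_min; apply/andP; split.
        apply: le_trans (vortex_lip _ _ _ _) _.
        rewrite ler_pM2l ?amplitude_gt0// ler_pM2l// ler_pM2l ?invr_gt0 ?vortex_radius_gt0//.
        by rewrite opprB addrC addrA subrK distrC.
      apply: le_trans (ler_normB _ _) _.
      have := vortex_bound j i (x - u); have := vortex_bound j i (x - w); lra.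
    by rewrite /m minr_pMr// ltW// amplitude_gt0.
  - move=> x; rewrite -!ball_normE /ball_/= => /negP; rewrite -leNgt => h1 /negP; rewrite -leNgt => h2.
    rewrite !vortex_off ?subrr ?normr0//.
      by move: h2; rewrite distrC opprD addrA addrAC.
    by move: h1; rewrite distrC opprD addrA addrAC.
rewrite lee_fin mulrAC amplitude_volume.
have j1 : j.+1%:R^-1 <= 1 :> R by rewrite invf_le1// ler1n.
have dj := height_gt0 j; have dk := height_gt0 k.
have B1 : 0 <= B by exact: ltW.
have mk : height j * m <= 2 * B * height k.
  apply: (@le_trans _ _ (height j * (L * ((vortex_radius j)^-1 * (C * height k))))).
    by rewrite ler_pM2l// ge_min lexx.
  have -> : height j * (L * ((vortex_radius j)^-1 * (C * height k))) = 2 * (L * C) * height k.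
    by rewrite /vortex_radius; field; rewrite gt_eqF.
  by rewrite ler_pM2r// ler_pM2l.
have mj : height j * m <= 2 * B * height j.
  apply: (@le_trans _ _ (height j * (2 * M))).
    by rewrite ler_pM2l// ge_min lexx orbT.
  by rewrite mulrC ler_pM2r// ler_pM2l.
have dm : height j * m <= 2 * B * Num.min (height k) (height j).
  by case: (leP (height k) (height j)).
have h := height_min j k.
apply: (@le_trans _ _ (2 * (height j * m))).
  rewrite ler_pM2l// mulrAC ler_piMr//.
  by rewrite mulr_ge0// ltW.
apply: (@le_trans _ _ (2 * (2 * B * (D * th ^+ k * 2^-1 ^+ j)))).
  rewrite ler_pM2l//; apply: le_trans dm _.
  by rewrite ler_wpM2l// mulr_ge0.
by rewrite le_eqVlt; apply/orP; left; apply/eqP; ring.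
Qed.

Section divergence.
Hypothesis Gdiv : forall a (t : R) phi, t != 0 -> smooth phi ->
  (\int[lam]_x (\sum_(i < N) G i (a + t *: x) * partial i phi x)%:E = 0)%E.

(** The partial sums are divergence-free and dominated by the tower itself. *)
Lemma tower_divergence phi : test_function setT phi ->
  (\int[lam]_x (\sum_(i < N) tower i x * partial i phi x)%:E = 0)%E.
Proof.
move=> [sphi cphi _].
have [r r0 phir] : exists2 r, 0 < r & vanishes_off r phi.
  have [B [_ HB]] := compact_bounded cphi.
  exists (`|B| + 2); first by rewrite ltr_wpDl.
  move=> x xr; apply/eqP/negP => /negP phix.
  have /HB : `|B| + 1 > B by rewrite (le_lt_trans (ler_norm B))// ltrDl.
  have cx : closed_support phi x by apply: subset_closure.
  move=> /(_ x cx) /= h.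
  by have := le_trans xr h; rewrite lerD2l leNgt ltr1n.
have cdphi i : continuous (partial i phi).
  by apply: smooth_cont; exact: smooth_partial.
have phi_off i x : r < `|x| -> partial i phi x = 0 by exact: (vanishes_off_partial i phir).
pose S x := \sum_(i < N) `|partial i phi x|.
have cS : continuous S by apply: fun_continuous_sum => i; exact: fun_continuous_norm.
have S_off : vanishes_off (r + 1) S.
  move=> x xr; apply: big1 => i _; rewrite phi_off ?normr0//.
  by apply: lt_le_trans xr; rewrite ltrDl.
have [Mp Mp0 SM] := vanishing_bounded cS S_off.
have dphiM i x : `|partial i phi x| <= Mp.
  have := le_trans (ler_norm _) (SM x); apply: le_trans.
  by rewrite /S (bigD1 i)//= lerDl sumr_ge0.
pose P (f : 'I_N -> V -> R) x := \sum_(i < N) f i x * partial i phi x.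
have cP (f : 'I_N -> V -> R) : (forall i, continuous (f i)) -> continuous (P f).
  by move=> cf; apply: fun_continuous_sum => i; apply: fun_continuousM; [exact: cf|exact: cdphi].
have P_off f : vanishes_off (r + 1) (P f).
  move=> x xr; apply: big1 => i _; rewrite phi_off ?mulr0//.
  by apply: lt_le_trans xr; rewrite ltrDl.
have P0 j : (\int[lam]_x (P (vortex j) x)%:E = 0)%E.
  transitivity (\int[lam]_x ((amplitude j)%:E * (\sum_(i < N)
      G i (- ((vortex_radius j)^-1 *: p j) + (vortex_radius j)^-1 *: x)%R * partial i phi x)%:E))%E.
    apply: eq_integral => x _; rewrite -EFinM; congr EFin.
    by rewrite mulr_sumr; apply: eq_bigr => i _; rewrite /vortex mulrA.
  have t0 : (vortex_radius j)^-1 != 0 by rewrite invr_eq0 gt_eqF// vortex_radius_gt0.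
  rewrite integralZl//; first by rewrite (Gdiv _ t0 sphi) mule0.
  apply: (@vanishing_integrable _ _ (r + 1) (fun x => \sum_(i < N)
      G i (- ((vortex_radius j)^-1 *: p j) + (vortex_radius j)^-1 *: x)%R * partial i phi x)).
    apply: (cP (fun i x => G i (- ((vortex_radius j)^-1 *: p j) + (vortex_radius j)^-1 *: x))) => i.
    by apply: (@continuous_comp_rV R N N _ (G i)) => //; exact: continuous_affine_rV.
  exact: (P_off (fun i x => G i (- ((vortex_radius j)^-1 *: p j) + (vortex_radius j)^-1 *: x))).
have PS0 m : (\int[lam]_x (P (tower_psum m) x)%:E = 0)%E.
  elim: m => [|m IH].
    rewrite (_ : (fun x => _) = cst 0%E) ?integral0//; apply/funext => x.
    by congr EFin; apply: big1 => i _; rewrite /tower_psum big_ord0 mul0r.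
  transitivity (\int[lam]_x ((P (tower_psum m) x)%:E + (P (vortex m) x)%:E))%E.
    apply: eq_integral => x _; rewrite -EFinD; congr EFin.
    by rewrite -big_split/=; apply: eq_bigr => i _; rewrite /tower_psum big_ord_recr/= mulrDl.
  rewrite integralD_EFin//; first by rewrite IH P0 adde0.
    by apply: (vanishing_integrable _ (P_off _)); apply: cP => i; exact: tower_psum_cont.
  by apply: (vanishing_integrable _ (P_off _)); apply: cP => i; exact: vortex_cont.
pose g x := \sum_(i < N) Mp * `|tower i x|.
have ig : lam.-integrable setT (EFin \o g).
  rewrite (_ : EFin \o g = (fun x => \sum_(i < N) Mp%:E * (`|tower i x|)%:E)%E).
    apply: integrable_sum => // i _; apply: integrableZl => //.
    exact: integrable_norm (tower_integrable i).
  by apply/funext => x /=; rewrite sumEFin.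
have mP m : measurable_fun setT (EFin \o P (tower_psum m)).
  apply/measurable_EFinP; apply: continuous_measurable_rV; apply: cP => i.
  exact: tower_psum_cont.
have mF : measurable_fun setT (EFin \o P tower).
  apply/measurable_EFinP; apply: measurable_sum => i.
  apply: measurable_funM; first exact: tower_measurable.
  exact: continuous_measurable_rV.
have cv : {ae lam, forall x, setT x -> (EFin \o P (tower_psum m)) x @[m --> \oo] --> (EFin \o P tower) x}.
  apply: aeW => x _; apply: cvg_EFin; first exact: nearW.
  apply: cvg_near_cst.
  have [j0 h] := at_most_one_vortex x.
  exists j0.+1 => // m /= mj0; apply: eq_bigr => i _; congr (_ * _).
  by rewrite (@tower_one j0) ?(@tower_psum_one j0) ?mj0// => j /h.
have bd : {ae lam, forall x m, setT x -> (`|(EFin \o P (tower_psum m)) x| <= (EFin \o g) x)%E}.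
  apply: aeW => x m _; rewrite /= lee_fin.
  apply: le_trans (ler_norm_sum _ _ _) _; apply: ler_sum => i _.
  by rewrite normrM mulrC; apply: ler_pM => //; exact: tower_psum_le.
have [_ _] := dominated_convergence measurableT mP mF cv ig bd.
move=> /cvg_lim <-//.
by rewrite (_ : (fun m => _) = cst 0%E) ?lim_cst//; apply/funext => m; exact: PS0.
Qed.

End divergence.

Section mollified.
Variables (rho : V -> R) (Mr rmin r0 C ga ka : R) (a : V) (i0 : 'I_N).
Hypothesis crho : continuous rho.
Hypothesis rho0 : forall x, 0 <= rho x.
Hypothesis rhoM : forall x, rho x <= Mr.
Hypothesis rho_off : vanishes_off 1 rho.
Hypothesis rmin0 : 0 < rmin.
Hypothesis rho_min : forall x, `|x| < r0 -> rmin <= rho x.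
Hypothesis ga0 : 0 < ga.
Hypothesis ka0 : 0 < ka.
Hypothesis G_min : forall x, `|a - x| < ka -> ga <= G i0 x.
Hypothesis C0 : 0 < C.
Hypothesis Cr0 : 3 < C * r0.
Hypothesis Cth : 2 * C * th ^+ 2 <= 1.
Variable S : set V.
Hypothesis Sp : forall x j, S x -> height j <= `|x - p j|.

Local Notation delta k := (C * height k).

Let delta_gt0 k : 0 < delta k. Proof. by rewrite mulr_gt0// height_gt0. Qed.

Lemma delta_le_height j k : (j < k)%N -> 2 * delta k <= height j.
Proof.
move=> jk; rewrite -(subnK jk) -addSnnS height_addn (exprS th).
have /andP[b1 b2] := th_exp_le1 (k - j.+1); have dj := height_gt0 j.
set t := th ^+ _ in b1 b2 *.
have -> : 2 * (C * (height j * (th * t) ^+ 2)) = (2 * C * th ^+ 2) * t ^+ 2 * height j by ring.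
rewrite -[leRHS]mul1r ler_pM2r//.
have t1 : t ^+ 2 <= 1 by rewrite expr_le1.
have s0 : 0 <= 2 * C * th ^+ 2 by rewrite mulr_ge0 ?sqr_ge0// mulr_ge0// ltW.
by rewrite mulr_ile1// sqr_ge0.
Qed.

Let pos_part i : V -> R := (tower i)^\+.

Let pos_measurable i : measurable_fun setT (pos_part i : V -> measurableTypeR R).
Proof. by apply: measurable_funrpos; exact: tower_measurable. Qed.

Let pos_ge0 i x : 0 <= pos_part i x.
Proof. by rewrite /pos_part /funrpos le_max lexx orbT. Qed.

Let pos_le i x : pos_part i x <= `|tower i x|.
Proof. by rewrite /pos_part /funrpos ge_max ler_norm normr_ge0. Qed.

Let pos_integrable i : lam.-integrable setT (EFin \o pos_part i).
Proof.
apply: le_integrable (tower_integrable i) => //; first by apply/measurable_EFinP; exact: pos_measurable.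
by move=> x _ /=; rewrite lee_fin (ger0_norm (pos_ge0 _ _)).
Qed.

(** From a boundary point, the kernel of scale C height k does not reach the
    first k vortices, so only the mass of the tail counts. *)
Lemma mollified_le i k x : S x ->
  convolution (pos_part i) (rescale rho (delta k)) x <=
  C ^- N * Mr * (2 * M) * (height k ^- N * height k / k.+1%:R).
Proof.
move=> Sx; rewrite -lee_fin (conv_def rho0 rhoM)//.
have Mr0 : 0 <= Mr by apply: le_trans (rho0 0) _.
have dn : 0 <= delta k ^- N by rewrite invr_ge0 exprn_ge0// ltW.
pose B : set V := [set y | `|x - y| < delta k].
apply: (@le_trans _ _ (\int[lam]_y ((delta k ^- N * Mr)%:E * ((fun y => `|tower i y|%:E) \_ B) y))%E).
  apply: integral_mono => y _; first by rewrite lee_fin mulr_ge0// /rescale mulr_ge0.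
  rewrite patchE; case: ifPn => [_|/negP yB].
    rewrite -EFinM lee_fin mulrC; apply: ler_pM => //.
      by rewrite /rescale mulr_ge0.
    by rewrite /rescale ler_wpM2l.
  rewrite /rescale rho_off ?mulr0 ?mule0// normrZ gtr0_norm ?invr_gt0//.
  by rewrite mulrC ler_pdivlMr// mul1r leNgt; apply/negP => h; apply: yB; rewrite inE.
have mB : measurable B.
  apply: open_measurable_rV.
  rewrite (_ : B = ball x (delta k)); first exact: ball_open.
  by rewrite -ball_normE.
have mFB : measurable_fun setT ((fun y => `|tower i y|%:E) \_ B).
  have mabs : measurable_fun setT (fun y : V => `|tower i y|%:E).
    by apply/measurable_EFinP; apply: measurableT_comp => //; exact: tower_measurable.
  exact: (proj1 (measurable_restrictT _ mB) (measurable_funTS mabs)).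
rewrite ge0_integralZl//; last 2 first.
- by move=> y _; apply: erestrict_ge0 => z _; rewrite lee_fin.
- by rewrite lee_fin mulr_ge0.
rewrite -integral_mkcond.
have -> : C ^- N * Mr * (2 * M) * (height k ^- N * height k / k.+1%:R) =
   (delta k ^- N * Mr) * (2 * (M * height k / k.+1%:R)).
  rewrite [delta k ^+ N]exprMn invfM; move: (C ^- N) (height k ^- N) (k.+1%:R^-1) => A1 A2 A3.
  by ring.
rewrite [X in (_ <= X)%E]EFinM; apply: lee_wpmul2l; first by rewrite lee_fin mulr_ge0.
apply: tower_tail => y j; rewrite /B/= => xy jk.
have h1 := delta_le_height jk; have h2 := Sp j Sx; have h3 := ler_distD y x (p j).
by rewrite /vortex_radius ler_pdivrMr//; lra.
Qed.

(** The k-th vortex alone contributes this much: it is within 3 height k of x, a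
    distance at which the kernel of scale C height k is bounded below. *)
Lemma mollified_ge k x : `|x - q| <= height k ->
  ga * rmin * ka ^+ N * C ^- N * (height k ^- N * height k / k.+1%:R) <=
  convolution (pos_part i0) (rescale rho (delta k)) x.
Proof.
move=> xq; rewrite -lee_fin (conv_def rho0 rhoM)//.
have dn : 0 < delta k ^- N by rewrite invr_gt0 exprn_gt0.
have rk := vortex_radius_gt0 k.
(* The cube on which the profile of the vortex k is bounded below. *)
pose y0 := p k + vortex_radius k *: a.
pose w := amplitude k * ga * (delta k ^- N * rmin).
have w0 : 0 < w.
  by apply: mulr_gt0; [apply: mulr_gt0 => //; exact: amplitude_gt0|exact: mulr_gt0].
have kr0 : 0 < vortex_radius k * ka by rewrite mulr_gt0.
have mb : measurable (ball y0 (vortex_radius k * ka)) by apply: open_measurable_rV; exact: ball_open.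
apply: (@le_trans _ _ (\int[lam]_y (w * \1_(ball y0 (vortex_radius k * ka)) y)%:E)%E); last first.
  apply: integral_mono => y _; first by rewrite lee_fin mulr_ge0// ltW.
  rewrite lee_fin indicE.
  have [yb|yb] := pselect (ball y0 (vortex_radius k * ka) y); last first.
    by rewrite memNset// mulr0 mulr_ge0// /rescale mulr_ge0// ltW.
  rewrite mem_set// mulr1 /w.
  have yG : ga <= G i0 (- ((vortex_radius k)^-1 *: p k) + (vortex_radius k)^-1 *: y).
    apply: G_min; rewrite vortex_argE.
    have -> : a - (vortex_radius k)^-1 *: (y - p k) = (vortex_radius k)^-1 *: (y0 - y).
      rewrite /y0 !scalerBr scalerDr scalerA mulVf ?gt_eqF// scale1r opprB.
      by rewrite addrA (addrC a).
    rewrite normrZ gtr0_norm ?invr_gt0// mulrC ltr_pdivrMr// mulrC.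
    by move: yb; rewrite -ball_normE.
  have yk : `|y - p k| < vortex_radius k.
    rewrite ltNge; apply/negP => h; move: yG.
    rewrite vortex_argE leNgt => /negP; apply.
    rewrite G_off// normrZ gtr0_norm ?invr_gt0//.
    by rewrite mulrC ler_pdivlMr// mul1r.
  have Fy : amplitude k * ga <= pos_part i0 y.
    rewrite /pos_part /funrpos le_max; apply/orP; left.
    by rewrite (tower_vortex i0 yk) /vortex ler_pM2l// amplitude_gt0.
  apply: ler_pM => //.
  - by apply: mulr_ge0; apply: ltW => //; exact: amplitude_gt0.
  - by apply: mulr_ge0; exact: ltW.
  rewrite /rescale ler_pM2l//; apply: rho_min.
  rewrite normrZ gtr0_norm ?invr_gt0// mulrC ltr_pdivrMr//.
  have h1 := ler_distD q x y; have h2 := ler_distD (p k) q y.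
  have h3 := pq k; rewrite (distrC q (p k)) (distrC (p k) y) in h2.
  have dk := height_gt0 k.
  have h4 : 3 * height k < C * r0 * height k by rewrite ltr_pM2r.
  have h5 : r0 * (C * height k) = C * r0 * height k by ring.
  rewrite h5; rewrite /vortex_radius in yk; lra.
rewrite (integralZl_indic measurableT (fun=> ball y0 (vortex_radius k * ka)))//; last first.
  by move=> w0'; move: w0; rewrite ltNge ltW.
rewrite integral_indic// setIT.
have -> : ga * rmin * ka ^+ N * C ^- N * (height k ^- N * height k / k.+1%:R) =
   w * (2 * (vortex_radius k * ka)) ^+ N.
  have E : amplitude k * (2 * (vortex_radius k * ka)) ^+ N = height k / k.+1%:R * ka ^+ N.
    by rewrite -amplitude_volume mulrA exprMn; ring.
  have -> : w * (2 * (vortex_radius k * ka)) ^+ N = ga * (delta k ^- N * rmin) * (amplitude k * (2 * (vortex_radius k * ka)) ^+ N).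
    by rewrite /w; ring.
  rewrite E [delta k ^+ N]exprMn invfM.
  move: (C ^- N) (height k ^- N) (k.+1%:R^-1) (ka ^+ N) => A1 A2 A3 A4.
  by ring.
by rewrite EFinM -(lebesgue_ball y0 kr0).
Qed.

(** The factor height k ^ (1 - N) grows by at least th ^ -2 from one scale to the
    next when N is at least 2, so that a small th makes the trace at the new
    scale dominate what was visible at the previous one. *)
Lemma mollified_jump k x : (2 <= N)%N -> S x -> `|x - q| <= height k.+1 ->
  4 * (C ^- N * Mr * (2 * M)) * th ^+ 2 <= ga * rmin * ka ^+ N * C ^- N ->
  ga * rmin * ka ^+ N * C ^- N / 2 * (height k.+1 ^- N * height k.+1 / k.+2%:R) <=
  `|convolution (pos_part i0) (rescale rho (delta k.+1)) x
    - convolution (pos_part i0) (rescale rho (delta k)) x|.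
Proof.
move=> N2 Sx xq hth.
have ge := mollified_ge xq; have le := mollified_le i0 k Sx.
apply: le_trans (ler_norm _).
have Mr0 : 0 <= Mr by apply: le_trans (rho0 0) _.
have CN : 0 <= C ^- N by rewrite invr_ge0 exprn_ge0// ltW.
have B0 : 0 <= C ^- N * Mr * (2 * M) by rewrite !mulr_ge0// ltW.
move: ge le hth; set A := ga * _ * _ * _; set B := C ^- N * _ * _ in B0 *.
set X := convolution _ _ _; set Y := convolution _ _ _.
have d0 := height_gt0 k; have d1 := height_gt0 k.+1.
(* This is height j ^ (1 - N). *)
pose e j := height j ^- N * height j.
have eE : e k <= th ^+ 2 * e k.+1.
  rewrite /e; case: N N2 => [//|[//|N' _]].
  have E (d : R) : 0 < d -> d ^- N'.+2 * d = (d ^+ N'.+1)^-1.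
    by move=> d00; rewrite exprSr invfM -mulrA mulVf ?mulr1 ?gt_eqF// mulrC.
  rewrite !E//.
  have -> : height k.+1 = th ^+ 2 * height k by rewrite -add1n height_addn expr1 mulrC.
  have t20 : 0 < th ^+ 2 by rewrite exprn_gt0.
  have t21 : th ^+ 2 <= 1 by have /andP[t0 t1] := th_exp_le1 1; rewrite expr_le1.
  have tdk : 0 < th ^+ 2 * height k by exact: mulr_gt0.
  rewrite -[leLHS]mul1r ler_pdivrMr ?exprn_gt0// mulrAC ler_pdivlMr ?exprn_gt0//.
  rewrite mul1r (exprS (th ^+ 2 * height k)) -mulrA ler_pM2l// (exprS (height k)) ler_pM2l//.
  have le1 : th ^+ 2 * height k <= height k by rewrite -[leRHS]mul1r ler_pM2r.
  by apply: lerXn2r le1; rewrite nnegrE // ltW.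
rewrite -!/(e _) => hX hY hAB.
have e1 : 0 < e k.+1 by rewrite mulr_gt0// invr_gt0 exprn_gt0.
have Y1 : Y <= B * (th ^+ 2 * e k.+1 * (2 / k.+2%:R)).
  apply: le_trans hY _; apply: ler_wpM2l => //; apply: ler_pM => //.
    by rewrite mulr_ge0// ?invr_ge0 ?exprn_ge0// ltW.
  by rewrite ler_pdivlMr// ler_pdivrMl// -natrM ler_nat muln2 -addnn addSnnS leq_addl.
have Y2 : B * (th ^+ 2 * e k.+1 * (2 / k.+2%:R)) <= A / 2 * (e k.+1 / k.+2%:R).
  have -> : B * (th ^+ 2 * e k.+1 * (2 / k.+2%:R)) = 4 * B * th ^+ 2 / 2 * (e k.+1 / k.+2%:R).
    by move: (k.+2%:R^-1) => U; field.
  by rewrite ler_pM2r ?ler_pM2r ?invr_gt0 ?divr_gt0.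
have E2 : A * (e k.+1 / k.+2%:R) = A / 2 * (e k.+1 / k.+2%:R) + A / 2 * (e k.+1 / k.+2%:R).
  by move: (k.+2%:R^-1) => U; field.
rewrite E2 in hX; rewrite lerBrDr; apply: le_trans hX; rewrite lerD2l.
exact: le_trans Y1 Y2.
Qed.

(** The function f stands for the positive and negative parts of the i-th
    component of the tower. *)
Lemma mollified_L1 i k (f : V -> R) (B : R) :
  (\int[lam]_x (rho x)%:E = 1)%E ->
  measurable_fun setT (f : V -> measurableTypeR R) -> (forall x, 0 <= f x) ->
  lam.-integrable setT (EFin \o f) ->
  (forall x y, `|f x - f y| <= `|tower i x - tower i y|) ->
  L * C <= B -> M <= B -> 8 * B * D <= 1 ->
  (\int[lam]_x `|convolution f (rescale rho (delta k.+1)) x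
     - convolution f (rescale rho (delta k)) x|%:E <= (2 ^- k)%:E)%E.
Proof.
move=> rho1 mf f0 fi fF LB MB BD.
have B0 : 0 < B by exact: lt_le_trans MB.
apply: (@le_trans _ _ (8 * B * D * th ^+ k)%:E); last first.
  rewrite lee_fin -exprVn -[leRHS]mul1r; apply: ler_pM => //.
  - by apply: mulr_ge0; [apply: mulr_ge0 => //|]; exact: ltW.
  - by case/andP : (th_exp_le1 k).
  - exact: th_exp_half.
apply: (conv_diff_L1 crho rho0 rhoM rho_off rho1) => // z z1.
apply: le_trans (tower_shift_L1 i (u := delta k.+1 *: z) (w := delta k *: z) (k := k) _ LB MB).
  by apply: integral_mono => x _; rewrite lee_fin.
have dle : 4 * height k.+1 <= height k by exact: height_lt.
have d1 := height_gt0 k.+1.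
rewrite -scalerBl normrZ -[leRHS]mulr1; apply: ler_pM => //; last exact: ltW.
rewrite distrC -mulrBr normrM gtr0_norm// ler_pM2l//.
by rewrite ger0_norm; lra.
Qed.

(** The vortices up to the k-th are at distance at least height k / 2 from S. *)
Lemma nbhd_mass k (eps : R) : eps <= height k / 2 ->
  (\int[lam]_(x in enbhd eps S) (enorm (\row_i tower i x))%:E
    <= (N%:R * (2 * (M * height k.+1 / k.+2%:R)))%:E)%E.
Proof.
move=> ek.
(* A closed set that contains the neighbourhood and misses the first
   vortices. *)
pose T : set V := \bigcap_(j in `I_k.+1) [set x | vortex_radius j <= `|x - p j|].
have ST : enbhd eps S `<=` T.
  move=> x [y Sy xy] j /= jk.
  have h1 := Sp j Sy; have h2 := ler_distD x y (p j).
  have h3 : `|y - x| < eps by rewrite distrC; apply: le_lt_trans (norm_le_enorm _) xy.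
  have h4 : height k <= height j.
    move: jk; rewrite ltnS leq_eqVlt => /predU1P[->//|/height_lt].
    by have := height_gt0 k; lra.
  rewrite /vortex_radius; lra.
have mT : measurable T.
  apply: bigcap_measurable; first by exists 0%N.
  move=> j _; rewrite -[X in measurable X]setCK; apply: measurableC.
  apply: open_measurable_rV.
  rewrite (_ : ~` _ = ball (p j) (vortex_radius j)); first exact: ball_open.
  rewrite -ball_normE; apply/seteqP; split => x /=.
    by move=> /negP; rewrite -ltNge distrC.
  by move=> h /(lt_le_trans h); rewrite distrC ltxx.
have mabs i : measurable_fun T (fun x : V => `|tower i x|%:E).
  apply: measurable_funTS; apply/measurable_EFinP.
  by apply: measurableT_comp => //; exact: tower_measurable.
apply: (@le_trans _ _ (\int[lam]_(x in T) (\sum_(i < N) `|tower i x|%:E))%E).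
  rewrite integral_mkcond [leRHS]integral_mkcond; apply: integral_mono => x _.
    by apply: erestrict_ge0 => y _; rewrite lee_fin; exact: enorm_ge0.
  rewrite !patchE; case: ifPn => [/set_mem/ST xT|_].
    rewrite mem_set// sumEFin lee_fin; apply: le_trans (enorm_le_sum _) _.
    by apply: ler_sum => i _; rewrite mxE.
  by case: ifP => // _; rewrite sumEFin lee_fin sumr_ge0.
rewrite ge0_integral_sum//.
rewrite mulr_natl -[X in _ *+ X]card_ord -sumr_const -sumEFin.
apply: lee_sum => i _; apply: tower_tail => x j xT jk; exact: xT.
Qed.

Lemma height_cvg0 : height k @[k --> \oo] --> (0 : R).
Proof.
apply: (@squeeze_cvgr _ _ _ _ (fun=> 0) (fun k => D * 2^-1 ^+ k)).
- apply: nearW => k; rewrite ltW ?height_gt0//=.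
  by have := height_addn_le k 0; rewrite addn0 /height expr0 expr1n mulr1.
- exact: cvg_cst.
- rewrite -[X in _ --> X](mulr0 D); apply: cvgM; first exact: cvg_cst.
  by apply: cvg_expr; rewrite ger0_norm// invf_lt1// ltr1n.
Qed.

(** For eps between height (k + 1) / 2 and height k / 2 the average is at most a
    constant divided by k + 2, by nbhd_mass. *)
Lemma nbhd_limit :
  ((2 * eps)^-1%:E * \int[lam]_(x in enbhd eps S) (enorm (\row_i tower i x))%:E)%E
    @[eps --> (0 : R)^'+] --> (0 : R)%:E.
Proof.
pose T eps := (\int[lam]_(x in enbhd eps S) (enorm (\row_i tower i x))%:E)%E.
have T0 eps : (0 <= T eps)%E.
  by apply: integral_ge0 => x _; rewrite lee_fin; exact: enorm_ge0.
pose b k := 2 * N%:R * M / k.+2%:R.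
have small k0 eps : 0 < eps -> eps < height k0 / 2 ->
    exists2 t, T eps = t%:E & 0 <= (2 * eps)^-1 * t <= b k0.
  move=> e0 ek0.
  have ex : exists k, height k.+1 / 2 < eps.
    have /cvgrPdist_lt/(_ _ e0)[k _ Hk] := height_cvg0.
    exists k; have := Hk k.+1 (leqnSn k); rewrite sub0r normrN gtr0_norm ?height_gt0//.
    by have := height_gt0 k.+1; lra.
  case: (ex_minnP ex) => k ke kmin.
  have k0k : (k0 <= k)%N.
    rewrite leqNgt; apply/negP => kk0.
    suff : height k0 <= height k.+1 by lra.
    move: kk0; rewrite leq_eqVlt => /predU1P[<-//|/height_lt].
    by have := height_gt0 k0; lra.
  have ek : eps <= height k / 2.
    case: k ke kmin k0k => [|k] ke kmin k0k.
      by move: k0k ek0; rewrite leqn0 => /eqP ->; exact: ltW.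
    by rewrite leNgt; apply/negP => /kmin; rewrite ltnn.
  have h := nbhd_mass ek.
  have Tfin : T eps \is a fin_num.
    by rewrite ge0_fin_numE//; apply: le_lt_trans h _; exact: ltry.
  exists (fine (T eps)); first by rewrite fineK.
  rewrite mulr_ge0 ?fine_ge0 ?invr_ge0 ?mulr_ge0 ?(ltW e0)//=.
  have ht : fine (T eps) <= N%:R * (2 * (M * height k.+1 / k.+2%:R)).
    by rewrite -lee_fin fineK.
  rewrite mulrC ler_pdivrMr ?mulr_gt0//.
  apply: le_trans ht _.
  have -> : N%:R * (2 * (M * height k.+1 / k.+2%:R)) = b k * height k.+1.
    by rewrite /b; move: (k.+2%:R^-1) => A; ring.
  have b0 j : 0 <= b j.
    by apply: divr_ge0 => //; apply: mulr_ge0; [apply: mulr_ge0|exact: ltW].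
  apply: ler_pM => //; first exact/ltW/height_gt0; last by lra.
  rewrite /b; apply: ler_wpM2l; first by apply: mulr_ge0; [apply: mulr_ge0|exact: ltW].
  by rewrite lef_pV2 ?posrE// ler_nat.
apply/fine_cvgP; split.
  near=> eps.
  have e0 : 0 < eps by near: eps; exact: nbhs_right_gt.
  have e1 : eps < height 0 / 2 by near: eps; apply: nbhs_right_lt; exact: vortex_radius_gt0.
  have [t Et _] := small 0%N eps e0 e1.
  by rewrite -/(T eps) Et.
apply/cvgrPdist_lt => e e0.
have [k0 bk0] : exists k, b k < e.
  have h : b k @[k --> \oo] --> (0 : R).
    rewrite -[X in _ --> X](mulr0 (2 * N%:R * M)); apply: cvgM; first exact: cvg_cst.
    by have h := @cvg_harmonic R; rewrite -cvg_shiftS in h; exact: h.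
  have /cvgrPdist_lt/(_ _ e0)[k _ Hk] := h; exists k.
  by have := Hk k (leqnn k); rewrite sub0r normrN; apply: le_lt_trans; exact: ler_norm.
near=> eps.
have e1 : 0 < eps by near: eps; exact: nbhs_right_gt.
have e2 : eps < height k0 / 2 by near: eps; apply: nbhs_right_lt; exact: vortex_radius_gt0.
have [t Et /andP[t0 tb]] := small k0 eps e1 e2.
rewrite -[X in _ - X]/(fine ((2 * eps)^-1%:E * T eps)%E) Et/= sub0r normrN ger0_norm//.
exact: le_lt_trans bk0.
Unshelve. all: by end_near. Qed.

End mollified.

End tower_of_vortices.

(** * The profile of a vortex *)

Lemma nneseries_harmonic_pinfty {R : realType} (c : R) j : 0 < c ->
  (\sum_(0 <= k <oo) (c / (k + j).+1%:R)%:E = +oo)%E.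
Proof.
move=> c0; apply: contrapT => /eqP; rewrite -ltey => soo.
have u0 k : 0 <= c / (k + j).+1%:R by rewrite divr_ge0// ltW.
set s := (\sum_(0 <= k <oo) _)%E in soo.
have sf : s \is a fin_num.
  by rewrite ge0_fin_numE//; apply: nneseries_ge0 => k _ _; rewrite lee_fin.
apply: (@dvg_harmonic R); apply: nondecreasing_is_cvgn.
  by apply/nondecreasing_seqP => k; rewrite !seriesEnat/= big_nat_recr//= lerDl.
exists (j.+1%:R / c * fine s) => _ [N _ <-]; rewrite seriesEnat/=.
apply: (@le_trans _ _ (\sum_(0 <= k < N) j.+1%:R / c * (c / (k + j).+1%:R))).
  apply: ler_sum => k _.
  rewrite mulrA divfK ?gt_eqF// ler_pdivlMr// ler_pdivrMl//.
  by rewrite -natrM ler_nat; nia.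
rewrite -mulr_sumr; apply: ler_wpM2l; first by rewrite divr_ge0// ltW.
by rewrite -lee_fin fineK// -sumEFin; apply: nneseries_lim_ge => i _ _; rewrite lee_fin.
Qed.

Lemma le_sum_term {R : realDomainType} n (f : 'I_n -> R) i :
  (forall j, 0 <= f j) -> f i <= \sum_(j < n) f j.
Proof. by move=> f0; rewrite (bigD1 i)//= lerDl sumr_ge0. Qed.

Section curl_field.
Context {R : realType} {n : nat}.
Local Notation V := 'rV[R]_n.
Variables (rho : V -> R) (i0 i1 : 'I_n).
Hypothesis i01 : i0 != i1.
Hypothesis srho : smooth rho.
Hypothesis rho_off : vanishes_off 1 rho.
Hypothesis drho_off : forall i, vanishes_off 1 (partial i rho).

(** The gradient of rho in the plane of the coordinates i0 and i1, turned by a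
    right angle. *)
Definition curl_field (i : 'I_n) (x : V) : R :=
  if i == i0 then partial i1 rho x
  else if i == i1 then - partial i0 rho x else 0.

Lemma curl_field_cont i : continuous (curl_field i).
Proof.
have c k : continuous (partial k rho) := smooth_cont (smooth_partial k srho).
rewrite /curl_field; case: (i == i0); first exact: c.
case: (i == i1); last exact: fun_continuous_cst.
rewrite (_ : (fun x => _) = (fun x => 0 - partial i0 rho x)).
  by apply: fun_continuousB; [exact: fun_continuous_cst|exact: c].
by apply/funext => x; rewrite sub0r.
Qed.

Lemma curl_field_off i : vanishes_off 1 (curl_field i).
Proof.
move=> x x1; rewrite /curl_field; case: ifP => _; first exact: drho_off.
by case: ifP => _ //; rewrite drho_off// oppr0.
Qed.

Lemma partial_bounded : exists2 M, 0 < M & forall i x, `|partial i rho x| <= M.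
Proof.
pose S x := \sum_(i < n) `|partial i rho x|.
have cS : continuous S.
  by apply: fun_continuous_sum => i; apply: fun_continuous_norm; apply: smooth_cont; exact: smooth_partial.
have S_off : vanishes_off 1 S by move=> x x1; apply: big1 => i _; rewrite drho_off// normr0.
have [M M0 SM] := vanishing_bounded cS S_off.
exists M => // i x; have := le_trans (ler_norm _) (SM x); apply: le_trans.
exact: (le_sum_term (f := fun i => `|partial i rho x|)).
Qed.

Lemma partial2_bounded : exists2 M, 0 < M & forall i k x, `|partial k (partial i rho) x| <= M.
Proof.
pose S x := \sum_(i < n) \sum_(k < n) `|partial k (partial i rho) x|.
have cS : continuous S.
  apply: fun_continuous_sum => i; apply: fun_continuous_sum => k; apply: fun_continuous_norm; apply: smooth_cont.
  by apply: smooth_partial; exact: smooth_partial.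
have S_off : vanishes_off (1 + 1) S.
  move=> x x1; apply: big1 => i _; apply: big1 => k _.
  rewrite (vanishes_off_partial k (drho_off i)) ?normr0//.
  by apply: lt_le_trans x1; rewrite ltrDl.
have [M M0 SM] := vanishing_bounded cS S_off.
exists M => // i k x; have := le_trans (ler_norm _) (SM x); apply: le_trans.
apply: le_trans (le_sum_term (f := fun k => `|partial k (partial i rho) x|) k _) _ => //.
by apply: (le_sum_term (f := fun i => \sum_(k < n) `|partial k (partial i rho) x|)) => l; exact: sumr_ge0.
Qed.

Lemma curl_field_bounded : exists2 M, 0 < M & forall i x, `|curl_field i x| <= M.
Proof.
have [M M0 h] := partial_bounded; exists M => // i x; rewrite /curl_field.
by case: ifP => // _; case: ifP => _; rewrite ?normrN ?normr0// ltW.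
Qed.

Lemma curl_field_lipschitz :
  exists2 L, 0 < L & forall i x y, `|curl_field i x - curl_field i y| <= L * `|x - y|.
Proof.
have [M M0 h] := partial2_bounded; exists (n%:R * M + 1).
  by rewrite ltr_wpDl// mulr_ge0// ltW.
have lip i x y : `|partial i rho x - partial i rho y| <= (n%:R * M + 1) * `|x - y|.
  apply: (@le_trans _ _ (n%:R * M * `|x - y|)).
    apply: lipschitz_of_partial; last exact: h.
    by move=> k z; apply: smooth_derivable; exact: smooth_partial.
  by rewrite ler_wpM2r// lerDl.
move=> i x y; rewrite /curl_field; case: ifP => _; first exact: lip.
case: ifP => _; first by rewrite opprK addrC distrC; exact: lip.
by rewrite subrr normr0 mulr_ge0// addr_ge0// mulr_ge0// ltW.
Qed.

Lemma curl_field_div a (t : R) phi : t != 0 -> smooth phi ->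
  (\int[lebesgue_rV R n]_x
     (\sum_(i < n) curl_field i (a + t *: x) * partial i phi x)%:E = 0)%E.
Proof.
move=> t0 sphi.
pose u x := rho (a + t *: x).
have su : smooth u by exact: smooth_affine.
pose r := (1 + `|a|) / `|t|.
have u0 : vanishes_off r u.
  move=> x xr; apply: rho_off.
  have t1 : 0 < `|t| by rewrite normr_gt0.
  have h1 := ler_normB (a + t *: x) a; rewrite addrAC subrr add0r normrZ in h1.
  have h2 : 1 + `|a| <= `|x| * `|t| by rewrite -ler_pdivrMr.
  by rewrite mulrC in h1; lra.
have pu i : partial i u = (fun x => t * partial i rho (a + t *: x)).
  by apply: partial_affine => x; exact: smooth_derivable.
have I := integral_curl i0 i1 su u0 sphi.
pose w x := partial i1 u x * partial i0 phi x - partial i0 u x * partial i1 phi x.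
have iw : (lebesgue_rV R n).-integrable setT (EFin \o w).
  apply: (@vanishing_integrable _ _ (r + 1)).
    by apply: fun_continuousB; apply: fun_continuousM; apply: smooth_cont; exact: smooth_partial.
  move=> x xr; have xr' : r < `|x| by apply: lt_le_trans xr; rewrite ltrDl.
  by rewrite /w !(vanishes_off_partial _ u0 xr') !mul0r subrr.
transitivity (\int[lebesgue_rV R n]_x ((t^-1)%:E * (w x)%:E))%E.
  apply: eq_integral => x _; rewrite -EFinM; congr EFin.
  rewrite (bigD1 i0)//= (bigD1 i1)/=; last by rewrite eq_sym.
  rewrite big1 ?addr0 => [|i /andP[h1 h2]]; last first.
    by rewrite /curl_field (negbTE h1) (negbTE h2) mul0r.
  rewrite /curl_field eqxx eq_sym (negbTE i01) eqxx /w !pu.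
  move: (partial i1 rho _) (partial i0 phi x) (partial i0 rho _) (partial i1 phi x) => A1 A2 A3 A4.
  by field.
by rewrite integralZl// I mule0.
Qed.

(** Along the axis i1, rho grows from 0 at distance 1 to rho 0, so its derivative
    takes the value rho 0. *)
Lemma curl_field_positive : 0 < rho 0 -> exists a (ga ka : R),
  [/\ 0 < ga, 0 < ka & forall x, `|a - x| < ka -> ga <= curl_field i0 x].
Proof.
move=> rho0.
pose e : V := delta_mx ord0 i1.
have e1 : 1 <= `|e|.
  by apply: le_trans (coord_le_norm e i1); rewrite !mxE !eqxx normr1.
have de s : derivable rho (- e + s *: e) e by exact: smooth_derivable.
have [c _] := line_mvt (x := - e) ler01 de.
have re : rho (- e) = 0 by apply: rho_off; rewrite normrN.
rewrite scale1r addNr mulr1 re subr0 => E.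
have cp : continuous (partial i1 rho) by apply: smooth_cont; exact: smooth_partial.
have r2 : 0 < rho 0 / 2 by rewrite divr_gt0.
have /cvgrPdist_lt/(_ _ r2)/nbhs_ballP[ka /= ka0 H] := cp (- e + c *: e).
exists (- e + c *: e), (rho 0 / 2), ka; split => // x xa.
rewrite /curl_field eqxx.
have := H x; rewrite -ball_normE /ball_/= => /(_ xa).
rewrite -[partial i1 rho (- e + _)]/('D_e rho (- e + c *: e)) -E ltr_norml => /andP[_ h].
by move: (partial i1 rho x) h => y h; lra.
Qed.

End curl_field.

(** * Points at prescribed distance from the boundary *)

Section touching.
Context {R : realType} {n : nat}.
Local Notation V := 'rV[R]_n.+1.
Variable Omega : set V.
Hypothesis oOmega : open Omega.
Hypothesis Omega0 : Omega !=set0.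
Hypothesis bOmega : bounded_set Omega.

Lemma frontier_bounded : bounded_set (frontier Omega).
Proof.
have [M [_ HM]] := bOmega.
exists (`|M| + 1); split; first exact: num_real.
move=> M' MM' x [+ _].
suff : closure Omega `<=` [set x | `|x| <= `|M| + 1].
  by move=> /(_ x) h /h /= xM; apply: le_trans xM (ltW MM').
have cl : closed [set x : V | `|x| <= `|M| + 1].
  rewrite (_ : [set y | _] = (fun y : V => `|y|) @^-1` [set t | t <= `|M| + 1])//.
  by apply: closed_comp => [y _|]; [exact: norm_continuous|exact: closed_le].
rewrite ((closure_id _).1 cl); apply: closureS => y Oy.
apply: (HM (`|M| + 1)) => //.
by rewrite (le_lt_trans (ler_norm M))// ltrDl.
Qed.

(** On a line through a point of Omega, the end of Omega in one direction is a
    boundary point. *)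
Lemma frontier_nonempty : frontier Omega !=set0.
Proof.
have [p0 Op0] := Omega0.
have [M [_ HM]] := bOmega.
pose e : V := delta_mx ord0 ord0.
have e1 : 1 <= `|e|.
  by apply: le_trans (coord_le_norm e ord0); rewrite !mxE !eqxx normr1.
have e0 : 0 < `|e| by apply: lt_le_trans e1.
pose T : set R := [set t | Omega (p0 + t *: e)].
have T0 : T 0 by rewrite /T/= scale0r addr0.
have Tub t : T t -> t <= `|M| + 1 + `|p0|.
  move=> /(HM (`|M| + 1)) h.
  have M1 : M < `|M| + 1 by rewrite (le_lt_trans (ler_norm M))// ltrDl.
  have := h M1 => /= h1.
  have h2 := ler_normB (p0 + t *: e) p0; rewrite addrAC subrr add0r normrZ in h2.
  have h3 : t <= `|t| * `|e|.
    by apply: le_trans (ler_norm t) _; rewrite ler_peMr.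
  lra.
have hs : has_sup T by split; [exists 0|exists (`|M| + 1 + `|p0|) => t; exact: Tub].
pose s := sup T.
exists (p0 + s *: e); split.
  move=> B /nbhs_ballP[r /= r0 rB].
  have re : 0 < r / `|e| by rewrite divr_gt0.
  have [t Tt st] := sup_adherent re hs.
  exists (p0 + t *: e); split => //; apply: rB.
  rewrite -ball_normE /ball_/= opprD addrACA subrr add0r -scalerBl normrZ.
  have ts : t <= s by apply: sup_upper_bound.
  rewrite ger0_norm ?subr_ge0// -ltr_pdivlMr//.
  by rewrite -/s in st; lra.
move=> /nbhs_ballP[r /= r0 rO].
pose t := s + r / `|e| / 2.
have re : 0 < r / `|e| / 2 by rewrite !divr_gt0.
have Tt : T t.
  apply: rO; rewrite -ball_normE /ball_/= opprD addrACA subrr add0r -scalerBl normrZ.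
  rewrite /t opprD addrA subrr add0r normrN ger0_norm ?ltW//.
  by rewrite mulrAC divfK ?gt_eqF// ltr_pdivrMr// ltr_pMr// ltr1n.
have : t <= s by apply: sup_upper_bound.
by rewrite /t; lra.
Qed.

(** The point q is a point of the boundary nearest to a point p0 of Omega, and
    p t is the point of the segment from q to p0 at distance t from q. The open
    ball of radius r about p0 misses the boundary, and it contains the open ball
    of radius t about p t. *)
Lemma touching_segment : exists q (p : R -> V) (r : R),
  [/\ frontier Omega q, 0 < r, forall t, 0 < t -> `|p t - q| = t &
    forall t x, 0 < t -> t <= r -> frontier Omega x -> t <= `|x - p t|].
Proof.
have [p0 Op0] := Omega0.
have cF : compact (frontier Omega).
  by apply: bounded_closed_compact; [exact: frontier_bounded|exact: frontier_closed].
have cf : {within frontier Omega, continuous (fun x : V => `|x - p0|)}.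
  apply: continuous_subspaceT.
  have cB : continuous (fun x : V => x - p0).
    by move=> x; apply: (@cvgB R V _ (nbhs x)); [exact: cvg_id|exact: cvg_cst].
  move=> x; apply: (@continuous_comp _ _ _ (fun x : V => x - p0) (fun y : V => `|y|)).
    exact: cB.
  exact: norm_continuous.
have [q /set_mem Fq qmin] := compact_EVT_min frontier_nonempty cF cf.
have r0 : 0 < `|q - p0|.
  rewrite normr_gt0 subr_eq0; apply/eqP => qp0.
  by apply: (frontierN oOmega Fq); rewrite qp0.
pose r := `|q - p0|.
exists q, (fun t => q + (t / r) *: (p0 - q)), r; split => // [t t0|t x t0 tr Fx].
  rewrite addrAC subrr add0r normrZ (distrC p0) -/r gtr0_norm ?divr_gt0//.
  by rewrite divfK// gt_eqF.
have h1 : r <= `|x - p0| by apply: qmin; rewrite inE.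
have h2 := ler_distD (q + (t / r) *: (p0 - q)) x p0.
have h3 : `|q + (t / r) *: (p0 - q) - p0| = r - t.
  have -> : q + (t / r) *: (p0 - q) - p0 = (1 - t / r) *: (q - p0).
    by rewrite scalerBl scale1r -scalerN opprB addrAC.
  rewrite normrZ -/r ger0_norm; last by rewrite subr_ge0 ler_pdivrMr// mul1r.
  by rewrite mulrBl mul1r divfK// gt_eqF.
by rewrite h3 in h2; lra.
Qed.

End touching.

(** * The integral of the majorant over the boundary *)

Section mollifier_facts.
Context {R : realType} {n : nat}.
Local Notation V := 'rV[R]_n.
Variable rho : V -> R.
Hypothesis test_rho : test_function (eball 0 1) rho.

Lemma closed_support_norm x : 1 <= `|x| -> ~ closed_support rho x.
Proof.
move=> x1 cx; have [_ _ sub] := test_rho.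
have := sub _ cx; rewrite /eball/= subr0 ltNge => /negP; apply.
exact: le_trans x1 (norm_le_enorm x).
Qed.

Lemma support_eq0 x : ~ closed_support rho x -> rho x = 0.
Proof.
move=> cx; apply/eqP/negP => /negP rx; apply: cx.
by apply: (@subset_closure _ [set y | rho y != 0]).
Qed.

Lemma mollifier_off : vanishes_off 1 rho.
Proof. by move=> x x1; apply: support_eq0; exact: closed_support_norm. Qed.

Lemma mollifier_partial_off i : vanishes_off 1 (partial i rho).
Proof.
move=> x x1; apply: (@partial_eq0 _ _ rho (closed_support rho)).
- exact: closed_closure.
- exact: support_eq0.
- exact: closed_support_norm.
Qed.

End mollifier_facts.

Lemma majorant_ge_series {R : realType} n (rho : 'rV[R]_n -> R) (delta : R^nat)
    (f : 'rV[R]_n -> R) x :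
  (\sum_(0 <= k <oo) `|mollify rho delta f k.+2 x - mollify rho delta f k.+1 x|%:E
   <= majorant rho delta f x)%E.
Proof.
rewrite /majorant.
have -> : (\sum_(1 <= k <oo) `|mollify rho delta f k.+1 x - mollify rho delta f k x|%:E =
   \sum_(0 <= k <oo) `|mollify rho delta f k.+2 x - mollify rho delta f k.+1 x|%:E)%E.
  rewrite -(@nneseries_addn _ (fun k => `|mollify rho delta f k.+1 x - mollify rho delta f k x|%:E) 1).
    by apply: eq_eseriesr => k _; rewrite addn1.
  by move=> k; rewrite lee_fin.
by rewrite -addeA addeCA leeDl// adde_ge0// lee_fin.
Qed.

Lemma majorant_ge0 {R : realType} n (rho : 'rV[R]_n -> R) (delta : R^nat)
    (f : 'rV[R]_n -> R) x : (0 <= majorant rho delta f x)%E.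
Proof.
by apply: le_trans (majorant_ge_series _ _ _ _); apply: nneseries_ge0 => k _ _; rewrite lee_fin.
Qed.

(** The simple functions below h have integrals that grow like the partial sums
    of the harmonic series. *)
Lemma integral_pinfty_of_pieces d (T : measurableType d) (R : realType)
    (mu : {measure set T -> \bar R}) (S : set T) (A : nat -> set T) (al : nat -> R)
    (c : R) (h : T -> \bar R) :
  measurable S -> (forall k, measurable (A k)) -> (forall k, 0 <= al k) -> 0 < c ->
  (forall k, (c / (k + 2).+1%:R)%:E <= (al k)%:E * mu (S `&` A k))%E ->
  (forall x, S x -> \sum_(0 <= k <oo) (al k * \1_(A k) x)%:E <= h x)%E ->
  (\int[mu]_(x in S) h x = +oo)%E.
Proof.
move=> mS mA al0 c0 hA hh; apply/eqP; rewrite eq_le leey/=.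
apply: (@le_trans _ _ (\int[mu]_(x in S) \sum_(0 <= k <oo) (al k * \1_(A k) x)%:E)%E); last first.
  apply: integral_mono => x Sx; last exact: hh.
  by apply: nneseries_ge0 => k _ _; rewrite lee_fin mulr_ge0.
rewrite integral_nneseries//; last 2 first.
- move=> k; apply/measurable_EFinP; apply: measurable_funM => //.
- by move=> k x _; rewrite lee_fin mulr_ge0.
rewrite -(nneseries_harmonic_pinfty 2 c0).
apply: lee_nneseries => k _; first by rewrite lee_fin divr_ge0// ltW.
rewrite (integralZl_indic mS (fun=> A k))//; last first.
  by move=> ak; have := al0 k; rewrite leNgt ak.
rewrite integral_indic// setIC.
exact: hA.
Qed.

Lemma hausdorff_integral_pinfty {R : realType} n m (S : set 'rV[R]_n)
    (A : nat -> set 'rV[R]_n) (al : nat -> R) (c : R) (h : 'rV[R]_n -> \bar R) :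
  closed S -> (forall k, closed (A k)) -> (forall k, 0 <= al k) -> 0 < c ->
  (forall k, (c / (k + 2).+1%:R)%:E <= (al k)%:E * hausdorff_outer m (S `&` A k))%E ->
  (forall x, S x -> \sum_(0 <= k <oo) (al k * \1_(A k) x)%:E <= h x)%E ->
  (\int[hausdorff_measure R n m]_(x in S) h x = +oo)%E.
Proof.
move=> cS cA al0 c0 hA hh.
apply: (@integral_pinfty_of_pieces _ _ R (hausdorff_measure R n m) S A al c h _ _ al0 c0 hA hh).
  exact: hausdorff_measurable_closed.
by move=> k; exact: hausdorff_measurable_closed.
Qed.

Lemma abs_pos_sub {R : realDomainType} (a b : R) : `|Num.max a 0 - Num.max b 0| <= `|a - b|.
Proof.
have [a0|a0] := leP a 0; have [b0|b0] := leP b 0.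
- by rewrite subrr normr0.
- rewrite sub0r normrN gtr0_norm// distrC ger0_norm ?subr_ge0; lra.
- rewrite subr0 gtr0_norm// ger0_norm ?subr_ge0; lra.
- by [].
Qed.

Lemma abs_neg_sub {R : realDomainType} (a b : R) : `|Num.max (- a) 0 - Num.max (- b) 0| <= `|a - b|.
Proof. by apply: le_trans (abs_pos_sub _ _) _; rewrite opprK addrC distrC. Qed.

Lemma closed_norm_le {R : realType} n (q : 'rV[R]_n) (r : R) :
  closed [set y | `|y - q| <= r].
Proof.
rewrite (_ : [set y | _] = closed_ball_ Num.norm q r); first exact: closed_closed_ball_.
by apply/seteqP; split => y /=; rewrite distrC.
Qed.

Theorem corollary4p6 (R : realType) (n : nat) (n_ge2 : (2 <= n)%N)
    (rho : 'rV[R]_n -> R) (rho_mollifier : standard_mollifier rho)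
    (Omega : set 'rV[R]_n) (Omega_lip : bounded_lipschitz_domain Omega) :
  exists (F : 'rV[R]_n -> 'rV[R]_n) (h : 'rV[R]_n -> \bar R),
    [/\ integrable_field F,
        divergence_free F,
        precise_majorant rho F h,
        (\int[hausdorff_measure R n n.-1]_(x in frontier Omega) h x = +oo)%E
      & exists l : R,
          ((2 * eps)^-1%:E *
            \int[lebesgue_rV R n]_(x in enbhd eps (frontier Omega))
              (enorm (F x))%:E)%E @[eps --> 0^'+] --> l%:E].
Proof.
case: n n_ge2 rho rho_mollifier Omega Omega_lip => [//|[//|m]] n_ge2 rho rho_mollifier Omega.
move=> [ne_Omega oOmega _ bOmega lipOmega].
set N := m.+2 in rho rho_mollifier Omega ne_Omega oOmega bOmega lipOmega *.
have [test_rho rho0 _ rho1 rho00] := rho_mollifier.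
have [srho _ _] := test_rho.
have crho := smooth_cont srho.
have roff := mollifier_off test_rho.
have droff := mollifier_partial_off test_rho.
have [Mr Mr0 rhoM'] := vanishing_bounded crho roff.
have rhoM x : rho x <= Mr by apply: le_trans (ler_norm _) (rhoM' x).
pose i0 : 'I_N := ord0.
pose i1 : 'I_N := lift ord0 ord0.
have i01 : i0 != i1 by [].
pose G := curl_field rho i0 i1.
have cG i : continuous (G i) by exact: curl_field_cont.
have Goff i : vanishes_off 1 (G i) by exact: curl_field_off.
have [M M0 GM] : exists2 M, 0 < M & forall i x, `|G i x| <= M by exact: curl_field_bounded.
have [L L0 GL] : exists2 L, 0 < L & forall i x y, `|G i x - G i y| <= L * `|x - y|.
  exact: curl_field_lipschitz.
have Gdiv a (t : R) phi : t != 0 -> smooth phi ->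
    (\int[lebesgue_rV R N]_x (\sum_(i < N) G i (a + t *: x) * partial i phi x)%:E = 0)%E.
  exact: curl_field_div.
have [a [ga [ka [ga0 ka0 Gmin]]]] : exists a (ga ka : R),
    [/\ 0 < ga, 0 < ka & forall x, `|a - x| < ka -> ga <= G i0 x].
  exact: curl_field_positive.
have rmin0 : 0 < rho 0 / 2 by rewrite divr_gt0.
have [r0 r00 rhomin] : exists2 r0 : R, 0 < r0 & forall x, `|x| < r0 -> rho 0 / 2 <= rho x.
  have /cvgrPdist_lt/(_ _ rmin0)/nbhs_ballP[r0 /= r00 H] := crho 0.
  exists r0 => // x xr; have := H x; rewrite -ball_normE /ball_/= sub0r normrN => /(_ xr).
  by rewrite ltr_norml => /andP[_]; lra.
have [q [pt [r [Fq rgt ptq ptF]]]] := touching_segment oOmega ne_Omega bOmega.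
have [cd [r1 [cd0 r10 density]]] := lipschitz_frontier_density oOmega Fq (lipOmega q Fq).
(* The vortex k is within 3 height k of the boundary points that are within
   height k of q, so C r0 has to exceed 3. *)
pose C := 4 / r0.
have C0 : 0 < C by rewrite divr_gt0.
have Cr0 : 3 < C * r0 by rewrite /C divfK ?gt_eqF//; lra.
pose av := ga * (rho 0 / 2) * ka ^+ N * C ^- N.
have CN0 : 0 < C ^- N by rewrite invr_gt0 exprn_gt0.
have av0 : 0 < av.
  by apply: mulr_gt0 => //; apply: mulr_gt0; [exact: mulr_gt0|exact: exprn_gt0].
pose bv := C ^- N * Mr * (2 * M).
have bv0 : 0 < bv by apply: mulr_gt0; [exact: mulr_gt0|exact: mulr_gt0].
(* The three bounds give disjoint supports, kernels that do not reach the
   earlier vortices, and jumps that are not cancelled. *)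
pose th := Num.min 2^-1 (Num.min (2 * C)^-1 (av / (4 * bv))).
have th0 : 0 < th.
  rewrite !lt_min; apply/and3P; split; first by rewrite invr_gt0.
    by rewrite invr_gt0 mulr_gt0.
  by rewrite divr_gt0// mulr_gt0.
have th2 : th <= 2^-1 by rewrite /th ge_min lexx.
have th1 : th <= 1 by apply: le_trans th2 _; rewrite invf_le1// ler1n.
have thsq : th ^+ 2 <= th by rewrite expr2 ger_pMl.
have Cth : 2 * C * th ^+ 2 <= 1.
  apply: (@le_trans _ _ (2 * C * th)); first by rewrite ler_pM2l// mulr_gt0.
  have t1 : th <= (2 * C)^-1.
    by rewrite /th ge_min; apply/orP; right; rewrite ge_min lexx.
  have C2 : 0 < 2 * C by rewrite mulr_gt0.
  by apply: (@le_trans _ _ (2 * C * (2 * C)^-1)); rewrite ?ler_pM2l// mulfV// gt_eqF.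
have bth : 4 * bv * th ^+ 2 <= av.
  apply: (@le_trans _ _ (4 * bv * th)); first by rewrite ler_pM2l// mulr_gt0.
  have t1 : th <= av / (4 * bv).
    by rewrite /th ge_min; apply/orP; right; rewrite ge_min lexx orbT.
  have b4 : 0 < 4 * bv by rewrite mulr_gt0.
  by rewrite mulrC -ler_pdivlMr.
pose B := L * C + M.
have LC0 : 0 < L * C by exact: mulr_gt0.
have B0 : 0 < B by exact: addr_gt0.
have LB : L * C <= B by rewrite /B lerDl ltW.
have MB : M <= B by rewrite /B lerDr ltW.
(* The heights stay in the range where the distance to the boundary and its
   density are known, and the mollifications converge fast enough. *)
pose D := Num.min r (Num.min (r1 / 2) (8 * B)^-1).
have D0 : 0 < D.
  rewrite !lt_min rgt/=; apply/andP; split; first by rewrite divr_gt0.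
  by rewrite invr_gt0 mulr_gt0.
have Dr : D <= r by rewrite /D ge_min lexx.
have Dr1 : D < r1.
  apply: (@le_lt_trans _ _ (r1 / 2)); last by rewrite ltr_pdivrMr// ltr_pMr// ltr1n.
  by rewrite /D ge_min; apply/orP; right; rewrite ge_min lexx.
have BD : 8 * B * D <= 1.
  have t1 : D <= (8 * B)^-1.
    by rewrite /D ge_min; apply/orP; right; rewrite ge_min lexx orbT.
  have B8 : 0 < 8 * B by rewrite mulr_gt0.
  by apply: (@le_trans _ _ (8 * B * (8 * B)^-1)); rewrite ?ler_pM2l// mulfV// gt_eqF.
pose d := height D th.
have d0 j : 0 < d j by exact: height_gt0.
have dD j : d j <= D.
  rewrite /d /height -[leRHS]mulr1 ler_pM2l//.
  have /andP[t0 t1] := th_exp_le1 th0 th2 j; by rewrite expr_le1.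
pose p j := pt (d j).
have pq j : `|p j - q| = height D th j by exact: ptq.
have Sp x j : frontier Omega x -> height D th j <= `|x - p j|.
  by move=> Fx; apply: ptF => //; exact: le_trans Dr.
pose f := tower p D th G.
have mf i : measurable_fun setT (f i : _ -> measurableTypeR R).
  exact: (tower_measurable D0 th0 th2 pq cG Goff).
have fi i : (lebesgue_rV R N).-integrable setT (EFin \o f i).
  exact: (tower_integrable D0 th0 th2 pq M0 cG GM Goff).
pose field x : 'rV[R]_N := \row_i f i x.
have fieldE i : component field i = f i by apply/funext => x; rewrite /component mxE.
pose delta k := C * d k.
pose h x := (\sum_(i < N) (majorant rho delta (component field i)^\+%R x
           + majorant rho delta (component field i)^\-%R x))%E.
have delta0 k : 0 < delta k by exact: mulr_gt0.
have dlt k : 4 * d k.+1 <= d k by exact: height_lt.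
have fast i (g : 'rV[R]_N -> R) : measurable_fun setT (g : _ -> measurableTypeR R) ->
    (forall x, 0 <= g x) -> (lebesgue_rV R N).-integrable setT (EFin \o g) ->
    (forall x y, `|g x - g y| <= `|f i x - f i y|) -> fast_approximation rho delta g.
  move=> mg g0 ig gf k _.
  exact: (mollified_L1 D0 th0 th2 pq M0 L0 cG GM GL Goff crho rho0 rhoM roff C0 k rho1 mg g0 ig gf LB MB BD).
exists field, h; split.
- by move=> i; rewrite fieldE.
- move=> phi tphi.
  have := tower_divergence D0 th0 th2 pq M0 cG GM Goff Gdiv tphi.
  move=> <-; apply: eq_integral => x _; congr EFin; apply: eq_bigr => i _.
  by rewrite fieldE.
- exists delta; split => //.
  + split => //.
      apply/decreasing_seqP => k; rewrite /delta ltr_pM2l//.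
      by apply: lt_le_trans (dlt k); rewrite ltr_pMl// ltr1n.
    by rewrite -(mulr0 C); apply: cvgM; [exact: cvg_cst|exact: height_cvg0].
  + move=> i; rewrite fieldE; apply: (fast i).
    * by apply: measurable_funrpos; exact: mf.
    * by move=> x; exact: funrpos_ge0.
    * apply: le_integrable (fi i) => //.
        by apply/measurable_EFinP; apply: measurable_funrpos; exact: mf.
      move=> x _ /=; rewrite lee_fin ger0_norm ?funrpos_ge0//.
      by rewrite /funrpos ge_max ler_norm normr_ge0.
    * by move=> x y; exact: abs_pos_sub.
  + move=> i; rewrite fieldE; apply: (fast i).
    * by apply: measurable_funrneg; exact: mf.
    * by move=> x; exact: funrneg_ge0.
    * apply: le_integrable (fi i) => //.
        by apply/measurable_EFinP; apply: measurable_funrneg; exact: mf.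
      move=> x _ /=; rewrite lee_fin ger0_norm ?funrneg_ge0//.
      by rewrite /funrneg ge_max -normrN ler_norm normr_ge0.
    * by move=> x y; exact: abs_neg_sub.
(* The series in the majorant starts with the jump from the scale 1 to the
   scale 2, hence the shift of the indices by 2. *)
- pose A k : set 'rV[R]_N := [set y | `|y - q| <= d k.+2].
  pose al k := av / 2 * (d k.+2 ^- N * d k.+2 / k.+3%:R).
  have al0 k : 0 <= al k.
    rewrite /al; apply: mulr_ge0; first by rewrite divr_ge0// ltW.
    have dk := ltW (d0 k.+2).
    apply: divr_ge0 => //; apply: mulr_ge0 => //.
    by rewrite invr_ge0; exact: exprn_ge0.
  have c0 : 0 < av / 2 * cd by rewrite mulr_gt0// divr_gt0.
  apply: (@hausdorff_integral_pinfty R N N.-1 _ A al (av / 2 * cd)) => //.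
  + exact: frontier_closed.
  + by move=> k; exact: closed_norm_le.
  + move=> k.
    have dk1 : d k.+2 < r1 by exact: le_lt_trans (dD _) Dr1.
    have := density _ (d0 k.+2) dk1.
    move=> /(lee_wpmul2l (_ : 0 <= (al k)%:E)%E) => H.
    apply: le_trans (H _); last by rewrite lee_fin.
    rewrite -EFinM lee_fin addn2 /al.
    have dN : d k.+2 ^+ m.+1 != 0 by rewrite expf_neq0// gt_eqF.
    rewrite le_eqVlt; apply/orP; left; apply/eqP.
    have -> : d k.+2 ^- N * d k.+2 = (d k.+2 ^+ m.+1)^-1.
      by rewrite /N exprSr invfM -mulrA mulVf ?mulr1// gt_eqF.
    rewrite -[in RHS](mulfVK dN cd).
    by move: (k.+3%:R^-1) (d k.+2 ^+ m.+1) dN => U W W0; field.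
  + move=> x Fx.
    apply: (@le_trans _ _ (majorant rho delta (component field i0)^\+%R x)); last first.
      rewrite /h (bigD1 i0)//= -addeA leeDl// adde_ge0 ?majorant_ge0//.
      by apply: sume_ge0 => i _; rewrite adde_ge0// majorant_ge0.
    apply: le_trans (majorant_ge_series _ _ _ _).
    apply: lee_nneseries => k _; first by rewrite lee_fin mulr_ge0.
    rewrite lee_fin indicE.
    have [xA|xA] := pselect (A k x); last by rewrite memNset// mulr0.
    rewrite mem_set// mulr1 fieldE.
    exact: (mollified_jump D0 th0 th2 pq M0 cG GM Goff rho0 rhoM roff rmin0 rhomin ga0 ka0 Gmin C0 Cr0 Cth Sp n_ge2 Fx xA bth).
- exists 0; exact: (nbhd_limit D0 th0 th2 pq M0 cG GM Goff Sp).
Qed.
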